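(* Let $Q(\xi)=\sum_{j=1}^d \sigma_j\xi_j^2$ on $\mathbb{R}^d$, where the signs $\sigma_1,\dots,\sigma_d\in\{+1,-1\}$ are not all equal, so that the surface $S=\{(\xi,\tau)\in\mathbb{R}^d\times\mathbb{R} : \tau=Q(\xi)\}$ is a hyperbolic paraboloid. Let $1<p<\frac{2(d+1)}{d}$, let $p'=\frac{p}{p-1}$ and let $q=\frac{(d+2)p'}{d}$. Then Gaussians are not critical points of the Fourier extension inequality $$\|Tf\|_{L^q(\mathbb{R}^{d+1})}\le C\,\|f\|_{L^p(\mathbb{R}^d)}$$ associated to $S$ (in case the inequality holds).
   Context: The Fourier extension operator associated to $S$ is $$Tf(x,t)=\int_{\mathbb{R}^d} e^{i x\cdot\xi+i t Q(\xi)} f(\xi)\,\mathrm{d}\xi,\qquad (x,t)\in\mathbb{R}^d\times\mathbb{R},$$ for $f:\mathbb{R}^d\to\mathbb{C}$. That the inequality holds means that it is valid for all $f\in L^p(\mathbb{R}^d)$ with some finite constant $C$ independent of $f$. Critical point: given a Gaussian $G$ on $\mathbb{R}^d$ and $\phi\in C_c^\infty(\mathbb{R}^d)$, put, for $\varepsilon\in\mathbb{R}$ small, $$\Psi_\phi(\varepsilon)=\frac{\|T(G+\varepsilon\phi)\|_{L^q(\mathbb{R}^{d+1})}}{\|G+\varepsilon\phi\|_{L^p(\mathbb{R}^d)}}.$$ The function $G$ is called a critical point of the inequality if $\Psi_\phi'(0)=0$ for every $\phi\in C_c^\infty(\mathbb{R}^d)$. *)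

(* Defs.v *)
From HB Require Import structures.
From mathcomp Require Import all_boot all_order all_algebra.
From mathcomp Require Import complex.
From mathcomp Require Import all_classical all_reals all_analysis.

Set Implicit Arguments.
Unset Strict Implicit.
Unset Printing Implicit Defensive.

Import Order.TTheory GRing.Theory Num.Theory.
Import numFieldNormedType.Exports.

Local Open Scope classical_set_scope.
Local Open Scope ring_scope.

(* The Borel sigma-algebra of R^n, generated by the coordinate maps; this is
   the row-vector counterpart of the library's sigma-algebra on n-tuples.    *)
Section measurable_rV.
Context (R : realType) (n : nat).

Definition rV_coord (i : 'I_n) (x : 'rV[R]_n) : R := x ord0 i.

Let rV_set0 : g_sigma_preimage rV_coord set0.
Proof. exact: sigma_algebra0. Qed.

Let rV_setC A : g_sigma_preimage rV_coord A -> g_sigma_preimage rV_coord (~` A).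
Proof. exact: sigma_algebraC. Qed.

Let rV_bigcup (F : (set 'rV[R]_n)^nat) :
  (forall i, g_sigma_preimage rV_coord (F i)) ->
  g_sigma_preimage rV_coord (\bigcup_i (F i)).
Proof. exact: sigma_algebra_bigcup. Qed.

HB.instance Definition _ := @isMeasurable.Build
  (measure_tuple_display default_measure_display)
  'rV[R]_n (g_sigma_preimage rV_coord) rV_set0 rV_setC rV_bigcup.

End measurable_rV.

Lemma measurable_fun_rV (R : realType) d (T : measurableType d) n
    (f : T -> 'rV[R]_n) :
  (forall i, measurable_fun [set: T] (@rV_coord R n i \o f)) ->
  measurable_fun [set: T] f.
Proof.
move=> mf; have sub : g_sigma_preimage (fun i => @rV_coord R n i \o f)
    `<=` measurable.
  apply: smallest_sub; first exact: sigma_algebra_measurable.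
  case: n => [|n] in f mf *; first by rewrite big_ord0.
  rewrite -bigcup_mkord_ord; apply: bigcup_sub => i Ii.
  by move=> A [B mB <-]; exact: mf.
move=> _ A mA; apply: sub.
by rewrite g_sigma_preimage_comp; exists A.
Qed.

Definition rV_cons (R : realType) (n : nat)
  (xt : 'rV[R]_n * measurableTypeR R) : 'rV[R]_n.+1 :=
  row_mx (xt.2 : R)%:M xt.1.

Lemma measurable_rV_cons (R : realType) (n : nat) :
  measurable_fun [set: 'rV[R]_n * measurableTypeR R] (@rV_cons R n).
Proof.
apply: measurable_fun_rV => i.
case: (split_ordP (i : 'I_(1 + n))) => j ->.
  rewrite (_ : _ \o _ = snd); first exact: measurable_snd.
  apply/funext => xt; apply: etrans (row_mxEl _ _ _ _) _.
  by rewrite !ord1 mxE eqxx mulr1n.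
rewrite (_ : _ \o _ = @rV_coord R n j \o fst); last first.
  by apply/funext => xt; exact: row_mxEr.
apply: measurableT_comp; last exact: measurable_fst.
move=> _ Y mY; rewrite setTI; apply: sub_sigma_algebra => /=.
rewrite -bigcup_seq/=; exists j => /=; first by rewrite mem_index_enum.
by exists Y => //; rewrite setTI.
Qed.

Section lebesgue_rV.
Context (R : realType) (n : nat) (mu : {measure set 'rV[R]_n -> \bar R}).
Local Open Scope ereal_scope.

Definition rV_cons_measure : set 'rV[R]_n.+1 -> \bar R :=
  pushforward (mu \x @lebesgue_measure R) (@rV_cons R n).

HB.instance Definition _ := Measure.copy rV_cons_measure
  (measure_function_pushforward__canonical__measure_function_Measure
     (mu \x @lebesgue_measure R) (@measurable_rV_cons R n)).

End lebesgue_rV.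

(* Lebesgue measure on R^n, obtained by adding one coordinate at a time. *)
Fixpoint lebesgue_rV (R : realType) (n : nat) :
    {measure set 'rV[R]_n -> \bar R} :=
  if n is n'.+1 then rV_cons_measure (lebesgue_rV R n')
  else \d_(0 : 'rV[R]_0).

Section complex_valued.
Context (R : realType).
Local Notation C := R[i].

Definition cexp (z : C) : C :=
  Complex (expR (complex.Re z) * cos (complex.Im z))
          (expR (complex.Re z) * sin (complex.Im z)).

Context d (T : measurableType d) (mu : {measure set T -> \bar R}).

Definition cmeasurable (f : T -> C) : Prop :=
  measurable_fun [set: T] (fun x => complex.Re (f x)) /\
  measurable_fun [set: T] (fun x => complex.Im (f x)).

Definition cintegrable (f : T -> C) : Prop :=
  mu.-integrable [set: T] (fun x => (complex.Re (f x))%:E) /\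
  mu.-integrable [set: T] (fun x => (complex.Im (f x))%:E).

Definition cintegral (f : T -> C) : C :=
  Complex (\int[mu]_x complex.Re (f x)) (\int[mu]_x complex.Im (f x)).

Definition cLnorm (p : R) (f : T -> C) : \bar R :=
  Lnorm mu p%:E (fun x => (Normc.normc (f x))%:E).

Definition cLp (p : R) (f : T -> C) : Prop :=
  cmeasurable f /\ (cLnorm p f < +oo)%E.

End complex_valued.

Section extension_operator.
Context (R : realType) (d : nat) (sigma : 'I_d -> R).
Local Notation C := R[i].

Definition dotrV (x y : 'rV[R]_d) : R := \sum_j x ord0 j * y ord0 j.

Definition quadQ (xi : 'rV[R]_d) : R := \sum_j sigma j * xi ord0 j ^+ 2.

(* Lebesgue measure on R^(d+1), seen as R^d * R. *)
Definition lebesgue_spacetime :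
    {measure set ('rV[R]_d * measurableTypeR R) -> \bar R} :=
  (lebesgue_rV R d \x @lebesgue_measure R)%E.

Definition fourier_ext (f : 'rV[R]_d -> C)
    (xt : 'rV[R]_d * measurableTypeR R) : C :=
  cintegral (lebesgue_rV R d) (fun xi =>
    cexp (Complex 0 (dotrV xt.1 xi + (xt.2 : R) * quadQ xi)) * f xi).

(* F is (a representative of) T f for f in L^p: the integral when it converges
   absolutely, and otherwise the L^q limit of T f_n for some f_n in L^1 and L^p
   converging to f in L^p.  The second clause is needed because the defining
   integral need not converge for a general f in L^p, p > 1.                  *)
Definition is_fourier_ext (p q : R) (f : 'rV[R]_d -> C)
    (F : 'rV[R]_d * measurableTypeR R -> C) : Prop :=
  (cintegrable (lebesgue_rV R d) f /\ F = fourier_ext f) \/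
  (~ cintegrable (lebesgue_rV R d) f /\ cmeasurable F /\
   exists f_ : nat -> 'rV[R]_d -> C,
     [/\ forall n, cintegrable (lebesgue_rV R d) (f_ n) /\
                   cLp (lebesgue_rV R d) p (f_ n),
         cLnorm (lebesgue_rV R d) p (fun xi => f_ n xi - f xi) @[n --> \oo]
           --> 0%E &
         cLnorm lebesgue_spacetime q (fun xt => fourier_ext (f_ n) xt - F xt)
           @[n --> \oo] --> 0%E]).

Definition extension_inequality (p q : R) : Prop :=
  exists C0 : R, forall f : 'rV[R]_d -> C, cLp (lebesgue_rV R d) p f ->
    exists2 F, is_fourier_ext p q f F &
      (cLnorm lebesgue_spacetime q F <=
       C0%:E * cLnorm (lebesgue_rV R d) p f)%E.

(* Nonzero multiples of exponentials of complex quadratic polynomials whose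
   quadratic part has negative definite real part.                          *)
Definition is_gaussian (G : 'rV[R]_d -> C) : Prop :=
  exists (A : 'M[C]_d) (b : 'I_d -> C) (c : C),
    [/\ A^T = A,
        forall xi : 'rV[R]_d, xi != 0 ->
          0 < \sum_j \sum_k complex.Re (A j k) * xi ord0 j * xi ord0 k &
        forall xi : 'rV[R]_d, G xi =
          cexp (- (\sum_j \sum_k A j k * (xi ord0 j * xi ord0 k)%:C%C)
                + \sum_j b j * (xi ord0 j)%:C%C + c)].

Definition partial (j : 'I_d) (f : 'rV[R]_d -> R) : 'rV[R]_d -> R :=
  fun x => 'D_(delta_mx ord0 j) f x.

(* All iterated partial derivatives exist everywhere and are continuous. *)
Definition smooth (f : 'rV[R]_d -> R) : Prop :=
  forall s : seq 'I_d, let g := foldr partial f s in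
    continuous g /\ forall j x, derivable g x (delta_mx ord0 j).

Definition test_function (phi : 'rV[R]_d -> C) : Prop :=
  [/\ smooth (fun x => complex.Re (phi x)),
      smooth (fun x => complex.Im (phi x)) &
      compact (closure [set x | phi x != 0])].

Definition Psi (p q : R) (G phi : 'rV[R]_d -> C) (eps : R) : R :=
  let f := fun xi => G xi + eps%:C%C * phi xi in
  fine (cLnorm lebesgue_spacetime q (fourier_ext f)) /
  fine (cLnorm (lebesgue_rV R d) p f).

Definition critical_point (p q : R) (G : 'rV[R]_d -> C) : Prop :=
  forall phi, test_function phi -> is_derive (0 : R) 1 (Psi p q G phi) 0.

End extension_operator.

(* Main.v *)
Require Import Defs.
From HB Require Import structures.
From mathcomp Require Import all_boot all_order all_algebra.
From mathcomp Require Import complex.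
From mathcomp Require Import all_classical all_reals all_analysis.
From mathcomp Require Import measurable_realfun ring lra.

Import Order.TTheory GRing.Theory Num.Theory.
Import numFieldNormedType.Exports.

Local Open Scope classical_set_scope.
Local Open Scope ring_scope.

Set Implicit Arguments.
Unset Strict Implicit.
Unset Printing Implicit Defensive.

(** Write a Gaussian G as the exponential of a complex quadratic polynomial with
    quadratic part -A, and put P = Re A, Pi = P^-1, S = diag(sigma), u = T G.
    At time t the slice u(., t) is the Fourier transform of a Gaussian with
    quadratic part M_t = A - i t S; it is again a Gaussian, with quadratic part
    R_t / 4, where R_t = M_t^-1.

    Suppose that G is critical.  The q-th power integral of T(G + e phi) lies
    above its tangent line in e, and the p-th power integral of G + e phi below a
    parabola, so the derivatives of the two logarithms at e = 0 agree
    ([stationary_quotient]):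
      Re int |u|^(q-2) conj(u) T phi / int |u|^q
        = Re int |G|^(p-2) conj(G) phi / int |G|^p.
    The extension inequality itself makes the left-hand side continuous in phi,
    so cutoffs extend this to phi = exp(i v.xi) G ([el_modulation]).  The
    extension of that function is the translate u(x + v, t), and both sides are
    explicit: up to common phases they are Gaussians in v, by complex contour
    shifts for Gaussian integrals ([cintegral_gauss], [gauss_ft_correlation]).
    The outcome ([el_identity]) is a real weight J of total mass m > 0 such that
      int J(t) exp(- k R_t[v]) dt = m exp(- k' Pi[v])   for all real v,
    where k = (1 - 2/q) / 4, k' = (1/p - 1/q) / 4, and M[v] is the quadratic form
    of M.

    The forms R_t are bounded uniformly in t by Pi ([normc_qf_inv]), so v may be
    scaled to 0.  Writing E for the integral against J, the first two orders
    ([moments_of_exponential]) are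
      k E R_t[v] = k' m Pi[v]   and   k^2 E R_t[v]^2 = k'^2 m Pi[v]^2.
    Polarizing the second identity gives an identity between products of two
    entries of R_t and of Pi.  Now M_t R_t = 1 says S A R_t = S + i t R_t, so a
    suitable contraction with S A turns products of entries into single entries
    and cancels all terms containing t.  For indices i and j with opposite signs
    what remains is R_t(i,i) + R_t(j,j), and the real part of the same contraction
    of Pi is Pi(i,i) + Pi(j,j) > 0.  Comparison with the first moment yields
    k k' = k'^2 ([exponents_agree]).

    Finally p < 2(d+1)/d forces q > p, so k' is nonzero and k = k', that is,
    q = p'; but q = (d+2)p'/d. *)

Local Notation Re := complex.Re.
Local Notation Im := complex.Im.
Local Notation normc := Normc.normc.
Local Notation "k %:c" := (real_complex _ k) (at level 2, format "k %:c").

(** * Complex-valued functions: arithmetic, measurability, integration *)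

Section complex_arithmetic.
Context (R : realType).
Local Notation C := R[i].
Implicit Types (z w : C) (a : R).

Lemma complex_eq z w : Re z = Re w -> Im z = Im w -> z = w.
Proof. by case: z w => [a b] [c d] /= -> ->. Qed.

Lemma ReD z w : Re (z + w) = Re z + Re w. Proof. by case: z w => ? ? []. Qed.
Lemma ImD z w : Im (z + w) = Im z + Im w. Proof. by case: z w => ? ? []. Qed.
Lemma ReN z : Re (- z) = - Re z. Proof. by case: z. Qed.
Lemma ImN z : Im (- z) = - Im z. Proof. by case: z. Qed.
Lemma ReM z w : Re (z * w) = Re z * Re w - Im z * Im w.
Proof. by case: z w => ? ? []. Qed.
Lemma ImM z w : Im (z * w) = Re z * Im w + Im z * Re w.
Proof. by case: z w => ? ? []. Qed.
Lemma ReC a : Re a%:c = a. Proof. by []. Qed.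
Lemma ImC a : Im a%:c = 0. Proof. by []. Qed.
Lemma ReJ z : Re (conjc z) = Re z. Proof. by case: z. Qed.
Lemma ImJ z : Im (conjc z) = - Im z. Proof. by case: z. Qed.
Lemma Re_sum (I : Type) (r : seq I) (P : pred I) (F : I -> C) :
  Re (\sum_(i <- r | P i) F i) = \sum_(i <- r | P i) Re (F i).
Proof. by elim/big_ind2 : _ => // a1 b1 a2 b2 <- <-; rewrite ReD. Qed.
Lemma Im_sum (I : Type) (r : seq I) (P : pred I) (F : I -> C) :
  Im (\sum_(i <- r | P i) F i) = \sum_(i <- r | P i) Im (F i).
Proof. by elim/big_ind2 : _ => // a1 b1 a2 b2 <- <-; rewrite ImD. Qed.

Definition ReImE :=
  (ReD, ImD, ReN, ImN, ReM, ImM, ReJ, ImJ).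

Lemma natCE n : n%:R = (n%:R)%:c :> C.
Proof. by rewrite rmorph_nat. Qed.

Lemma normcE z : normc z = Num.sqrt (Re z ^+ 2 + Im z ^+ 2).
Proof. by case: z. Qed.

Lemma sqr_normcE z : normc z ^+ 2 = Re z ^+ 2 + Im z ^+ 2.
Proof. by rewrite normcE sqr_sqrtr// addr_ge0// sqr_ge0. Qed.

Lemma normc_ge0 z : 0 <= normc z. Proof. by rewrite normcE sqrtr_ge0. Qed.

Lemma normc_eq0 z : (normc z == 0) = (z == 0).
Proof.
apply/eqP/eqP => [/Normc.eq0_normc //|->]; exact: Normc.normc0.
Qed.

Lemma normc_gt0 z : (0 < normc z) = (z != 0).
Proof. by rewrite lt_def normc_eq0 normc_ge0 andbT. Qed.

Lemma normcC a : normc a%:c = `|a|.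
Proof. by rewrite normcE/= expr0n/= addr0 sqrtr_sqr. Qed.

Lemma normcJ z : normc (conjc z) = normc z.
Proof. by rewrite !normcE ReJ ImJ sqrrN. Qed.

Lemma normcD z w : normc (z + w) <= normc z + normc w.
Proof. exact: le_normcD. Qed.

Lemma normcN z : normc (- z) = normc z.
Proof. by rewrite !normcE ReN ImN !sqrrN. Qed.

Lemma ler_Re z : `|Re z| <= normc z.
Proof. by rewrite normcE -sqrtr_sqr ler_wsqrtr// lerDl sqr_ge0. Qed.

Lemma ler_Im z : `|Im z| <= normc z.
Proof. by rewrite normcE -sqrtr_sqr ler_wsqrtr// lerDr sqr_ge0. Qed.

Lemma normc_le_ReIm z : normc z <= `|Re z| + `|Im z|.
Proof.
rewrite -(@ler_pXn2r _ 2) ?nnegrE ?addr_ge0 ?normc_ge0 ?normr_ge0//.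
rewrite sqr_normcE sqrrD !real_normK ?num_real//.
by rewrite lerD2r lerDl mulrn_wge0// mulr_ge0.
Qed.

Lemma mulcJ z : z * conjc z = (normc z ^+ 2)%:c.
Proof. by apply: complex_eq; rewrite !ReImE/= ?sqr_normcE//; ring. Qed.

Lemma ReV z : Re z^-1 = Re z / normc z ^+ 2.
Proof. by rewrite sqr_normcE; case: z. Qed.
Lemma ImV z : Im z^-1 = - Im z / normc z ^+ 2.
Proof. by rewrite sqr_normcE; case: z => a b; rewrite /GRing.inv/= mulNr. Qed.

Lemma cexpE z : cexp z =
  Complex (expR (Re z) * cos (Im z)) (expR (Re z) * sin (Im z)).
Proof. by []. Qed.

Lemma cexpD z w : cexp (z + w) = cexp z * cexp w.
Proof.
apply: complex_eq; rewrite !ReImE /= !ReImE expRD ?cosD ?sinD; ring.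
Qed.

Lemma cexp0 : cexp 0 = 1 :> C.
Proof. by apply: complex_eq; rewrite /= expR0 ?cos0 ?sin0 mul1r. Qed.

Lemma normc_cexp z : normc (cexp z) = expR (Re z).
Proof.
by rewrite normcE /= !exprMn -mulrDr cos2Dsin2 mulr1 sqrtr_sqr ger0_norm.
Qed.

Lemma cexp_neq0 z : cexp z != 0.
Proof. by rewrite -normc_eq0 normc_cexp gt_eqF// expR_gt0. Qed.

Lemma cexpN z : cexp (- z) = (cexp z)^-1.
Proof.
by apply: (mulfI (cexp_neq0 z)); rewrite -cexpD subrr cexp0 divff// cexp_neq0.
Qed.

Lemma cexpC a : cexp a%:c = (expR a)%:c.
Proof. by apply: complex_eq; rewrite /= ?cos0 ?sin0 ?mulr1 ?mulr0. Qed.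

End complex_arithmetic.

Section complex_measurability.
Context d (T : measurableType d) (R : realType).
Local Notation C := R[i].
Implicit Types f g : T -> C.

Lemma cmeasurable_cst (c : C) : cmeasurable (fun _ : T => c).
Proof. by split; exact: measurable_cst. Qed.

Lemma cmeasurableD f g :
  cmeasurable f -> cmeasurable g -> cmeasurable (fun x => f x + g x).
Proof.
move=> [f1 f2] [g1 g2]; split.
- by under eq_fun do rewrite ReD; exact: measurable_funD.
- by under eq_fun do rewrite ImD; exact: measurable_funD.
Qed.

Lemma cmeasurableM f g :
  cmeasurable f -> cmeasurable g -> cmeasurable (fun x => f x * g x).
Proof.
move=> [f1 f2] [g1 g2]; split.
- under eq_fun do rewrite ReM; apply: measurable_funB; exact: measurable_funM.
- under eq_fun do rewrite ImM; apply: measurable_funD; exact: measurable_funM.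
Qed.

Lemma cmeasurableN f : cmeasurable f -> cmeasurable (fun x => - f x).
Proof.
move=> [f1 f2]; split.
- by under eq_fun do rewrite ReN; exact: measurableT_comp.
- by under eq_fun do rewrite ImN; exact: measurableT_comp.
Qed.

Lemma cmeasurableB f g :
  cmeasurable f -> cmeasurable g -> cmeasurable (fun x => f x - g x).
Proof. by move=> mf mg; apply: cmeasurableD => //; exact: cmeasurableN. Qed.

Lemma cmeasurableJ f : cmeasurable f -> cmeasurable (fun x => conjc (f x)).
Proof.
move=> [f1 f2]; split.
- by under eq_fun do rewrite ReJ.
- by under eq_fun do rewrite ImJ; exact: measurableT_comp.
Qed.

Lemma cmeasurableC (h : T -> R) :
  measurable_fun setT h -> cmeasurable (fun x => (h x)%:c).
Proof. by move=> mh; split => //=; exact: measurable_cst. Qed.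

Lemma cmeasurableX f n : cmeasurable f -> cmeasurable (fun x => f x ^+ n).
Proof.
move=> mf; elim: n => [|n ih].
  by under eq_fun do rewrite expr0; exact: cmeasurable_cst.
by under eq_fun do rewrite exprS; exact: cmeasurableM.
Qed.

Lemma cmeasurable_sum (I : Type) (r : seq I) (P : pred I) (F : I -> T -> C) :
  (forall i, P i -> cmeasurable (F i)) ->
  cmeasurable (fun x => \sum_(i <- r | P i) F i x).
Proof.
move=> mF; elim: r => [|i r ih].
  by under eq_fun do rewrite big_nil; exact: cmeasurable_cst.
under eq_fun do rewrite big_cons; case: (boolP (P i)) => // Pi.
by apply: cmeasurableD => //; exact: mF.
Qed.

Lemma cmeasurable_prod (I : Type) (r : seq I) (P : pred I) (F : I -> T -> C) :
  (forall i, P i -> cmeasurable (F i)) ->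
  cmeasurable (fun x => \prod_(i <- r | P i) F i x).
Proof.
move=> mF; elim: r => [|i r ih].
  by under eq_fun do rewrite big_nil; exact: cmeasurable_cst.
under eq_fun do rewrite big_cons; case: (boolP (P i)) => // Pi.
by apply: cmeasurableM => //; exact: mF.
Qed.

Lemma measurable_normc f :
  cmeasurable f -> measurable_fun setT (fun x => normc (f x)).
Proof.
move=> [f1 f2]; under eq_fun do rewrite normcE.
apply: (measurableT_comp (continuous_measurable_fun (@sqrt_continuous R))).
by apply: measurable_funD; exact: measurable_funX.
Qed.

Lemma cmeasurableV f : cmeasurable f -> cmeasurable (fun x => (f x)^-1).
Proof.
move=> mf; have [f1 f2] := mf.
have mV : measurable_fun setT (fun x => (normc (f x) ^+ 2)^-1).
  under eq_fun do rewrite -powR_inv1 ?sqr_ge0//.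
  apply: (@measurableT_comp _ _ _ _ _ _ (fun y : R => y `^ (-1))); first exact: measurable_powR.
  exact/measurable_funX/measurable_normc.
split.
- by under eq_fun do rewrite ReV; exact: measurable_funM.
- under eq_fun do rewrite ImV.
  by apply: measurable_funM => //; exact: measurableT_comp.
Qed.

Lemma cmeasurable_cexp f : cmeasurable f -> cmeasurable (fun x => cexp (f x)).
Proof.
move=> [f1 f2]; split => /=; apply: measurable_funM.
- by apply: (measurableT_comp (@measurable_expR R)).
- by apply: (measurableT_comp (continuous_measurable_fun (@continuous_cos R))).
- by apply: (measurableT_comp (@measurable_expR R)).
- by apply: (measurableT_comp (continuous_measurable_fun (@continuous_sin R))).
Qed.

Lemma cmeasurable_comp d' (T' : measurableType d') f (h : T' -> T) :
  cmeasurable f -> measurable_fun setT h -> cmeasurable (fun x => f (h x)).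
Proof. move=> [f1 f2] mh; split.
- exact: (measurableT_comp f1 mh).
- exact: (measurableT_comp f2 mh). Qed.

End complex_measurability.

Section complex_integration.
Context d (T : measurableType d) (R : realType).
Variable mu : {measure set T -> \bar R}.
Local Notation C := R[i].
Implicit Types f g : T -> C.

Lemma eq_cintegrable f g : f =1 g -> cintegrable mu f -> cintegrable mu g.
Proof. by move=> /funext ->. Qed.

Lemma eq_cintegral f g : f =1 g -> cintegral mu f = cintegral mu g.
Proof. by move=> /funext ->. Qed.

Lemma cintegrable_cmeasurable f : cintegrable mu f -> cmeasurable f.
Proof.
by move=> [/measurable_int/measurable_EFinP ? /measurable_int/measurable_EFinP].
Qed.

Lemma le_cintegrable f (g : T -> R) : cmeasurable f ->
  mu.-integrable setT (EFin \o g) -> (forall x, normc (f x) <= g x) ->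
  cintegrable mu f.
Proof.
move=> [f1 f2] ig fg; split.
- apply: le_integrable ig => //; first exact/measurable_EFinP.
  move=> x _ /=; rewrite lee_fin (le_trans (ler_Re _))// (le_trans (fg x))//.
  exact: ler_norm.
- apply: le_integrable ig => //; first exact/measurable_EFinP.
  move=> x _ /=; rewrite lee_fin (le_trans (ler_Im _))// (le_trans (fg x))//.
  exact: ler_norm.
Qed.

Lemma cintegrable_normc f : cintegrable mu f ->
  mu.-integrable setT (fun x => (normc (f x))%:E).
Proof.
move=> fi; have mf := cintegrable_cmeasurable fi; case: fi => f1 f2.
apply: (@le_integrable _ _ _ mu setT _ _
    (fun x => (`|Re (f x)| + `|Im (f x)|)%:E)) => //.
- exact/measurable_EFinP/measurable_normc.
- move=> x _ /=; rewrite lee_fin ger0_norm ?normc_ge0//.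
  by rewrite ger0_norm ?addr_ge0//; exact: normc_le_ReIm.
- by apply: (integrableD _ (integrable_norm f1) (integrable_norm f2)).
Qed.

Lemma cintegrableD f g : cintegrable mu f -> cintegrable mu g ->
  cintegrable mu (fun x => f x + g x).
Proof.
move=> [f1 f2] [g1 g2]; split.
- under eq_fun do rewrite ReD EFinD; exact: integrableD.
- under eq_fun do rewrite ImD EFinD; exact: integrableD.
Qed.

Lemma cintegrableZ (c : C) f : cintegrable mu f ->
  cintegrable mu (fun x => c * f x).
Proof.
move=> [f1 f2]; split.
- under eq_fun do rewrite ReM EFinB !EFinM.
  by apply: integrableB => //; exact: integrableZl.
- under eq_fun do rewrite ImM EFinD !EFinM.
  by apply: integrableD => //; exact: integrableZl.
Qed.

Lemma cintegrableB f g : cintegrable mu f -> cintegrable mu g ->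
  cintegrable mu (fun x => f x - g x).
Proof.
move=> fi gi; apply: cintegrableD => //.
by have := cintegrableZ (-1) gi; under eq_fun do rewrite mulN1r.
Qed.

Lemma cintegralD f g : cintegrable mu f -> cintegrable mu g ->
  cintegral mu (fun x => f x + g x) = cintegral mu f + cintegral mu g.
Proof.
move=> [f1 f2] [g1 g2]; apply: complex_eq; rewrite ReImE /=.
- by under eq_Rintegral do rewrite ReD; rewrite RintegralD.
- by under eq_Rintegral do rewrite ImD; rewrite RintegralD.
Qed.

Lemma cintegralZ (c : C) f : cintegrable mu f ->
  cintegral mu (fun x => c * f x) = c * cintegral mu f.
Proof.
move=> [f1 f2].
have iZ (a : R) (h : T -> R) : mu.-integrable setT (EFin \o h) ->
    mu.-integrable setT (EFin \o (fun x => a * h x)).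
  by move=> ih; apply: (integrableZl measurableT a ih).
apply: complex_eq; rewrite ReImE /=.
- under eq_Rintegral do rewrite ReM.
  by rewrite RintegralB ?RintegralZl//; exact: iZ.
- under eq_Rintegral do rewrite ImM.
  by rewrite RintegralD ?RintegralZl//; exact: iZ.
Qed.

(** Rotating the integral onto the positive real axis reduces the triangle
    inequality to the real part. *)
Lemma le_normc_cintegral f : cintegrable mu f ->
  normc (cintegral mu f) <= \int[mu]_x normc (f x).
Proof.
move=> fi; set I := cintegral mu f.
have [/eqP|I0] := eqVneq I 0.
  by rewrite -normc_eq0 => /eqP ->; apply: Rintegral_ge0 => x _; exact: normc_ge0.
pose w := conjc I * ((normc I)^-1)%:c.
have nI0 : normc I != 0 by rewrite normc_eq0.
have w1 : normc w = 1.
  by rewrite Normc.normcM normcJ normcC ger0_norm ?invr_ge0 ?normc_ge0// divff.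
have <- : Re (w * I) = normc I.
  rewrite /w mulrAC (mulrC (conjc I)) mulcJ ReM/= mulr0 subr0.
  by rewrite expr2 mulfK.
rewrite -cintegralZ//=; apply: le_Rintegral => //.
- by have [] := cintegrableZ w fi.
- exact: cintegrable_normc.
- move=> x _; rewrite (le_trans (ler_norm _))// (le_trans (ler_Re _))//.
  by rewrite Normc.normcM w1 mul1r.
Qed.

End complex_integration.

Section complex_fubini.
Context d1 d2 (T1 : measurableType d1) (T2 : measurableType d2) (R : realType).
Variables (m1 : {sigma_finite_measure set T1 -> \bar R})
          (m2 : {sigma_finite_measure set T2 -> \bar R}).
Local Notation C := R[i].

Lemma cintegral_prod1 (f : T1 * T2 -> C) :
  cintegrable (m1 \x m2)%E f ->
  (forall x, cintegrable m2 (fun y => f (x, y))) ->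
  cintegral (m1 \x m2)%E f =
  cintegral m1 (fun x => cintegral m2 (fun y => f (x, y))).
Proof.
move=> [f1 f2] fx; apply: complex_eq => /=; rewrite /Rintegral.
- rewrite -integral12_prod_meas1//; congr fine; apply: eq_integral => x _.
  by rewrite /fubini_F fineK// integrable_fin_num//; have [] := fx x.
- rewrite -integral12_prod_meas1//; congr fine; apply: eq_integral => x _.
  by rewrite /fubini_F fineK// integrable_fin_num//; have [] := fx x.
Qed.

Lemma cintegral_prod2 (f : T1 * T2 -> C) :
  cintegrable (m1 \x m2)%E f ->
  (forall y, cintegrable m1 (fun x => f (x, y))) ->
  cintegral (m1 \x m2)%E f =
  cintegral m2 (fun y => cintegral m1 (fun x => f (x, y))).
Proof.
move=> [f1 f2] fx; apply: complex_eq => /=; rewrite /Rintegral.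
- rewrite -integral21_prod_meas1//; congr fine; apply: eq_integral => x _.
  by rewrite /fubini_G fineK// integrable_fin_num//; have [] := fx x.
- rewrite -integral21_prod_meas1//; congr fine; apply: eq_integral => x _.
  by rewrite /fubini_G fineK// integrable_fin_num//; have [] := fx x.
Qed.

End complex_fubini.

Section dominated.
Context d (T : measurableType d) (R : realType) (mu : {measure set T -> \bar R}).

Lemma Rintegral_dominated_cvg (f_ : nat -> T -> R) (f g : T -> R) :
  (forall n, measurable_fun setT (f_ n)) -> measurable_fun setT f ->
  (forall x, f_ ^~ x @ \oo --> f x) -> mu.-integrable setT (EFin \o g) ->
  (forall n x, `|f_ n x| <= g x) ->
  (fun n => \int[mu]_x f_ n x) @ \oo --> \int[mu]_x f x.
Proof.
move=> mf_ mf cf ig fg.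
have i1 : mu.-integrable setT (EFin \o f).
  apply: le_integrable ig => //; first exact/measurable_EFinP.
  move=> x _; rewrite lee_fin [leRHS]ger0_norm; last first.
    exact: le_trans (normr_ge0 _) (fg 0%N x).
  rewrite -(cvg_lim (@Rhausdorff R) (cvg_norm (cf x))).
  by apply: limr_le; [apply: cvgP; exact: cvg_norm (cf x)|exact: nearW].
apply: fine_cvg; rewrite fineK; last exact: integrable_fin_num.
apply: (@dominated_cvg _ _ _ mu _ measurableT (fun n => EFin \o f_ n) (EFin \o f)
  (EFin \o g)) => //.
- by move=> n; exact/measurable_EFinP.
- by move=> x _; apply: cvg_EFin; [exact: nearW|exact: cf].
- by move=> n x _; rewrite lee_fin.
Qed.

End dominated.

Section fubini_slice.
Context d1 d2 (T1 : measurableType d1) (T2 : measurableType d2) (R : realType).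
Variables (m1 : {sigma_finite_measure set T1 -> \bar R})
          (m2 : {sigma_finite_measure set T2 -> \bar R}).

Lemma integrable_fubini2 (f : T1 * T2 -> \bar R) :
  (m1 \x m2)%E.-integrable setT f -> m2.-integrable setT (fubini_G m1 f).
Proof.
move=> fi; apply/integrableP; split; first exact: (measurable_fubini_G fi).
have mf : measurable_fun setT f by case/integrableP: fi.
have : (\int[m1 \x m2]_z `|f z| < +oo)%E by case/integrableP: fi.
rewrite fubini_tonelli2//; last exact: measurableT_comp.
apply: le_lt_trans; apply: ge0_le_integral => //.
- by apply: measurableT_comp => //; exact: (measurable_fubini_G fi).
- apply: measurable_fun_fubini_tonelli_G => //; exact: measurableT_comp.
- move=> y _; apply: le_abse_integral => //.
  exact: measurableT_comp.
Qed.

Lemma cintegrable_prod2 (f : T1 * T2 -> R[i]) :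
  cintegrable (m1 \x m2)%E f ->
  (forall y, cintegrable m1 (fun x => f (x, y))) ->
  cintegrable m2 (fun y => cintegral m1 (fun x => f (x, y))).
Proof.
move=> [f1 f2] fx; split.
- apply: eq_integrable (integrable_fubini2 f1) => // y _.
  by rewrite /fubini_G /= /Rintegral fineK// integrable_fin_num//; have [] := fx y.
- apply: eq_integrable (integrable_fubini2 f2) => // y _.
  by rewrite /fubini_G /= /Rintegral fineK// integrable_fin_num//; have [] := fx y.
Qed.

End fubini_slice.

(** * The complex Gaussian integral on the line *)

Section complex_derivative.
Context (R : realType).
Local Notation C := R[i].

Definition is_cderive (f : R -> C) (x : R) (df : C) :=
  is_derive x 1 (fun t => Re (f t)) (Re df) /\
  is_derive x 1 (fun t => Im (f t)) (Im df).

Lemma is_cderive_eq f x df df' : is_cderive f x df -> df = df' ->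
  is_cderive f x df'.
Proof. by move=> ? <-. Qed.

Lemma is_cderive_cst (c : C) x : is_cderive (fun _ => c) x 0.
Proof. by split; exact: is_derive_cst. Qed.

Lemma is_cderive_real (f : R -> R) (x df : R) : is_derive x 1 f df ->
  is_cderive (fun t => (f t)%:c) x df%:c.
Proof. by move=> fx; split => //=; exact: is_derive_cst. Qed.

Lemma is_cderiveD f g x df dg : is_cderive f x df -> is_cderive g x dg ->
  is_cderive (fun t => f t + g t) x (df + dg).
Proof.
move=> [f1 f2] [g1 g2]; split; rewrite ReImE.
- by under eq_fun do rewrite ReD; exact: is_deriveD.
- by under eq_fun do rewrite ImD; exact: is_deriveD.
Qed.

Lemma is_cderiveM f g x df dg : is_cderive f x df -> is_cderive g x dg ->
  is_cderive (fun t => f t * g t) x (df * g x + f x * dg).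
Proof.
move=> [f1 f2] [g1 g2]; split.
- under eq_fun do rewrite ReM.
  apply: (@is_derive_eq _ _ _ _ _ _ _ _ (is_deriveB (is_deriveM f1 g1)
    (is_deriveM f2 g2))).
  by rewrite !ReImE /GRing.scale /=; ring.
- under eq_fun do rewrite ImM.
  apply: (@is_derive_eq _ _ _ _ _ _ _ _ (is_deriveD (is_deriveM f1 g2)
    (is_deriveM f2 g1))).
  by rewrite !ReImE /GRing.scale /=; ring.
Qed.

Lemma is_cderive_cexp f x df : is_cderive f x df ->
  is_cderive (fun t => cexp (f t)) x (df * cexp (f x)).
Proof.
move=> [f1 f2].
have e := is_derive1_comp (is_derive_expR (Re (f x))) f1.
have s := is_derive1_comp (is_derive_sin (Im (f x))) f2.
have c := is_derive1_comp (is_derive_cos (Im (f x))) f2.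
split.
- apply: (@is_derive_eq _ _ _ _ _ _ _ _ (is_deriveM e c)).
  by rewrite !ReImE /= /GRing.scale /=; ring.
- apply: (@is_derive_eq _ _ _ _ _ _ _ _ (is_deriveM e s)).
  by rewrite !ReImE /= /GRing.scale /=; ring.
Qed.

Lemma is_derive_continuous (f : R -> R) (x a : R) :
  is_derive x 1 f a -> {for x, continuous f}.
Proof.
by move=> [fx _]; apply/differentiable_continuous; apply/derivable1_diffP.
Qed.

End complex_derivative.

Section gaussian_line.
Context (R : realType).
Local Notation C := R[i].
Local Notation leb := (@lebesgue_measure R).
Local Notation RT := (measurableTypeR R).

Lemma integral_gauss_gt0 (a : R) : 0 < a ->
  exists2 G : R, 0 < G & forall z : R, (\int[leb]_x (expR (- (a * (x - z) ^+ 2)))%:E = G%:E)%E.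
Proof.
move=> a0; pose s := (Num.sqrt (2 * a))^-1.
have s0 : s != 0 by rewrite invr_neq0// gt_eqF// sqrtr_gt0 mulr_gt0.
exists (normal_peak s)^-1; first by rewrite invr_gt0 normal_peak_gt0.
move=> z.
transitivity (\int[leb]_x (((normal_peak s)^-1)%:E * (normal_pdf z s x)%:E))%E.
  apply: eq_integral => x _; rewrite -EFinM /normal_pdf (negPf s0).
  rewrite mulKf ?gt_eqF ?normal_peak_gt0// /normal_fun; congr (expR _)%:E.
  rewrite /s exprVn sqr_sqrtr ?mulr_ge0 ?ltW//.
  have a_neq0 : a != 0 by rewrite gt_eqF.
  by field.
rewrite integralZl//; last exact: integrable_normal_pdf.
by rewrite integral_normal_pdf mule1.
Qed.

Lemma measurable_gauss (a z : R) :
  measurable_fun setT (fun x : R => expR (- (a * (x - z) ^+ 2))).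
Proof.
apply: (measurableT_comp (@measurable_expR R)) => /=.
apply: (measurableT_comp (@oppr_measurable R _)).
apply: measurable_funM => //; apply: measurable_funX.
exact: measurable_funB.
Qed.

Lemma integrable_gauss (a z : R) : 0 < a ->
  leb.-integrable setT (fun x => (expR (- (a * (x - z) ^+ 2)))%:E).
Proof.
move=> a0; apply/integrableP; split.
  by apply/measurable_EFinP; exact: measurable_gauss.
have [G _ GE] := integral_gauss_gt0 a0.
under eq_integral do rewrite gee0_abs ?lee_fin ?expR_ge0//.
by rewrite GE; exact: ltry.
Qed.

(** The fundamental theorem of calculus on [-N, N], where the boundary terms decay
    with N. *)
Lemma integral_derive_eq0 (g g' : R -> R) (c K : R) : 0 < c ->
  (forall x : R, is_derive x 1 g (g' x)) -> continuous g' ->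
  leb.-integrable setT (EFin \o g') ->
  (forall x, `|g x| <= K * expR (- (c * x ^+ 2))) ->
  \int[leb]_x g' x = 0.
Proof.
move=> c0 dg cg' ig' gK.
have K0 : 0 <= K.
  have := le_trans (normr_ge0 _) (gK 0).
  by rewrite expr0n mulr0 oppr0 expR0 mulr1.
have mg' : measurable_fun setT (EFin \o g') := measurable_int _ ig'.
pose N (n : nat) : R := n%:R + 1.
have N0 n : 0 < N n by rewrite /N ltr_wpDl.
pose f_ n := (EFin \o g') \_ `[- N n, N n].
have fE n : (\int[leb]_x f_ n x = (g (N n) - g (- N n))%:E)%E.
  rewrite /f_ -integral_mkcond EFinB.
  apply: continuous_FTC2.
  - by rewrite -subr_gt0 opprK addr_gt0.
  - exact: continuous_subspaceT.
  - split.
    + by move=> x _; have [] := dg x.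
    + exact/cvg_at_right_filter/(is_derive_continuous (dg _)).
    + exact/cvg_at_left_filter/(is_derive_continuous (dg _)).
  - by move=> x _; rewrite derive1E; have [_] := dg x.
have cvgf : (\int[leb]_x f_ n x @[n --> \oo] --> \int[leb]_x (g' x)%:E)%E.
  apply: (@dominated_cvg _ _ _ leb _ measurableT f_ (EFin \o g') (abse \o (EFin \o g'))).
  - move=> n; apply/(measurable_restrictT _ _).1 => //.
    exact: measurable_funTS.
  - move=> x _; apply: cvg_near_cst; near=> n.
    rewrite /f_ patchE mem_set//= in_itv/= -ler_norml.
    near: n; exists (Num.trunc `|x|).+1 => // n /= xn.
    rewrite /N (le_trans (ltW (truncnS_gt _)))//.
    by rewrite (@le_trans _ _ n%:R) ?ler_nat// lerDl.
  - by [].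
  - exact: integrable_abse.
  - move=> n x _; rewrite /f_ patchE; case: ifPn => _ //.
    by rewrite abse0; exact: abse_ge0.
have cvg0 : (\int[leb]_x f_ n x @[n --> \oo] --> 0)%E.
  under eq_fun do rewrite fE.
  apply: cvg_EFin; first exact: nearW.
  apply/cvgrPdist_le => e e0; near=> n; rewrite sub0r normrN /=.
  have h x : `|x| = N n -> `|g x| <= e / 2.
    move=> xN; rewrite (le_trans (gK x))//.
    have -> : x ^+ 2 = N n ^+ 2 by rewrite -xN real_normK ?num_real.
    rewrite expRN ler_pdivrMr ?expR_gt0//.
    rewrite (@le_trans _ _ (e / 2 * (1 + c * N n ^+ 2)))//; last first.
      by rewrite ler_wpM2l ?expR_ge1Dx// ltW// divr_gt0.
    have nK : 2 * K / (c * e) <= n%:R.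
      by near: n; exact: nbhs_infty_ger.
    have nN : n%:R <= N n ^+ 2.
      rewrite /N; have : 0 <= n%:R :> R by [].
      by move: (n%:R) => y y0; nra.
    have : 2 * K / (c * e) <= N n ^+ 2 by exact: le_trans nN.
    rewrite ler_pdivrMr ?mulr_gt0//; move: (N n ^+ 2) => y; nra.
  rewrite (le_trans (ler_normB _ _))// [leRHS](splitr e) lerD// h//.
  - by rewrite ger0_norm// ltW.
  - by rewrite normrN ger0_norm// ltW.
have := cvg_unique _ cvgf cvg0; rewrite /Rintegral => -> //.
Unshelve. all: end_near. Qed.

(** The homotopy joining the real Gaussian exp(-(a x)^2) to the complex one
    exp(-((a + i b) x - l)^2) is f s x = k s * exp(-(E s x)^2), normalized by the
    factor k s.  Its derivative Phi in s is the derivative in x of g, so its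
    integral does not depend on s; the condition b^2 < a^2 keeps the real part of
    (k s)^2 positive along the path. *)
Section path.
Variables (a b : R) (l : C).
Hypotheses (a0 : 0 < a) (ab : b ^+ 2 < a ^+ 2).

Let k' : C := Complex 0 b.
Let k (s : R) : C := a%:c + s%:c * k'.
Let E (s x : R) : C := k s * x%:c - s%:c * l.
Let f (s x : R) : C := k s * cexp (- (E s x) ^+ 2).
Let Phi (s x : R) : C :=
  (k' - 2 * k s * E s x * (k' * x%:c - l)) * cexp (- (E s x) ^+ 2).
Let g (s x : R) : C := (k' * x%:c - l) * cexp (- (E s x) ^+ 2).
Let c := a ^+ 2 - b ^+ 2.

Let c0 : 0 < c. Proof. by rewrite subr_gt0. Qed.

Let id_cderive (x : R) : is_cderive (fun t => t%:c) x 1.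
Proof. exact: (is_cderive_real (is_derive_id x 1)). Qed.

Let aff_cderive (u v : C) (x : R) : is_cderive (fun t => u * t%:c + v) x u.
Proof.
apply: is_cderive_eq (is_cderiveD (is_cderiveM (is_cderive_cst u x)
  (id_cderive x)) (is_cderive_cst v x)) _.
by rewrite mul0r add0r mulr1 addr0.
Qed.

Let k_cderive s : is_cderive k s k'.
Proof.
rewrite (_ : k = fun t => k' * t%:c + a%:c); first exact: aff_cderive.
by apply/funext => t; rewrite /k addrC mulrC.
Qed.

Let Es_cderive s x : is_cderive (fun t => E t x) s (k' * x%:c - l).
Proof.
rewrite (_ : (fun t => _) = fun t => (k' * x%:c - l) * t%:c + a%:c * x%:c).
  exact: aff_cderive.
by apply/funext => t; rewrite /E /k; ring.
Qed.

Let Ex_cderive s x : is_cderive (E s) x (k s).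
Proof. exact: aff_cderive. Qed.

Let exp_cderive (h : R -> C) x dh : is_cderive h x dh ->
  is_cderive (fun t => cexp (- (h t) ^+ 2)) x
    (- 2 * h x * dh * cexp (- (h x) ^+ 2)).
Proof.
move=> hx.
have h2 := is_cderiveM (is_cderive_cst (-1) x) (is_cderiveM hx hx).
have := is_cderive_cexp h2; under eq_fun do rewrite mulN1r -expr2.
by move/is_cderive_eq; apply; rewrite !mulN1r -expr2; ring.
Qed.

Let f_cderive s x : is_cderive (fun t => f t x) s (Phi s x).
Proof.
apply: is_cderive_eq (is_cderiveM (k_cderive s) (exp_cderive (Es_cderive s x))) _.
by rewrite /Phi; ring.
Qed.

Let g_cderive s x : is_cderive (g s) x (Phi s x).
Proof.
apply: is_cderive_eq (is_cderiveM (aff_cderive k' (- l) x)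
  (exp_cderive (Ex_cderive s x))) _.
by rewrite /Phi; ring.
Qed.

Let Phi_continuous s : continuous (fun x : R => (Re (Phi s x) : R)) /\
                       continuous (fun x : R => (Im (Phi s x) : R)).
Proof.
have D x : exists d, is_cderive (Phi s) x d.
  rewrite (_ : Phi s = fun y => (k' + - (2 * k s) * (E s y * (k' * y%:c + - l))) *
      cexp (- (E s y) ^+ 2)); last first.
    by apply/funext => y; rewrite /Phi; congr (_ * _); ring.
  eexists; apply: is_cderiveM; last exact: exp_cderive (Ex_cderive s x).
  apply: is_cderiveD; first exact: is_cderive_cst.
  apply: is_cderiveM; first exact: is_cderive_cst.
  exact: is_cderiveM (Ex_cderive s x) (aff_cderive k' (- l) x).
by split=> x; have [d [d1 d2]] := D x;
  [exact: is_derive_continuous d1|exact: is_derive_continuous d2].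
Qed.

(** Half of the quadratic decay c x^2 absorbs the terms of the exponent that are
    linear in x. *)
Let dom s x : `|s| <= 1 ->
  normc (cexp (- (E s x) ^+ 2)) <=
  expR (2 / c * (a * `|Re l| + `|b| * `|Im l|) ^+ 2 + Im l ^+ 2) *
  expR (- (c / 2 * x ^+ 2)).
Proof.
move=> s1; rewrite normc_cexp -expRD ler_expR expr2 ReImE !ReImE /=.
rewrite !(mulr0, mul0r, subr0, addr0, add0r).
set D := a * _ + _.
have h1 : s ^+ 2 <= 1.
  by rewrite -(real_normK (num_real s)) expr_le1.
have h2 : s * x * (a * Re l - s * b * Im l) <= `|x| * D.
  apply: le_trans (ler_norm _) _; rewrite normrM; apply: ler_pM => //.
    by rewrite normrM ler_piMl.
  rewrite /D (le_trans (ler_normB _ _))// !normrM (gtr0_norm a0) lerD2l -mulrA.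
  by rewrite ler_piMl// mulr_ge0.
have h3 : 2 * (`|x| * D) <= c / 2 * x ^+ 2 + 2 / c * D ^+ 2.
  rewrite -(real_normK (num_real x)) -subr_ge0.
  have -> : c / 2 * `|x| ^+ 2 + 2 / c * D ^+ 2 - 2 * (`|x| * D) =
      c / 2 * (`|x| - 2 / c * D) ^+ 2 by field; rewrite gt_eqF.
  by rewrite mulr_ge0 ?sqr_ge0// divr_ge0// ltW.
have h4 : 0 <= (1 - s ^+ 2) * (b * x) ^+ 2 by rewrite mulr_ge0 ?sqr_ge0 ?subr_ge0.
have h5 : 0 <= (1 - s ^+ 2) * Im l ^+ 2 by rewrite mulr_ge0 ?sqr_ge0 ?subr_ge0.
have h6 : 0 <= (s * Re l) ^+ 2 by exact: sqr_ge0.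
rewrite /c in h3 *.
nra.
Qed.

Let B := a + `|b| + normc l.

Let B0 : 0 < B.
Proof. by rewrite /B ltr_wpDr ?normc_ge0// ltr_wpDr. Qed.

Let k'_le : normc k' <= B.
Proof.
rewrite (le_trans (normc_le_ReIm _))//= normr0 add0r /B.
by rewrite -addrA addrCA lerDl addr_ge0 ?normc_ge0// ltW.
Qed.

Let k_le s : `|s| <= 1 -> normc (k s) <= a + `|b|.
Proof.
move=> s1; rewrite (le_trans (normcD _ _))// normcC gtr0_norm// lerD2l.
rewrite Normc.normcM normcC normcE/= expr0n add0r sqrtr_sqr.
by rewrite ler_piMl.
Qed.

Let k'xl_le (x : R) : normc (k' * x%:c - l) <= B * (1 + `|x|).
Proof.
rewrite (le_trans (normcD _ _))// normcN Normc.normcM normcC mulrDr mulr1 addrC.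
rewrite lerD// ?ler_wpM2r//.
by rewrite /B lerDr addr_ge0// ltW.
Qed.

Let E_le s (x : R) : `|s| <= 1 -> normc (E s x) <= B * (1 + `|x|).
Proof.
move=> s1; rewrite (le_trans (normcD _ _))// normcN !Normc.normcM !normcC.
rewrite mulrDr mulr1 addrC lerD//.
- apply: (@le_trans _ _ (normc l)); first by rewrite ler_piMl ?normc_ge0.
  by rewrite /B lerDr addr_ge0// ltW.
- by rewrite ler_wpM2r// (le_trans (k_le s1))// /B lerDl normc_ge0.
Qed.

(** Half of the remaining decay absorbs polynomial factors. *)
Let dom2 : exists K : R, forall s x, `|s| <= 1 ->
  (1 + `|x|) ^+ 2 * normc (cexp (- (E s x) ^+ 2)) <=
  K * expR (- (c / 4 * x ^+ 2)).
Proof.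
set K1 := expR (2 / c * (a * `|Re l| + `|b| * `|Im l|) ^+ 2 + Im l ^+ 2).
exists (2 * (1 + 4 / c) * K1) => s x s1.
have c1 : 0 < c^-1 by rewrite invr_gt0.
have h : (1 + `|x|) ^+ 2 <= 2 * (1 + 4 / c) * expR (c / 4 * x ^+ 2).
  apply: (@le_trans _ _ (2 * (1 + 4 / c) * (1 + c / 4 * x ^+ 2))); last first.
    by rewrite ler_wpM2l ?expR_ge1Dx// mulr_ge0// addr_ge0// divr_ge0// ltW.
  have -> : 2 * (1 + 4 / c) * (1 + c / 4 * x ^+ 2) =
      2 * (1 + x ^+ 2 + c / 4 * x ^+ 2 + 4 / c) by field; rewrite gt_eqF.
  have h1 : 0 <= c / 4 * x ^+ 2 by rewrite mulr_ge0 ?sqr_ge0// divr_ge0// ltW.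
  have h2 : 0 <= 4 / c by rewrite divr_ge0// ltW.
  rewrite -(real_normK (num_real x)) in h1 *.
  have := sqr_ge0 (`|x| - 1).
  move: (c / 4) (4 / c) `|x| h1 h2 => u v y; nra.
rewrite (le_trans (ler_pM _ _ h (dom x s1))) ?sqr_ge0 ?normc_ge0//.
rewrite -/K1 mulrACA -expRD.
have -> : c / 4 * x ^+ 2 + - (c / 2 * x ^+ 2) = - (c / 4 * x ^+ 2).
  by field.
by [].
Qed.

Let x_le (x : R) : 1 + `|x| <= (1 + `|x|) ^+ 2.
Proof. by have := normr_ge0 x; move: `|x| => y; nra. Qed.

Let one_le (x : R) : 1 <= (1 + `|x|) ^+ 2.
Proof. by have := normr_ge0 x; move: `|x| => y; nra. Qed.

Let bounds : exists K : R, forall s x, `|s| <= 1 ->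
  [/\ normc (f s x) <= K * expR (- (c / 4 * x ^+ 2)),
      normc (g s x) <= K * expR (- (c / 4 * x ^+ 2)),
      normc (Phi s x) <= K * expR (- (c / 4 * x ^+ 2)) &
      normc (cexp (- (E s x) ^+ 2)) <= K * expR (- (c / 4 * x ^+ 2))].
Proof.
have [K HK] := dom2.
have K0 : 0 <= K.
  rewrite -(pmulr_lge0 _ (expR_gt0 (- (c / 4 * 0 ^+ 2)))).
  by apply: le_trans (HK 0 0 _); rewrite ?normr0// mulr_ge0 ?sqr_ge0 ?normc_ge0.
exists ((1 + B + B + 2 * B * B * B) * K) => s x s1.
have HKx := HK s x s1.
set e := normc (cexp _) in HKx *.
have e0 : 0 <= e by exact: normc_ge0.
set y := (1 + `|x|) in HKx *.
have y1 := x_le x; have y2 := one_le x; rewrite -/y in y1 y2.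
have yy : y ^+ 2 * e <= K * expR (- (c / 4 * x ^+ 2)) by [].
have B00 := ltW B0.
have P (w : C) (q : R) : 0 <= q -> normc w <= q * y ^+ 2 ->
    q <= 1 + B + B + 2 * B * B * B ->
    normc (w * cexp (- E s x ^+ 2)) <=
    (1 + B + B + 2 * B * B * B) * K * expR (- (c / 4 * x ^+ 2)).
  move=> q0 wq qB; rewrite Normc.normcM -/e.
  apply: (@le_trans _ _ (q * (y ^+ 2 * e))).
    by rewrite mulrA ler_wpM2r.
  by rewrite -mulrA ler_pM// mulr_ge0 ?sqr_ge0.
have B3 : 0 <= B * B * B by rewrite !mulr_ge0.
split.
- apply: (P _ B) => //; last by nra.
  rewrite (le_trans (k_le s1))// (@le_trans _ _ B)//.
    by rewrite /B lerDl normc_ge0.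
  by rewrite ler_peMr.
- apply: (P _ B) => //; last by nra.
  by rewrite (le_trans (k'xl_le x))// -/y ler_wpM2l.
- apply: (P _ (B + 2 * B * B * B)); [by nra| |by nra].
  rewrite (le_trans (normcD _ _))// normcN !Normc.normcM mulrDl lerD//.
    by rewrite (le_trans k'_le)// ler_peMr.
  have -> : 2 * B * B * B * y ^+ 2 = 2 * B * (B * y) * (B * y) by ring.
  rewrite ler_pM ?mulr_ge0 ?normc_ge0 ?k'xl_le//.
  rewrite ler_pM ?mulr_ge0 ?normc_ge0 ?E_le//.
  rewrite natCE normcC ger0_norm// ler_wpM2l//.
  by rewrite (le_trans (k_le s1))// /B lerDl normc_ge0.
- rewrite /e -[cexp _]mul1r; apply: (P _ 1) => //; last by nra.
  by rewrite Normc.normc1 mul1r.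
Qed.

Let mcst (z : C) : cmeasurable (fun _ : RT => z). Proof. exact: cmeasurable_cst. Qed.

Let midC : cmeasurable (fun x : RT => (x : R)%:c).
Proof. exact: (cmeasurableC (@measurable_id _ RT setT)). Qed.

Let mE s : cmeasurable (fun x : RT => E s x).
Proof. exact: cmeasurableB (cmeasurableM (mcst _) midC) (mcst _). Qed.

Let mexp s : cmeasurable (fun x : RT => cexp (- (E s x) ^+ 2)).
Proof. exact: cmeasurable_cexp (cmeasurableN (cmeasurableX 2 (mE s))). Qed.

Let mPhi s : cmeasurable (fun x : RT => Phi s x).
Proof.
apply: cmeasurableM (mexp s); apply: cmeasurableB (mcst _) _.
apply: cmeasurableM; first exact: cmeasurableM (mcst _) (mE s).
exact: cmeasurableB (cmeasurableM (mcst _) midC) (mcst _).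
Qed.

Let ci (h : RT -> C) K : cmeasurable h ->
  (forall x, normc (h x) <= K * expR (- (c / 4 * x ^+ 2))) -> cintegrable leb h.
Proof.
move=> mh hK; apply: (le_cintegrable mh _ hK).
have c40 : 0 < c / 4 by rewrite divr_gt0.
have := integrableZl measurableT K (integrable_gauss 0 c40).
by apply: eq_integrable => // x _; rewrite /= subr0.
Qed.

Let ci_exp s : `|s| <= 1 -> cintegrable leb (fun x => cexp (- (E s x) ^+ 2)).
Proof.
by move=> s1; have [K HK] := bounds; apply: (ci (mexp s)) => x; have [_ _ _] := HK s x s1; exact.
Qed.

Let ci_f s : `|s| <= 1 -> cintegrable leb (f s).
Proof. by move=> s1; exact: cintegrableZ (ci_exp s1). Qed.

Let ci_Phi s : `|s| <= 1 -> cintegrable leb (Phi s).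
Proof.
by move=> s1; have [K HK] := bounds; apply: (ci (mPhi s)) => x; have [_ _ h _] := HK s x s1; exact: h.
Qed.

Let int_Phi s : `|s| <= 1 ->
  \int[leb]_x Re (Phi s x) = 0 /\ \int[leb]_x Im (Phi s x) = 0.
Proof.
move=> s1; have [c1 c2] := Phi_continuous s; have [i1 i2] := ci_Phi s1.
have [K HK] := bounds; split.
- apply: (@integral_derive_eq0 (fun x => Re (g s x)) _ (c / 4) K) => //.
  + by rewrite divr_gt0.
  + by move=> x; have [] := g_cderive s x.
  + by move=> x; rewrite (le_trans (ler_Re _))//; have [] := HK s x s1.
- apply: (@integral_derive_eq0 (fun x => Im (g s x)) _ (c / 4) K) => //.
  + by rewrite divr_gt0.
  + by move=> x; have [] := g_cderive s x.
  + by move=> x; rewrite (le_trans (ler_Im _))//; have [] := HK s x s1.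
Qed.

Let sin_le1 (h : R) : `|sin h| <= 1.
Proof. by rewrite ler_norml sin_geN1 sin_le1. Qed.

Let cos_le1 (h : R) : `|cos h| <= 1.
Proof. by rewrite ler_norml cos_geN1 cos_le1. Qed.

(** The substitution s = sin h lets the homotopy parameter h range over the whole
    line while s stays in the interval [-1, 1] on which the integrands decay. *)
Let is_derive_int (P : C -> R) (h : R) :
  (forall z, `|P z| <= normc z) ->
  (forall s : R, `|s| <= 1 -> leb.-integrable setT (fun x => (P (f s x))%:E)) ->
  (forall s x : R, is_derive s 1 (fun t => P (f t x)) (P (Phi s x))) ->
  (forall s : R, `|s| <= 1 -> leb.-integrable setT (fun x => (P (Phi s x))%:E)) ->
  (forall s : R, `|s| <= 1 -> \int[leb]_x P (Phi s x) = 0) ->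
  is_derive h 1 (fun t => \int[leb]_x P (f (sin t) x)) 0.
Proof.
move=> Pn iP dP iPhi Phi0.
pose F := fun (t : R) (x : RT) => P (f (sin t) x).
have dF (t x : R) : is_derive t 1 (F ^~ x) (cos t * P (Phi (sin t) x)).
  by rewrite mulrC; exact: (is_derive1_comp (dP (sin t) x) (is_derive_sin t)).
have [K HK] := bounds.
have c40 : 0 < c / 4 by rewrite divr_gt0.
have K0 : 0 <= K.
  rewrite -(pmulr_lge0 _ (expR_gt0 (- (c / 4 * 0 ^+ 2)))).
  by apply: le_trans (normc_ge0 (f 0 0)) _; have [] := HK 0 0; rewrite ?normr0.
pose G := fun x : RT => K * expR (- (c / 4 * x ^+ 2)).
have iG : leb.-integrable setT (EFin \o G).
  have := integrableZl measurableT K (integrable_gauss 0 c40).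
  by apply: eq_integrable => // x _; rewrite /= subr0.
have Ih : `]h - 1, h + 1[%classic h by rewrite /= in_itv/= ltrDl ltrBlDr ltrDl ltr01.
have d1 t x : partial1of2 F t x = cos t * P (Phi (sin t) x).
  by rewrite partial1of2E; have [_ ->] := dF t x.
have a1 : forall x : R, `]h - 1, h + 1[%classic x ->
    leb.-integrable setT (EFin \o F x) by move=> t _; exact: iP.
have a2 : forall (x : R) (y : RT), `]h - 1, h + 1[%classic x -> setT y ->
    derivable (F ^~ y) x 1 by move=> t x _ _; have [] := dF t x.
have a3 : forall y, 0 <= G y by move=> x; rewrite mulr_ge0// expR_ge0.
have a4 : forall (x : R) (y : RT), `]h - 1, h + 1[%classic x -> setT y ->
    `|partial1of2 F x y| <= G y.
  move=> t x _ _; rewrite d1 normrM; have [_ _ hP _] := HK (sin t) x (sin_le1 t).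
  apply: le_trans (ler_piMl _ (cos_le1 t)) _; first exact: normr_ge0.
  exact: le_trans (Pn _) hP.
have D := derivable_under_integral measurableT Ih a1 a2 a3 iG a4.
have E0 := differentiation_under_integral measurableT Ih a1 a2 a3 iG a4.
apply: DeriveDef => //; rewrite -derive1E E0.
transitivity (\int[leb]_y (cos h * P (Phi (sin h) y))).
  by apply: eq_Rintegral => y _; rewrite d1.
by rewrite RintegralZl// ?Phi0 ?mulr0//; exact: iPhi.
Qed.

Lemma gauss_line_path (G : R) :
  (\int[leb]_x (expR (- (a ^+ 2 * (x - 0) ^+ 2)))%:E = G%:E)%E ->
  cintegrable leb (fun x : RT => cexp (- (k 1 * x%:c - l) ^+ 2)) /\
  cintegral leb (fun x : RT => cexp (- (k 1 * x%:c - l) ^+ 2)) = (a * G)%:c / k 1.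
Proof.
move=> GE.
have n1 : `|1 : R| <= 1 by rewrite normr1.
have n0 : `|0 : R| <= 1 by rewrite normr0.
have k10 : k 1 != 0.
  rewrite -normc_eq0 gt_eqF// (lt_le_trans _ (ler_Re _))// /k !ReImE/=.
  by rewrite !mulr0 mul0r subr0 addr0 normr_gt0 gt_eqF.
have E1 x : E 1 x = k 1 * x%:c - l by rewrite /E mul1r.
have i1 := ci_exp n1.
have -> : (fun x : RT => cexp (- (k 1 * x%:c - l) ^+ 2)) =
    (fun x : RT => cexp (- (E 1 x) ^+ 2)) by apply/funext => x; rewrite E1.
split => //.
apply: (mulfI k10); rewrite -cintegralZ// [RHS]mulrC divfK//.
rewrite (_ : (fun x => _) = f 1)//.
have f0 x : f 0 x = (a * expR (- (a ^+ 2 * (x - 0) ^+ 2)))%:c.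
  rewrite /f /E /k mul0r addr0 mul0r subr0 -rmorphM -rmorphXn -rmorphN cexpC.
  by rewrite -rmorphM/= subr0 exprMn.
have <- : cintegral leb (f 0) = (a * G)%:c.
  rewrite (funext f0); apply: complex_eq => /=.
    rewrite RintegralZl//; first by rewrite /Rintegral GE.
    exact: integrable_gauss (exprn_gt0 2 a0).
  by rewrite Rintegral_cst// mul0r.
apply: complex_eq => /=.
- have := is_derive_0_is_cst (f := fun t => \int[leb]_x Re (f (sin t) x)) (pi / 2) 0.
  rewrite sin_pihalf sin0; apply => h; apply: is_derive_int.
  + exact: ler_Re.
  + by move=> s /ci_f[].
  + by move=> s x; have [] := f_cderive s x.
  + by move=> s /ci_Phi[].
  + by move=> s /int_Phi[].
- have := is_derive_0_is_cst (f := fun t => \int[leb]_x Im (f (sin t) x)) (pi / 2) 0.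
  rewrite sin_pihalf sin0; apply => h; apply: is_derive_int.
  + exact: ler_Im.
  + by move=> s /ci_f[].
  + by move=> s x; have [] := f_cderive s x.
  + by move=> s /ci_Phi[].
  + by move=> s /int_Phi[].
Qed.

End path.

(** With w^2 = m, the condition Re m > 0 says exactly that b^2 < a^2 for w = a + i b,
    so the homotopy above applies with k 1 = w and l = w z; its value does not
    involve z. *)
Lemma cgauss_line (m : C) : 0 < Re m -> exists2 Z : C, Z != 0 & forall z : C,
  cintegrable leb (fun x : RT => cexp (- (m * (x%:c - z) ^+ 2))) /\
  cintegral leb (fun x : RT => cexp (- (m * (x%:c - z) ^+ 2))) = Z.
Proof.
move=> m0.
(* the square root in the right half-plane *)
have [w [wm w0]] : exists w : C, w ^+ 2 = m /\ 0 <= Re w.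
  have [s0|s0] := leP 0 (Re (sqrtc m)); first by exists (sqrtc m); rewrite sqr_sqrtc.
  by exists (- sqrtc m); rewrite sqrrN sqr_sqrtc ReN oppr_ge0 ltW.
have hw : Im w ^+ 2 < Re w ^+ 2 by rewrite -subr_gt0 !expr2 -ReM -expr2 wm.
have {}w0 : 0 < Re w.
  rewrite lt_def w0 andbT; apply: contraTneq hw => ->.
  by rewrite -leNgt expr0n sqr_ge0.
have kE : (Re w)%:c + 1%:c * Complex 0 (Im w) = w.
  by apply: complex_eq; rewrite !ReImE /=; ring.
have wn0 : w != 0 by apply: contraTneq w0 => ->; rewrite ltxx.

have [G G0 GE] := integral_gauss_gt0 (exprn_gt0 2 w0).
exists ((Re w * G)%:c / w).
  rewrite mulf_neq0 ?invr_neq0// -normc_eq0 normcC normr_eq0.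
  by rewrite gt_eqF// mulr_gt0.
move=> z; have := gauss_line_path (w * z) w0 hw (GE 0); rewrite kE.
have -> // : (fun x : RT => cexp (- (w * x%:c - w * z) ^+ 2)) =
  (fun x : RT => cexp (- (m * (x%:c - z) ^+ 2))).
by apply/funext => x; rewrite -mulrBr exprMn wm.
Qed.

End gaussian_line.

(** * Sigma-finiteness of Lebesgue measure on R^n *)

Section measurable_uncons.
Context (R : realType).
Local Notation leb := (@lebesgue_measure R).
Local Notation RT := (measurableTypeR R).

Definition rV_uncons n (x : 'rV[R]_n.+1) : 'rV[R]_n * RT :=
  (@rsubmx R 1 1 n x, x ord0 ord0).

Lemma rV_consK n : cancel (@rV_cons R n) (@rV_uncons n).
Proof.
move=> [x t]; rewrite /rV_uncons /rV_cons; congr pair.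
  by rewrite (@row_mxKr R 1 1 n).
have -> : ord0 = lshift n ord0 :> 'I_(1 + n) by apply/val_inj.
by apply: etrans (row_mxEl _ _ _ _) _; rewrite mxE eqxx mulr1n.
Qed.

Lemma measurable_rV_coord n (i : 'I_n) :
  measurable_fun [set: 'rV[R]_n] (fun x : 'rV[R]_n => x ord0 i : RT).
Proof.
move=> _ Y mY; rewrite setTI; apply: sub_sigma_algebra => /=.
rewrite -bigcup_seq/=; exists i => /=; first by rewrite mem_index_enum.
by exists Y => //; rewrite setTI.
Qed.

Lemma measurable_rV_uncons n : measurable_fun setT (@rV_uncons n).
Proof.
apply: measurable_fun_pair; last exact: measurable_rV_coord.
apply: measurable_fun_rV => i; rewrite (_ : _ \o _ =
    fun x : 'rV[R]_n.+1 => x ord0 (rshift 1 i)); first exact: measurable_rV_coord.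
by apply/funext => x; rewrite /rV_coord /= mxE.
Qed.

End measurable_uncons.

(** An alias carrying a proof of sigma-finiteness, so that Fubini's theorem applies
    to the recursively defined [lebesgue_rV], whose construction only records that
    it is a measure. *)
Definition sf_measure d (T : measurableType d) (R : realType)
  (mu : {measure set T -> \bar R}) (sf : sigma_finite setT mu) :
  set T -> \bar R := mu.

Section sf_measure_instance.
Context d (T : measurableType d) (R : realType).
Variables (mu : {measure set T -> \bar R}) (sf : sigma_finite setT mu).
HB.instance Definition _ := Measure.copy (sf_measure sf) mu.
HB.instance Definition _ := Measure_isSigmaFinite.Build _ _ _ (sf_measure sf) sf.
Lemma sf_measureE : (sf_measure sf : {measure set T -> \bar R}) = mu.
Proof. exact: eq_measure. Qed.
End sf_measure_instance.

Lemma product_sigma_finite d1 d2 (T1 : measurableType d1)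
    (T2 : measurableType d2) (R : realType)
    (m1 : {sigma_finite_measure set T1 -> \bar R})
    (m2 : {sigma_finite_measure set T2 -> \bar R}) :
  sigma_finite setT (m1 \x m2)%E.
Proof.
have /sigma_finiteP[F [TF ndF Foo]] := sigma_finiteT m1.
have /sigma_finiteP[G [TG ndG Goo]] := sigma_finiteT m2.
exists (fun n => F n `*` G n).
  apply/seteqP; split => // -[x y] _.
  have : setT x by []. have : setT y by [].
  rewrite {1}TF {1}TG => -[j _ Gjy] [i _ Fix].
  exists (maxn i j) => //; split.
  - by move: Fix; exact/subsetPset/ndF/leq_maxl.
  - by move: Gjy; exact/subsetPset/ndG/leq_maxr.
move=> k; have [? ?] := Foo k; have [? ?] := Goo k.
split; first exact: measurableX.
by rewrite product_measure1E// lte_mul_pinfty// ge0_fin_numE.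
Qed.

Section lebesgue_rV_fubini.
Context (R : realType).
Local Notation leb := (@lebesgue_measure R).
Local Notation RT := (measurableTypeR R).

Lemma lebesgue_rV_sigma_finite n : sigma_finite setT (lebesgue_rV R n).
Proof.
elim: n => [|n ih].
  pose dl : {finite_measure set 'rV[R]_0 -> \bar R} := \d_(0 : 'rV[R]_0).
  exact: (sigma_finiteT dl).
pose m : {sigma_finite_measure set 'rV[R]_n -> \bar R} := sf_measure ih.
have mE : (m : {measure set _ -> \bar R}) = lebesgue_rV R n := sf_measureE ih.
have [F FT mF] := product_sigma_finite m leb.
exists (fun i => @rV_uncons R n @^-1` F i).
  by rewrite -preimage_bigcup -FT preimage_setT.
move=> i; have [mFi Fi] := mF i; split.
  by rewrite -[X in measurable X]setTI; exact: measurable_rV_uncons.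
rewrite /= /rV_cons_measure /pushforward -[X in (X \x _)%E]/(lebesgue_rV R n : set _ -> _).
rewrite (_ : _ @^-1` _ = F i)//.
by apply/seteqP; split => z /=; rewrite rV_consK.
Qed.

Definition leb_rV (n : nat) : {sigma_finite_measure set 'rV[R]_n -> \bar R} :=
  sf_measure (lebesgue_rV_sigma_finite n).

Section first_coordinate.
Variable n : nat.
Local Notation mu := (leb_rV n).

Lemma integrable_rV_cons (f : 'rV[R]_n.+1 -> \bar R) :
  measurable_fun setT f ->
  (lebesgue_rV R n.+1).-integrable setT f <->
  (mu \x leb)%E.-integrable setT (f \o @rV_cons R n).
Proof.
move=> mf; split=> fi.
- apply/integrableP; split.
    exact: measurableT_comp mf (@measurable_rV_cons R n).
  have /integrableP[_] := fi; apply: le_lt_trans.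
  rewrite [leRHS](ge0_integral_pushforward (@measurable_rV_cons R n)
    (mu \x leb)%E measurableT)//.
  exact: measurableT_comp.
- exact: (integrable_pushforward (@measurable_rV_cons R n) mf fi measurableT).
Qed.

Lemma integral_rV_cons (f : 'rV[R]_n.+1 -> \bar R) :
  (lebesgue_rV R n.+1).-integrable setT f ->
  (\int[lebesgue_rV R n.+1]_x f x = \int[mu \x leb]_z f (rV_cons z))%E.
Proof.
move=> fi; have mf := measurable_int _ fi.
have fi' := (integrable_rV_cons mf).1 fi.
exact: (integral_pushforward (@measurable_rV_cons R n) mf fi' measurableT).
Qed.

Lemma cintegrable_rV_cons (f : 'rV[R]_n.+1 -> R[i]) :
  cintegrable (lebesgue_rV R n.+1) f ->
  cintegrable (mu \x leb)%E (fun z => f (rV_cons z)).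
Proof.
move=> [f1 f2]; split.
- exact: (integrable_rV_cons (measurable_int _ f1)).1 f1.
- exact: (integrable_rV_cons (measurable_int _ f2)).1 f2.
Qed.

Lemma cintegral_rV_cons (f : 'rV[R]_n.+1 -> R[i]) :
  cintegrable (lebesgue_rV R n.+1) f ->
  cintegral (lebesgue_rV R n.+1) f =
  cintegral (mu \x leb)%E (fun z => f (rV_cons z)).
Proof.
by move=> [f1 f2]; rewrite /cintegral /Rintegral !integral_rV_cons.
Qed.

End first_coordinate.
End lebesgue_rV_fubini.

(** * Quadratic forms and Gaussian integrals on R^n *)

Section quadratic_form.
Context (F : fieldType).

(** Vectors are rows; [bf] is bilinear, without conjugation, also over the complex
    numbers, so that a real vector enters a complex form through [toC]. *)
Definition qf n (M : 'M[F]_n) (z : 'rV[F]_n) : F := (z *m M *m z^T) ord0 ord0.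

Definition bf n (M : 'M[F]_n) (z w : 'rV[F]_n) : F := (z *m M *m w^T) ord0 ord0.

Lemma qfE n (M : 'M[F]_n) z :
  qf M z = \sum_j (\sum_i z ord0 i * M i j) * z ord0 j.
Proof. by rewrite /qf mxE; apply: eq_bigr => j _; rewrite !mxE. Qed.

Lemma mx11E (A : 'M[F]_1) : A = (A ord0 ord0)%:M.
Proof. by apply/matrixP => i j; rewrite !ord1 !mxE eqxx mulr1n. Qed.

Section schur.
Variables (n : nat) (M : 'M[F]_(1 + n)).
Hypothesis MT : M^T = M.

Definition pivot : F := M ord0 ord0.
Definition schur : 'M[F]_n :=
  drsubmx M - pivot^-1 *: ((ursubmx M)^T *m ursubmx M).

Lemma ulsubmx_pivot : @ulsubmx F 1 n 1 n M = pivot%:M.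
Proof.
rewrite [LHS]mx11E; congr (_%:M); rewrite !mxE /pivot.
by congr (M _ _); apply/val_inj.
Qed.

Lemma dlsubmx_sym : @dlsubmx F 1 n 1 n M = (ursubmx M)^T.
Proof. by rewrite trmx_ursub MT. Qed.

Lemma schur_sym : schur^T = schur.
Proof.
by rewrite /schur linearB /= linearZ /= trmx_mul trmxK trmx_drsub MT.
Qed.

(** Completing the square in the first variable. *)
Lemma qf_schur (a : F) (v : 'rV[F]_n) : pivot != 0 ->
  qf M (row_mx a%:M v) =
  pivot * (a + pivot^-1 * (ursubmx M *m v^T) ord0 ord0) ^+ 2 + qf schur v.
Proof.
move=> p0; rewrite /qf -[M in LHS](@submxK F 1 n 1 n).
rewrite ulsubmx_pivot dlsubmx_sym mul_row_block tr_row_mx mul_row_col.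
rewrite /schur mulmxBr mulmxBl -scalemxAr -scalemxAl.
rewrite !mulmxDl !mul_scalar_mx tr_scalar_mx !mul_mx_scalar.
rewrite -!scalemxAl !mulmxA.
have -> : v *m (ursubmx M)^T = (ursubmx M *m v^T)^T by rewrite trmx_mul trmxK.
set r := ursubmx M *m v^T.
have -> : r^T *m ursubmx M *m v^T = ((r ord0 ord0) ^+ 2)%:M.
  rewrite -mulmxA -/r [r]mx11E !mxE /= tr_scalar_mx -scalar_mxM.
  by rewrite mulr1n expr2.
rewrite [r]mx11E tr_scalar_mx !mxE /= !mulr1n.
by field.
Qed.

End schur.

Section bilinear.
Variables (n : nat).
Implicit Types (M : 'M[F]_n) (z w : 'rV[F]_n).

Lemma bfDl M z1 z2 w : bf M (z1 + z2) w = bf M z1 w + bf M z2 w.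
Proof. by rewrite /bf !mulmxDl mxE. Qed.
Lemma bfZl M a z w : bf M (a *: z) w = a * bf M z w.
Proof. by rewrite /bf -!scalemxAl mxE. Qed.
Lemma bfDr M z w1 w2 : bf M z (w1 + w2) = bf M z w1 + bf M z w2.
Proof. by rewrite /bf linearD /= mulmxDr mxE. Qed.
Lemma bfZr M a z w : bf M z (a *: w) = a * bf M z w.
Proof. by rewrite /bf linearZ /= -scalemxAr mxE. Qed.
Lemma bfNl M z w : bf M (- z) w = - bf M z w.
Proof. by rewrite -scaleN1r bfZl mulN1r. Qed.
Lemma bfNr M z w : bf M z (- w) = - bf M z w.
Proof. by rewrite -scaleN1r bfZr mulN1r. Qed.
Lemma bfMD M N z w : bf (M + N) z w = bf M z w + bf N z w.
Proof. by rewrite /bf mulmxDr mulmxDl mxE. Qed.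
Lemma bfMZ a M z w : bf (a *: M) z w = a * bf M z w.
Proof. by rewrite /bf -scalemxAr -scalemxAl mxE. Qed.
Lemma bfC M z w : M^T = M -> bf M z w = bf M w z.
Proof.
move=> MT; rewrite /bf -[in RHS]MT -[w in RHS]trmxK -!trmx_mul mulmxA.
by rewrite [RHS]mxE.
Qed.
Lemma qf_bf M z : qf M z = bf M z z. Proof. by []. Qed.

Lemma bf_delta M (i j : 'I_n) :
  bf M (delta_mx ord0 i) (delta_mx ord0 j) = M i j.
Proof.
by rewrite /bf -rowE trmx_delta -colE !mxE.
Qed.

Lemma bf_mulmx M N z w : bf M z (w *m N) = bf (M *m N^T) z w.
Proof. by rewrite /bf trmx_mul !mulmxA. Qed.

Lemma bf_mulmxl M N z w : bf M (z *m N) w = bf (N *m M) z w.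
Proof. by rewrite /bf !mulmxA. Qed.

Lemma bf_gram (r v : 'rV[F]_n) :
  bf (r^T *m r) v v = ((r *m v^T) ord0 ord0) ^+ 2.
Proof.
rewrite /bf mulmxA -[v *m r^T]trmxK trmx_mul trmxK -mulmxA [r *m v^T]mx11E.
by rewrite tr_scalar_mx -scalar_mxM !mxE eqxx !mulr1n expr2.
Qed.
End bilinear.
End quadratic_form.

Section real_gaussian.
Context (R : realType).
Local Notation leb := (@lebesgue_measure R).
Local Notation RT := (measurableTypeR R).

Definition posdef n (P : 'M[R]_n) := forall x, x != 0 -> 0 < qf P x.

Lemma row_mx_eq0 (F : fieldType) n (a : 'rV[F]_1) (v : 'rV[F]_n) :
  (row_mx a v == 0) = (a == 0) && (v == 0).
Proof. by rewrite -row_mx0; apply/eqP/andP => [/eq_row_mx[-> ->]//|[/eqP-> /eqP->]]. Qed.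

Lemma posdef_pivot n (P : 'M[R]_(1 + n)) : posdef P -> 0 < pivot P.
Proof.
move=> posP; have := posP (row_mx 1%:M 0).
rewrite row_mx_eq0 negb_and; have -> : 1%:M != 0 :> 'rV[R]_1.
  by apply/eqP => /matrixP/(_ ord0 ord0); rewrite !mxE eqxx mulr1n => /eqP; rewrite oner_eq0.
move=> /(_ isT); rewrite -[P in qf P _](@submxK R 1 n 1 n) ulsubmx_pivot /qf.
rewrite mul_row_block tr_row_mx mul_row_col !mul0mx !addr0 trmx0 mulmx0 addr0.
by rewrite !mul1mx trmx1 mulmx1 mxE eqxx mulr1n.
Qed.

Lemma posdef_schur n (P : 'M[R]_(1 + n)) : P^T = P -> posdef P ->
  posdef (schur P).
Proof.
move=> PT posP v v0; have p0 := posdef_pivot posP.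
have pn0 : pivot P != 0 by rewrite gt_eqF.
have := posP (row_mx (- ((pivot P)^-1 * (ursubmx P *m v^T) ord0 ord0))%:M v).
rewrite row_mx_eq0 negb_and v0 orbT qf_schur// addNr expr0n mulr0 add0r.
exact.
Qed.

Lemma measurable_qf n (P : 'M[R]_n) (y : 'rV[R]_n) :
  measurable_fun setT (fun x : 'rV[R]_n => qf P (x - y) : RT).
Proof.
under eq_fun do rewrite qfE.
have mc i : measurable_fun setT (fun x : 'rV[R]_n => (x - y) ord0 i : RT).
  under eq_fun do rewrite !mxE.
  by apply: measurable_funD => //; exact: measurable_rV_coord.
apply: measurable_sum => j; apply: measurable_funM; last exact: mc.
apply: measurable_sum => i; apply: measurable_funM => //; exact: mc.
Qed.

(** Integrating out the first coordinate leaves the Gaussian of the Schur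
    complement. *)
Lemma integrable_gauss_rV n (P : 'M[R]_n) : P^T = P -> posdef P ->
  forall y, (lebesgue_rV R n).-integrable setT
    (fun x => (expR (- qf P (x - y)))%:E).
Proof.
elim: n P => [|n ih] P PT posP y.
  rewrite (_ : (fun _ => _) = EFin \o cst (expR (- qf P (0 - y)))).
    exact: (finite_measure_integrable_cst \d_(0 : 'rV[R]_0)).
  by apply/funext => x /=; rewrite [x]thinmx0.
have mf m (Q : 'M[R]_m) z : measurable_fun setT
    (fun x : 'rV[R]_m => (expR (- qf Q (x - z)))%:E).
  apply/measurable_EFinP; apply: (measurableT_comp (@measurable_expR R)).
  by apply: (measurableT_comp (@oppr_measurable R _)); exact: measurable_qf.
apply/(integrable_rV_cons (mf _ _ _)).
have mf' : measurable_fun setT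
    ((fun x => (expR (- qf P (x - y)))%:E) \o @rV_cons R n).
  exact: measurableT_comp (mf _ _ _) (@measurable_rV_cons R n).
have p0 := posdef_pivot posP; have pn0 : pivot P != 0 by rewrite gt_eqF.
apply/(integrable12ltyP _ _ mf') => /=.
have [G G0 GE] : exists2 G : R, 0 < G & forall z,
    (\int[leb]_x (expR (- (pivot P * (x - z) ^+ 2)))%:E = G%:E)%E.
  exact: integral_gauss_gt0.
set P' := schur P; pose y' := @rsubmx R 1 1 n y.
pose z (x : 'rV[R]_n) := y ord0 ord0 -
   (pivot P)^-1 * (@ursubmx R 1 n 1 n P *m (x - y')^T) ord0 ord0.
have E x t : qf P (rV_cons (x, t) - y) =
    pivot P * (t - z x) ^+ 2 + qf P' (x - y').
  rewrite -[y in LHS](@hsubmxK R 1 1 n) /rV_cons /=.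
  rewrite (@opp_row_mx R 1 1 n) (@add_row_mx R 1 1 n) -/y'.
  have -> : t%:M - @lsubmx R 1 1 n y = (t - y ord0 ord0)%:M.
    rewrite [RHS]raddfB /=; congr (_ - _); rewrite [LHS]mx11E; congr (_%:M).
    by rewrite mxE; congr (y _ _); apply/val_inj.
  by rewrite qf_schur// /z; congr (_ * _ ^+ 2 + _); ring.
rewrite (eq_integral (fun x : 'rV[R]_n => (G%:E * (expR (- qf P' (x - y')))%:E)%E)); last first.
  move=> x _; rewrite -(GE (z x)).
  rewrite -ge0_integralZr//; last first.
    by apply/measurable_EFinP; exact: measurable_gauss.
  apply: eq_integral => t _; rewrite E opprD expRD ger0_norm ?mulr_ge0 ?expR_ge0//.
rewrite integralZl//; last exact: ih (schur_sym PT) (posdef_schur PT posP) y'.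
rewrite lte_mul_pinfty// ?lee_fin ?ltW//.
exact: (integrable_lty measurableT (ih P' (schur_sym PT) (posdef_schur PT posP) y')).
Qed.

Lemma posdef_unit n (P : 'M[R]_n) : posdef P -> P \in unitmx.
Proof.
move=> posP; rewrite -row_free_unit -kermx_eq0; apply/negPn/negP => /rowV0Pn.
move=> [v /sub_kermxP vP v0]; have := posP v v0.
by rewrite /qf vP mul0mx mxE ltxx.
Qed.
End real_gaussian.

Section complex_gaussian.
Context (R : realType).
Local Notation C := R[i].
Local Notation leb := (@lebesgue_measure R).
Local Notation RT := (measurableTypeR R).

Local Notation toC := (map_mx (real_complex R)).
Local Notation mRe := (map_mx (@complex.Re R)).
Local Notation mIm := (map_mx (@complex.Im R)).

Lemma mx_ReIm m n (M : 'M[C]_(m, n)) : M = toC (mRe M) + 'i%C *: toC (mIm M).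
Proof. by apply/matrixP => i j; rewrite !mxE -complexE. Qed.

Lemma bf_toC n (P : 'M[R]_n) x y : bf (toC P) (toC x) (toC y) = (bf P x y)%:c.
Proof. by rewrite /bf map_trmx -!map_mxM mxE. Qed.

Lemma bf_toCE n (M : 'M[C]_n) x y : bf M (toC x) (toC y) =
  (bf (mRe M) x y)%:c + 'i%C * (bf (mIm M) x y)%:c.
Proof. by rewrite {1}[M]mx_ReIm bfMD bfMZ !bf_toC. Qed.

Lemma mRe_sym n (M : 'M[C]_n) : M^T = M -> (mRe M)^T = mRe M.
Proof. by move=> MT; rewrite map_trmx MT. Qed.
Lemma mIm_sym n (M : 'M[C]_n) : M^T = M -> (mIm M)^T = mIm M.
Proof. by move=> MT; rewrite map_trmx MT. Qed.

Lemma cmeasurable_qf n (M : 'M[C]_n) (h : 'rV[C]_n) :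
  cmeasurable (fun x : 'rV[R]_n => qf M (toC x - h)).
Proof.
under eq_fun do rewrite qfE.
have mc i : cmeasurable (fun x : 'rV[R]_n => (toC x - h) ord0 i).
  under eq_fun do rewrite !mxE.
  apply: cmeasurableD; last exact: cmeasurable_cst.
  exact: (cmeasurableC (measurable_rV_coord i)).
apply: cmeasurable_sum => j _; apply: cmeasurableM; last exact: mc.
apply: cmeasurable_sum => i _; apply: cmeasurableM; first exact: mc.
exact: cmeasurable_cst.
Qed.

(** A complex centre h1 + i h2 is the same, in modulus and up to a constant, as the
    real centre h1 - h2 Q P^-1, where P and Q are the real and imaginary parts
    of M. *)
Lemma cintegrable_gauss n (M : 'M[C]_n) (h : 'rV[C]_n) :
  M^T = M -> posdef (mRe M) ->
  cintegrable (lebesgue_rV R n) (fun x => cexp (- qf M (toC x - h))).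
Proof.
move=> MT posM; set P := mRe M; set Q := mIm M.
have PT : P^T = P := mRe_sym MT; have QT : Q^T = Q := mIm_sym MT.
pose h1 := mRe h; pose h2 := mIm h.
pose s := h2 *m Q *m invmx P; pose y := h1 - s.
have PU := posdef_unit posM.
have E x : Re (qf M (toC x - h)) = qf P (x - y) - (bf P s s + bf P h2 h2).
  have -> : toC x - h = toC (x - h1) + (- 'i%C) *: toC h2.
    rewrite {1}[h]mx_ReIm -/h1 -/h2 (map_mxB (real_complex R)).
    by rewrite opprD addrA scaleNr.
  have -> : x - y = (x - h1) + s by rewrite /y opprB addrCA addrC.
  move: (x - h1) => w.
  have Ps v : bf P v s = bf Q v h2.
    rewrite (bfC _ _ PT) /bf mulmxKV// -/(bf Q h2 v); exact: bfC.
  rewrite !qf_bf !(bfDl, bfDr, bfZl, bfZr) !bf_toCE -/P -/Q !Ps.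
  rewrite (bfC h2 w PT) (bfC h2 w QT) (bfC s w PT) !Ps.
  rewrite !ReImE /=; ring.
apply: (@le_cintegrable _ _ _ _ _
  (fun x : 'rV[R]_n => expR (bf P s s + bf P h2 h2) * expR (- qf P (x - y)))).
- exact/cmeasurable_cexp/cmeasurableN/cmeasurable_qf.
- have := integrableZl measurableT (expR (bf P s s + bf P h2 h2))
    (integrable_gauss_rV PT posM y).
  by apply: eq_integrable.
- by move=> x; rewrite normc_cexp -expRD ler_expR ReN E opprB.
Qed.

(** The real part of the Schur complement dominates the Schur complement of the
    real part: if the pivot is c + i d and the off-diagonal row pairs with v to
    a + i b, the difference at v is (c b - d a)^2 / (c (c^2 + d^2)). *)
Lemma mRe_schur_posdef n (M : 'M[C]_(1 + n)) : M^T = M -> posdef (mRe M) ->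
  posdef (mRe (schur M)).
Proof.
move=> MT posM v v0; set P : 'M[R]_(1 + n) := mRe M.
have PT : P^T = P := mRe_sym MT.
have p0 : 0 < pivot P := posdef_pivot posM.
have pE : Re (pivot M) = pivot P by rewrite /pivot mxE.
set q := (pivot M); set r := (ursubmx M *m (toC v)^T) ord0 ord0.
have rE : Re r = (ursubmx P *m v^T) ord0 ord0.
  rewrite /r !mxE Re_sum; apply: eq_bigr => k _.
  by rewrite !mxE ReM /= mulr0 subr0.
have E1 : Re (qf (schur M) (toC v)) =
    qf (@drsubmx R 1 n 1 n P) v - Re (q^-1 * r ^+ 2).
  rewrite /schur qf_bf bfMD -scaleNr bfMZ mulNr ReD ReN; congr (_ - Re (_ * _)).
    rewrite bf_toCE !ReImE /=; rewrite qf_bf map_drsubmx.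
    by ring.
  exact: bf_gram.
have E2 : qf (mRe (schur M)) v = Re (qf (schur M) (toC v)).
  by rewrite [in RHS]qf_bf bf_toCE !ReImE /= qf_bf; ring.
rewrite E2 E1.
have := posdef_schur PT posM v0.
rewrite /schur qf_bf bfMD -scaleNr bfMZ -/P.
rewrite bf_gram -rE.
move/lt_le_trans; apply; rewrite /bf /qf mulNr lerD2l lerN2.
rewrite expr2 !ReImE ReV ImV pE sqr_normcE pE -/q.
move: (Re r) (Im r) (pivot P) (Im q) p0 => a b c d c0.
have cd : 0 < c ^+ 2 + d ^+ 2 by rewrite ltr_wpDr ?sqr_ge0// exprn_gt0.
rewrite -subr_ge0.
have -> : c^-1 * a ^+ 2 - (c / (c ^+ 2 + d ^+ 2) * (a * a - b * b) -
    - d / (c ^+ 2 + d ^+ 2) * (a * b + b * a)) =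
    (c * b - d * a) ^+ 2 / (c * (c ^+ 2 + d ^+ 2)).
  by field; rewrite !gt_eqF.
by rewrite divr_ge0 ?sqr_ge0// mulr_ge0// ltW.
Qed.

(** Gaussian integrals do not change when the centre is moved into the complex
    domain.  Completing the square in one coordinate reduces this to the Schur
    complement and to the one-dimensional statement. *)
Lemma cintegral_gauss n (M : 'M[C]_n) : M^T = M -> posdef (mRe M) ->
  exists2 Z : C, Z != 0 & forall h : 'rV[C]_n,
  cintegral (lebesgue_rV R n) (fun x => cexp (- qf M (toC x - h))) = Z.
Proof.
elim: n M => [|n ih] M MT posM.
  exists (cexp (- qf M 0)); first exact: cexp_neq0.
  have H (f : 'rV[R]_0 -> R) : \int[lebesgue_rV R 0]_x f x = f 0.
    rewrite (_ : f = cst (f 0)); last by apply/funext => x; rewrite [x]thinmx0.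
    by rewrite Rintegral_cst// [lebesgue_rV R 0 _]diracT mulr1.
  by move=> h; rewrite /cintegral !H [toC 0 - h]thinmx0.
pose M1 : 'M[C]_(1 + n) := M.
have MT' : M1^T = M1 by exact: MT.
have posM' : posdef (mRe M1) by exact: posM.
have p0 : 0 < Re (pivot M1).
  by have := posdef_pivot posM'; rewrite /pivot mxE.
set m := pivot M1 in p0.
have m0 : m != 0 by apply: contraTneq p0 => ->; rewrite ltxx.
have [Z0 Z0n HZ0] := cgauss_line p0.
have [Z1 Z1n HZ1] := ih (schur M1) (schur_sym MT')
  (mRe_schur_posdef MT' posM').
exists (Z0 * Z1) => [|h]; first by rewrite mulf_neq0.
pose h' := @rsubmx C 1 1 n h.
pose z (x : 'rV[R]_n) := h ord0 ord0 -
   m^-1 * (@ursubmx C 1 n 1 n M *m (toC x - h')^T) ord0 ord0.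
have E x t : qf M (toC (rV_cons (x, t)) - h) =
    m * (t%:c - z x) ^+ 2 + qf (schur M1) (toC x - h').
  rewrite -[h in LHS](@hsubmxK C 1 1 n) /rV_cons /=.
  rewrite (@map_row_mx _ _ _ 1 1 n) (@opp_row_mx C 1 1 n) (@add_row_mx C 1 1 n).
  have -> : toC (t : R)%:M - @lsubmx C 1 1 n h = (t%:c - h ord0 ord0)%:M.
    rewrite [RHS]raddfB /= map_scalar_mx; congr (_ - _); rewrite [LHS]mx11E.
    by congr (_%:M); rewrite mxE; congr (h _ _); apply/val_inj.
  by rewrite (qf_schur MT')// -/m /z; congr (_ * _ ^+ 2 + _); ring.
have ci := cintegrable_gauss h MT posM.
have ci' := cintegrable_gauss h' (schur_sym MT') (mRe_schur_posdef MT' posM').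
have fE x t : cexp (- qf M (toC (rV_cons (x, t)) - h)) =
    cexp (- qf (schur M1) (toC x - h')) *
    cexp (- (m * (t%:c - z x) ^+ 2)).
  by rewrite E opprD addrC cexpD.
have [ci1 cE1] : (forall x, cintegrable leb (fun t : RT =>
      cexp (- qf M (toC (rV_cons (x, t)) - h)))) /\
   (forall x, cintegral leb (fun t : RT =>
      cexp (- qf M (toC (rV_cons (x, t)) - h))) =
      Z0 * cexp (- qf (schur M1) (toC x - h'))).
  split=> x; have [i1 i2] := HZ0 (z x); rewrite (funext (fE x)).
    exact: cintegrableZ.
  by rewrite cintegralZ// i2 mulrC.
rewrite (cintegral_rV_cons ci) (cintegral_prod1 (cintegrable_rV_cons ci) ci1).
rewrite -(HZ1 h') -(cintegralZ Z0 ci'); exact: eq_cintegral.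
Qed.

End complex_gaussian.

(** * Fourier transforms of Gaussians and their correlations *)

Section complex_symmetric.
Context (R : realType).
Local Notation C := R[i].
Local Notation toC := (map_mx (real_complex R)).
Local Notation mRe := (map_mx (@complex.Re R)).
Local Notation mIm := (map_mx (@complex.Im R)).
Local Notation mJ := (map_mx (@conjc R)).

Variables (n : nat) (M : 'M[C]_n).
Hypotheses (MT : M^T = M) (posM : posdef (mRe M)).

Let P := mRe M.
Let Pi := invmx P.
Let Rm := invmx M.

Let PT : P^T = P. Proof. exact: mRe_sym. Qed.
Let PU : P \in unitmx. Proof. exact: posdef_unit. Qed.

Lemma bf_conj (y : 'rV[C]_n) :
  bf (toC P) y (mJ y) = (qf P (mRe y) + qf P (mIm y))%:c.
Proof.
have -> : mJ y = toC (mRe y) - 'i%C *: toC (mIm y).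
  by apply/matrixP => i j; rewrite !mxE; apply: complex_eq; rewrite !ReImE /=; ring.
rewrite {1}[y]mx_ReIm !(bfDl, bfDr, bfNr, bfZl, bfZr) !bf_toC !qf_bf.
rewrite (bfC (mIm y) (mRe y) PT).
by apply: complex_eq; rewrite !ReImE /=; ring.
Qed.

Lemma posdef_ge0 (x : 'rV[R]_n) : 0 <= qf P x.
Proof.
have [->|/posM/ltW//] := eqVneq x 0.
by rewrite /qf !mul0mx mxE.
Qed.

Lemma mReIm_eq0 (y : 'rV[C]_n) : mRe y = 0 -> mIm y = 0 -> y = 0.
Proof.
move=> y1 y2; rewrite [y]mx_ReIm y1 y2.
by apply/matrixP => i j; rewrite !mxE mulr0 addr0.
Qed.

Lemma posdef_ReIm_gt0 (y : 'rV[C]_n) : y != 0 ->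
  0 < qf P (mRe y) + qf P (mIm y).
Proof.
move=> y0; have [y1|y1] := eqVneq (mRe y) 0; last first.
  by rewrite ltr_wpDr ?posM ?posdef_ge0.
have [y2|y2] := eqVneq (mIm y) 0; last by rewrite ltr_wpDl ?posM ?posdef_ge0.
by move: y0; rewrite (mReIm_eq0 y1 y2) eqxx.
Qed.

Lemma map_conj_mul m1 m2 m3 (K : 'M[C]_(m1, m2)) (L : 'M[C]_(m2, m3)) :
  mJ (K *m L) = mJ K *m mJ L.
Proof. exact: map_mxM. Qed.

Lemma mJ_toC m1 m2 (K : 'M[R]_(m1, m2)) : mJ (toC K) = toC K.
Proof. by apply/matrixP => i j; rewrite !mxE conjc_real. Qed.

Lemma M_add_conj : M + mJ M = 2 *: toC P.
Proof.
by apply/matrixP => i j; rewrite !mxE addcJ.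
Qed.

(** If y M = 0 then the Hermitian form of Re M vanishes at y. *)
Lemma symmetric_unit : M \in unitmx.
Proof.
rewrite -row_free_unit -kermx_eq0; apply/negPn/negP => /rowV0Pn.
move=> [y /sub_kermxP yM y0]; have := posdef_ReIm_gt0 y0.
have : bf (M + mJ M) y (mJ y) = 0.
  rewrite bfMD {1}/bf yM mul0mx mxE add0r.
  rewrite /bf -[M]MT -map_trmx -mulmxA -trmx_mul -map_conj_mul yM.
  have -> : mJ (0 : 'rV[C]_n) = 0.
    by apply/matrixP => i j; rewrite !mxE rmorph0.
  by rewrite trmx0 mulmx0 mxE.
rewrite M_add_conj bfMZ bf_conj natCE -rmorphM => -[/eqP].
by rewrite mulf_eq0 pnatr_eq0 /= => /eqP ->; rewrite ltxx.
Qed.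
Let MU := symmetric_unit.

Let RT' : Rm^T = Rm. Proof. by rewrite /Rm trmx_inv MT. Qed.
Let RM : Rm *m M = 1%:M. Proof. exact: mulVmx. Qed.
Let MR : M *m Rm = 1%:M. Proof. exact: mulmxV. Qed.

Let mJ1 : mJ (1%:M : 'M[C]_n) = 1%:M.
Proof. by apply/matrixP => i j; rewrite !mxE conjc_nat. Qed.

Let JMR : mJ M *m mJ Rm = 1%:M.
Proof. by rewrite -map_conj_mul MR mJ1. Qed.
Let JRM : mJ Rm *m mJ M = 1%:M.
Proof. by rewrite -map_conj_mul RM mJ1. Qed.

(** Multiply M + conj(M) = 2 P by R on the left and by conj(R) on the right. *)
Lemma mRe_inv : toC (mRe Rm) = Rm *m toC P *m mJ Rm.
Proof.
have two : (2 : C) != 0 by rewrite pnatr_eq0.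
apply: (scalerI two).
transitivity (Rm + mJ Rm).
  by apply/matrixP => i j; rewrite !mxE addcJ.
rewrite scalemxAl scalemxAr -M_add_conj mulmxDr RM mulmxDl mul1mx.
by rewrite -mulmxA JMR mulmx1 addrC.
Qed.

Lemma mRe_inv_sym : (mRe Rm)^T = mRe Rm.
Proof. exact: mRe_sym. Qed.

Lemma qf_mRe_inv (v : 'rV[R]_n) : qf (mRe Rm) v =
  qf P (mRe (toC v *m Rm)) + qf P (mIm (toC v *m Rm)).
Proof.
apply: (@complexI R); rewrite -bf_conj map_conj_mul mJ_toC.
rewrite qf_bf -bf_toC mRe_inv bf_mulmx map_trmx RT' bf_mulmxl.
by rewrite mulmxA.
Qed.

Lemma mRe_inv_posdef : posdef (mRe Rm).
Proof.
move=> v v0; rewrite qf_mRe_inv posdef_ReIm_gt0//.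
apply: contra v0 => /eqP vR; apply/eqP.
have : toC v *m Rm *m M = 0 by rewrite vR mul0mx.
rewrite -mulmxA RM mulmx1 => /matrixP v0; apply/matrixP => i j.
by have := v0 i j; rewrite !mxE => -[].
Qed.

Lemma invmx_uniq (F : fieldType) m (A B : 'M[F]_m) : A *m B = 1%:M ->
  invmx A = B.
Proof.
move=> AB; have /andP[AU _] : (A \in unitmx) && (B \in unitmx).
  by apply/andP; split; have := mulmx1_unit AB; case.
by rewrite -[LHS]mulmx1 -AB mulKmx.
Qed.

Let PPi : toC P *m toC Pi = 1%:M.
Proof. by rewrite -map_mxM mulmxV// map_mx1. Qed.

(** With R = M^-1, (Re R)^-1 = conj(M) Pi M by [mRe_inv], and conj(M) = 2 P - M.
    This identity is what makes the exponent of the correlation linear in R. *)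
Lemma inv_mRe_inv : Rm *m toC (invmx (mRe Rm)) *m Rm = 2 *: Rm - toC Pi.
Proof.
have -> : toC (invmx (mRe Rm)) = mJ M *m toC Pi *m M.
  rewrite map_invmx; apply: invmx_uniq; rewrite mRe_inv !mulmxA.
  rewrite -(mulmxA _ (mJ Rm) (mJ M)) JRM mulmx1 -(mulmxA _ (toC P)) PPi.
  by rewrite mulmx1 RM.
have -> : mJ M = 2 *: toC P - M by rewrite -M_add_conj addrC addKr.
rewrite !mulmxA -(mulmxA _ M Rm) MR mulmx1 mulmxBr mulmxBl RM mul1mx.
by rewrite -scalemxAr -scalemxAl -mulmxA PPi mulmx1.
Qed.

Lemma bf_inv_mRe_inv z w :
  bf (Rm *m toC (invmx (mRe Rm)) *m Rm) z w = 2 * bf Rm z w - bf (toC Pi) z w.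
Proof.
by rewrite inv_mRe_inv /bf mulmxBr mulmxBl -scalemxAr -scalemxAl !mxE.
Qed.

(** Young's inequality for the dual pair P, Pi. *)
Lemma bf1_le (y v : 'rV[R]_n) : `|2 * bf 1%:M y v| <= qf P y + qf Pi v.
Proof.
have PiT : Pi^T = Pi by rewrite /Pi trmx_inv PT.
have E1 w : bf P w (v *m Pi) = bf 1%:M w v.
  by rewrite bf_mulmx PiT mulmxV.
have E2 : bf 1%:M (v *m Pi) v = qf Pi v by rewrite bf_mulmxl mulmx1.
have h1 := posdef_ge0 (y - v *m Pi); have h2 := posdef_ge0 (y + v *m Pi).
rewrite !qf_bf !(bfDl, bfDr, bfNl, bfNr) (bfC (v *m Pi) y PT) !E1 E2 -!qf_bf in h1 h2.
rewrite ler_norml.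
apply/andP; split; lra.
Qed.

(** The bound depends on the real part of M only, hence is uniform for the matrices
    A - i t S.  With y = v R one has Re R[v] = P[Re y] + P[Im y], while the duality
    inequality bounds 2 |Re R[v]| and 2 |Im R[v]|, where R[v] = y.v, by the sum of one
    of these terms and Pi[v]. *)
Lemma normc_qf_inv (v : 'rV[R]_n) : normc (qf Rm (toC v)) <= 2 * qf Pi v.
Proof.
set y := toC v *m Rm.
have E : qf Rm (toC v) = bf 1%:M y (toC v) by rewrite bf_mulmxl mulmx1.
have E1 : Re (qf Rm (toC v)) = bf 1%:M (mRe y) v.
  rewrite E {1}[y]mx_ReIm bfDl bfZl -(map_mx1 (real_complex R)) !bf_toC !ReImE /=.
  by ring.
have E2 : Im (qf Rm (toC v)) = bf 1%:M (mIm y) v.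
  rewrite E {1}[y]mx_ReIm bfDl bfZl -(map_mx1 (real_complex R)) !bf_toC !ReImE /=.
  by ring.
have E3 : Re (qf Rm (toC v)) = qf P (mRe y) + qf P (mIm y).
  by rewrite -qf_mRe_inv qf_bf bf_toCE !ReImE /= qf_bf; ring.
rewrite (le_trans (normc_le_ReIm _))//.
have h1 := bf1_le (mRe y) v; have h2 := bf1_le (mIm y) v.
rewrite -E1 in h1; rewrite -E2 in h2; rewrite normrM in h2.
have a0 := posdef_ge0 (mRe y); have b0 := posdef_ge0 (mIm y).
rewrite E3 in h1 *; move/(le_trans (ler_norm _)) in h1.
rewrite (ger0_norm (addr_ge0 a0 b0)).
rewrite (ger0_norm (ler0n _ _)) in h2.
move: (normr_ge0 (Im (qf Rm (toC v)))) => n0.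
lra.
Qed.

Lemma cintegrable_gauss_dot (l : 'rV[C]_n) (c : C) :
  cintegrable (lebesgue_rV R n) (fun xi =>
    cexp (- qf M (toC xi) + bf 1%:M (toC xi) l + c)).
Proof.
have e := cintegrable_gauss (2^-1 *: (l *m Rm)) MT posM.
have := cintegrableZ (cexp (c + qf M (2^-1 *: (l *m Rm)))) e.
apply: eq_cintegrable => x; rewrite -cexpD; congr cexp.
rewrite !qf_bf !(bfDl, bfDr, bfNl, bfNr) (bfC _ (toC x) MT) !bfZl !bfZr.
have E w : bf M w (l *m Rm) = bf 1%:M w l by rewrite bf_mulmx RT' MR.
by rewrite !E; move: (bf _ _ _) (bf _ _ _) (bf _ _ _) => x1 x2 x3; field.
Qed.

(** The linear term l moves the centre to l R / 2. *)
Lemma cintegral_gauss_dot : exists2 Z : C, Z != 0 & forall l c,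
  cintegral (lebesgue_rV R n) (fun xi =>
    cexp (- qf M (toC xi) + bf 1%:M (toC xi) l + c)) = cexp (4^-1 * qf Rm l + c) * Z.
Proof.
have [Z Z0 HZ] := cintegral_gauss MT posM.
exists Z => // l c.
rewrite -(HZ (2^-1 *: (l *m Rm))) -cintegralZ; last exact: cintegrable_gauss.
apply: eq_cintegral => x; rewrite -cexpD; congr cexp.
rewrite !qf_bf !(bfDl, bfDr, bfNl, bfNr) (bfC _ (toC x) MT) !bfZl !bfZr.
have E z : bf M z (l *m Rm) = bf 1%:M z l by rewrite bf_mulmx RT' MR.
rewrite !E bf_mulmxl mulmx1.
by move: (bf _ _ _) (bf _ _ _) (bf _ _ _) => x1 x2 x3; field.
Qed.

Section slice.
Variables (b : 'rV[C]_n) (c : C) (q : R).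
Hypothesis q0 : 0 < q.

(** One time slice of the extension of a Gaussian, as a function of the space
    variable x. *)
Definition gauss_ft (x : 'rV[R]_n) : C := cintegral (lebesgue_rV R n)
  (fun xi => cexp (- qf M (toC xi) + bf 1%:M (toC xi) ('i%C *: toC x + b) + c)).

(** The transform is a Gaussian centred at [space_center] that oscillates with
    frequency [freq_center]; the frequency depends on M only through Re M. *)
Definition freq_center : 'rV[R]_n := 2^-1 *: (mRe b *m Pi).
Definition space_center : 'rV[R]_n := 2 *: (freq_center *m mIm M) - mIm b.

Lemma center_spec :
  'i%C *: toC space_center + b = 2 *: (toC freq_center *m M).
Proof.
have e1 : 2 *: toC (freq_center *m P) = toC (mRe b).
  have <- : 2 *: (freq_center *m P) = mRe b.
    rewrite /freq_center -scalemxAl scalerA mulfV ?pnatr_eq0//.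
    by rewrite scale1r mulmxKV.
  by rewrite map_mxZ rmorph_nat.
have e2 : 2 *: toC (freq_center *m mIm M) = toC space_center + toC (mIm b).
  by rewrite -map_mxD /space_center subrK map_mxZ rmorph_nat.
rewrite [b in LHS]mx_ReIm -e1 [M in RHS]mx_ReIm mulmxDr scalerDr -/P.
rewrite -scalemxAr -!map_mxM scalerA (mulrC 2) -scalerA e2 scalerDr.
by rewrite addrCA.
Qed.

Let S := mRe Rm.
Let N : 'M[C]_n := toC ((q / 4) *: S).

Let qf_center (w : 'rV[R]_n) :
  qf Rm ('i%C *: toC (space_center + w) + b) =
  - qf Rm (toC w) + 4 * 'i%C * bf 1%:M (toC w) (toC freq_center) +
  4 * qf M (toC freq_center).
Proof.
rewrite map_mxD scalerDr addrAC center_spec qf_bf !(bfDl, bfDr, bfZl, bfZr).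
rewrite (bfC (toC freq_center *m M) (toC w) RT').
have E z : bf Rm z (toC freq_center *m M) = bf 1%:M z (toC freq_center).
  by rewrite bf_mulmx MT RM.
rewrite !E bf_mulmxl mulmx1 !qf_bf.
have i2 : 'i%C * ('i%C * bf Rm (toC w) (toC w)) = - bf Rm (toC w) (toC w).
  by rewrite mulrA -expr2 sqr_i mulN1r.
rewrite i2; move: (bf _ _ _) (bf _ _ _) (bf _ _ _) => x y z; ring.
Qed.

Lemma gauss_ftE : exists2 Z : C, Z != 0 & forall w,
  gauss_ft (space_center + w) =
  Z * cexp (- (4^-1 * qf Rm (toC w)) + 'i%C * bf 1%:M (toC w) (toC freq_center)).
Proof.
have [Z Z0 H] := cintegral_gauss_dot.
exists (Z * cexp (c + qf M (toC freq_center))).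
  by rewrite mulf_neq0// cexp_neq0.
move=> w; rewrite /gauss_ft H -mulrA -cexpD mulrC; congr (_ * cexp _).
rewrite qf_center; move: (bf _ _ _) (qf _ _) (qf _ _) => x1 x2 x3.
by field.
Qed.

Lemma gauss_ft_neq0 x : gauss_ft x != 0.
Proof.
have [Z Z0 HZ] := gauss_ftE; rewrite -[x](subrKC space_center) HZ.
by rewrite mulf_neq0// cexp_neq0.
Qed.

(** The quotient u(x + v) / u(x) is the exponential of an affine function of x, so
    the integrand is |u|^q times such an exponential: a Gaussian with quadratic
    part (q/4) Re R and a complex centre.  Its integral does not feel the centre,
    and [inv_mRe_inv] evaluates the constant left by completing the square. *)
Lemma gauss_ft_correlation : exists J : R, forall v : 'rV[R]_n,
  cintegrable (lebesgue_rV R n) (fun x => (normc (gauss_ft x) `^ (q - 2))%:c *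
    (conjc (gauss_ft x) * gauss_ft (x + v))) /\
  cintegral (lebesgue_rV R n) (fun x => (normc (gauss_ft x) `^ (q - 2))%:c *
    (conjc (gauss_ft x) * gauss_ft (x + v))) =
  J%:c * cexp ('i%C * bf 1%:M (toC v) (toC freq_center)
    - (4^-1 * ((1 - 2 / q)%:c * qf Rm (toC v) + (q^-1)%:c * qf (toC Pi) (toC v)))).
Proof.
have [Z Z0 HZ] := gauss_ftE.
have ST : S^T = S := mRe_inv_sym.
have SU : S \in unitmx by apply: posdef_unit; exact: mRe_inv_posdef.
have q40 : 0 < q / 4 by rewrite divr_gt0.
have NT : N^T = N by rewrite /N map_trmx linearZ /= ST.
have mReN : mRe N = (q / 4) *: S by apply/matrixP => i j; rewrite !mxE.
have posN : posdef (mRe N).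
  move=> x x0; rewrite mReN qf_bf bfMZ -qf_bf mulr_gt0//.
  exact: mRe_inv_posdef.
have NE z w : bf N z w = (q / 4)%:c * bf (toC S) z w.
  by rewrite /N map_mxZ bfMZ.
have [ZN _ HZN] := cintegral_gauss NT posN.
have ZNE : ZN = (Re ZN)%:c.
  apply: complex_eq => //=; rewrite -(HZN 0) /=.
  rewrite (_ : (fun x => _) = cst 0) ?Rintegral_cst ?mul0r//.
  by apply/funext => x; rewrite subr0 ImN qf_bf bf_toC /= oppr0 sin0 mulr0.
exists (normc Z `^ q * Re ZN) => v.
pose h := (- (4^-1 * (4 / q)%:c)) *: (toC v *m Rm *m toC (invmx S)).
have hN w : bf N w h = - 4^-1 * bf Rm w (toC v).
  have e1 : bf (toC S) w (toC v *m Rm *m toC (invmx S)) = bf Rm w (toC v).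
    rewrite bf_mulmx map_trmx trmx_inv ST -map_mxM mulmxV// map_mx1.
    by rewrite bf_mulmx mul1mx RT'.
  rewrite /h bfZr NE e1 mulrA; congr (_ * _).
  rewrite mulNr -mulrA -rmorphM (_ : 4 / q * (q / 4) = 1) ?mulr1//.
  by field; rewrite gt_eqF.
have qfNh : qf N h = (4^-1 * q^-1%:c) * (2 * qf Rm (toC v) - qf (toC Pi) (toC v)).
  rewrite qf_bf hN /h bfZl bf_mulmxl bf_mulmxl mulmxA bf_inv_mRe_inv.
  rewrite -!qf_bf rmorphM fmorphV.
  move: (qf _ _) (qf _ _) => x1 x2; rewrite rmorph_nat; field.
  by rewrite -normc_eq0 normcC normr_eq0 gt_eqF.
have uE x : gauss_ft x = Z * cexp (- (4^-1 * qf Rm (toC (x - space_center))) +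
    'i%C * bf 1%:M (toC (x - space_center)) (toC freq_center)).
  by rewrite -HZ subrKC.
have nE x : normc (gauss_ft x) `^ q =
    normc Z `^ q * expR (- (q / 4 * qf S (x - space_center))).
  rewrite uE Normc.normcM normc_cexp powRM ?normc_ge0 ?expR_ge0// -expRM.
  congr (_ * expR _).
  rewrite -(map_mx1 (real_complex R)) bf_toC qf_bf bf_toCE -/S qf_bf natCE.
  move: (bf _ _ _) (bf _ _ _) (bf _ _ _) => x1 x2 x3.
  by rewrite -fmorphV !ReImE /=; field.
have u0 := gauss_ft_neq0.
have toCB (x y : 'rV[R]_n) : toC x - toC y = toC (x - y).
  by apply/matrixP => i j; rewrite !mxE rmorphB.
have fE x : (normc (gauss_ft x) `^ (q - 2))%:c *
    (conjc (gauss_ft x) * gauss_ft (x + v)) =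
    (normc Z `^ q)%:c * cexp ('i%C * bf 1%:M (toC v) (toC freq_center)
    - (4^-1 * ((1 - 2 / q)%:c * qf Rm (toC v) + (q^-1)%:c * qf (toC Pi) (toC v)))) *
    cexp (- qf N (toC x - (toC space_center + h))).
  transitivity ((normc (gauss_ft x) `^ q)%:c *
      (gauss_ft (x + v) / gauss_ft x)).
    have nu : 0 < normc (gauss_ft x) by rewrite normc_gt0.
    rewrite powRB; last by rewrite normc_eq0 u0 implybT.
    rewrite (powR_mulrn 2) ?normc_ge0//.
    have -> : conjc (gauss_ft x) = (normc (gauss_ft x) ^+ 2)%:c / gauss_ft x.
      by rewrite -mulcJ mulrAC divff// mul1r.
    have nn0 : (normc (gauss_ft x) ^+ 2)%:c != 0.
      by rewrite -normc_eq0 normcC normr_eq0 expf_neq0// gt_eqF.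
    rewrite fmorph_div /=; move: (_ ^+ 2)%:c nn0 (gauss_ft (x + v)) => a a0 y.
    move: (gauss_ft x) (u0 x) (_ `^ _)%:c => u u00 y2.
    by field; rewrite u00 a0.
  set w := x - space_center.
  have -> : (normc (gauss_ft x) `^ q)%:c =
      (normc Z `^ q)%:c * cexp ((- (q / 4 * qf S w))%:c).
    by rewrite cexpC -rmorphM nE.
  rewrite -!(mulrA (normc Z `^ q)%:c); congr (_ * _).
  have -> : gauss_ft (x + v) / gauss_ft x = cexp (- (4^-1 * (2 * bf Rm (toC w) (toC v)
      + qf Rm (toC v))) + 'i%C * bf 1%:M (toC v) (toC freq_center)).
    rewrite !uE -/w addrAC -/w -mulf_div divff// mul1r -cexpN -cexpD.
    congr cexp; rewrite map_mxD !qf_bf !(bfDl, bfDr) (bfC (toC v) (toC w) RT').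
    by move: (bf _ _ _) (bf _ _ _) (bf _ _ _) => x1 x2 x3; ring.
  rewrite -!cexpD; congr cexp.
  have -> : toC x - (toC space_center + h) = toC w - h.
    rewrite /w opprD addrA; congr (_ - _).
    exact: toCB.
  have e2 : (- (q / 4 * qf S w))%:c = - qf N (toC w).
    by rewrite !qf_bf NE bf_toC -rmorphM rmorphN.
  rewrite e2 [qf N (_ - _)]qf_bf !(bfDl, bfDr, bfNl, bfNr) (bfC h _ NT) hN.
  have e3 : (1 - 2 / q)%:c = 1 - 2 * q^-1%:c.
    by rewrite rmorphB rmorphM rmorph1 rmorph_nat.
  rewrite -!qf_bf qfNh e3; move: q^-1%:c => q1.
  move: (qf _ _) (qf _ _) (qf _ _) (bf _ _ _) (bf _ _ _) => x1 x2 x3 x4 x5.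
  by field.
rewrite (funext fE); split.
  by apply: cintegrableZ; apply: cintegrable_gauss.
rewrite cintegralZ; last exact: cintegrable_gauss.
by rewrite HZN ZNE mulrAC -rmorphM.
Qed.
End slice.
End complex_symmetric.

(** * First variation of a quotient of norms *)

Section elementary_inequalities.
Context (R : realType).
Local Notation C := R[i].
Implicit Types (x y r q p e : R) (a b h : C).

Lemma bernoulli_powR r y : 1 <= r -> 0 <= 1 + y -> 1 + r * y <= (1 + y) `^ r.
Proof.
move=> r1; rewrite le_eqVlt => /predU1P[y0|y0].
  by rewrite -y0 powR0 ?gt_eqF ?(lt_le_trans ltr01)//; nra.
set L := ln (1 + y); have yE : 1 + y = expR L by rewrite lnK.
have -> : y = expR L - 1 by rewrite -yE addrC addKr.
rewrite (addrC 1 (_ - 1)) subrK -expRM (_ : L * r = L + (r - 1) * L); last by ring.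
rewrite expRD.
have h1 : expR L * (1 + (r - 1) * L) <= expR L * expR ((r - 1) * L).
  by rewrite ler_wpM2l ?expR_ge0// expR_ge1Dx.
apply: le_trans h1.
have h2 : 0 <= expR L * (expR (- L) - (1 - L)).
  by rewrite mulr_ge0 ?expR_ge0// subr_ge0 expR_ge1Dx.
have h3 : expR L * expR (- L) = 1 by rewrite -expRD subrr expR0.
rewrite mulrBr h3 in h2.
have r0 : 0 <= r - 1 by rewrite subr_ge0.
by have := mulr_ge0 r0 h2; move: (expR L) => E; nra.
Qed.

Lemma expR_le_quadratic x : x <= 2^-1 -> expR x <= 1 + x + 2 * x ^+ 2.
Proof.
move=> x2; have h : 1 - x <= expR (- x) by exact: expR_ge1Dx.
have h0 : 0 < 1 - x by lra.
rewrite expRN in h.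
have {}h : expR x * (1 - x) <= 1.
  by rewrite mulrC -ler_pdivlMr ?expR_gt0// div1r.
rewrite -(ler_pM2r h0) (le_trans h)//.
have -> : (1 + x + 2 * x ^+ 2) * (1 - x) = 1 + x ^+ 2 * (1 - 2 * x) by ring.
by rewrite lerDl mulr_ge0 ?sqr_ge0//; lra.
Qed.

Lemma powR_sub2 a q : a != 0 ->
  normc a `^ q = normc a `^ (q - 2) * normc a ^+ 2.
Proof.
move=> a0; rewrite powRB; last by rewrite normc_eq0 a0 implybT.
by rewrite (powR_mulrn 2) ?normc_ge0// divfK// expf_neq0// normc_eq0.
Qed.

(** Bernoulli's inequality, after |a + e b| is bounded below by the real part of
    conj(a) (a + e b) / |a|. *)
Lemma powR_tangent q e a b : 1 <= q -> a != 0 ->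
  normc a `^ q + e * (q * (normc a `^ (q - 2) * Re (conjc a * b)))
  <= normc (a + e%:c * b) `^ q.
Proof.
move=> q1 a0; have na : 0 < normc a by rewrite normc_gt0.
have q0 : 0 <= q by rewrite (le_trans _ q1).
pose y := e * Re (conjc a * b) / normc a ^+ 2.
have -> : normc a `^ q + e * (q * (normc a `^ (q - 2) * Re (conjc a * b))) =
    normc a `^ q * (1 + q * y).
  rewrite (powR_sub2 q a0) /y; field; by rewrite gt_eqF.
have [y1|y1] := leP 0 (1 + y); last first.
  rewrite (@le_trans _ _ 0) ?powR_ge0//.
  by rewrite mulr_ge0_le0 ?powR_ge0//; nra.
apply: (@le_trans _ _ (normc a `^ q * (1 + y) `^ q)).
  by rewrite ler_wpM2l ?powR_ge0// bernoulli_powR.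
rewrite -powRM ?normc_ge0//; apply: ge0_ler_powR => //;
  rewrite ?nnegrE ?mulr_ge0 ?normc_ge0//.
rewrite -(ler_pM2l na) -[leRHS](congr1 (fun z => z * _) (normcJ a)) -Normc.normcM.
apply: le_trans (le_trans (ler_norm _) (ler_Re _)).
have -> : Re (conjc a * (a + e%:c * b)) = normc a ^+ 2 + e * Re (conjc a * b).
  rewrite mulrDr ReD (mulrC _ a) mulcJ /= mulrCA; congr (_ + _).
  by rewrite ReM /= mul0r subr0.
by rewrite /y le_eqVlt; apply/orP; left; apply/eqP; field; rewrite gt_eqF.
Qed.

Lemma normc_add1_sqr e h :
  normc (1 + e%:c * h) ^+ 2 = 1 + (2 * e * Re h + e ^+ 2 * normc h ^+ 2).
Proof. by rewrite !sqr_normcE !ReImE /=; ring. Qed.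

(** An upper bound suffices for the denominator, and it holds for every p > 0:
    (1 + y)^(p/2) <= exp(p y / 2), and the exponential is at most quadratic for
    arguments bounded above by 1/2. *)
Lemma powR_expansion_le p e h : 0 < p -> normc h <= 1 -> `|e| <= 1 ->
  `|e| <= (3 * p)^-1 ->
  normc (1 + e%:c * h) `^ p <=
  1 + e * (p * Re h) + (p / 2 + 5 * p ^+ 2) * e ^+ 2.
Proof.
move=> p0 h1 e1 ep.
have n0 : 0 <= normc h := normc_ge0 h.
set y := 2 * e * Re h + e ^+ 2 * normc h ^+ 2.
have e2 : e ^+ 2 = `|e| ^+ 2 by rewrite real_normK ?num_real.
have hR : `|Re h| <= 1 by rewrite (le_trans (ler_Re h)).
have yE : `|y| <= 3 * `|e|.
  rewrite /y (le_trans (ler_normD _ _))// (normrM (2 * e)) (normrM 2) (normrM (e ^+ 2)).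
  rewrite (ger0_norm (ler0n _ 2)) (ger0_norm (sqr_ge0 e)) (ger0_norm (sqr_ge0 (normc h))) e2.
  have : `|e| * `|Re h| <= `|e| by rewrite ler_piMr.
  have : `|e| ^+ 2 * normc h ^+ 2 <= `|e|.
    apply: (@le_trans _ _ (`|e| ^+ 2)); last by rewrite expr2 ler_piMr.
    by rewrite ler_piMr ?sqr_ge0// exprn_ile1.
  by rewrite -mulrA; move: (`|e| * `|_|) (_ * normc h ^+ 2) => u v; lra.
have p2 : p / 2 * `|y| <= 2^-1.
  rewrite (@le_trans _ _ (p / 2 * (3 * (3 * p)^-1)))//.
    rewrite ler_wpM2l ?divr_ge0// ?(ltW p0)//.
    by rewrite (le_trans yE)// ler_wpM2l.
  by rewrite le_eqVlt; apply/orP; left; apply/eqP; field; rewrite gt_eqF.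
have -> : normc (1 + e%:c * h) `^ p = (1 + y) `^ (p / 2).
  rewrite -normc_add1_sqr -(powR_mulrn 2) ?normc_ge0// -powRrM.
  by congr (_ `^ _); field.
have y0 : 0 <= 1 + y by rewrite -normc_add1_sqr sqr_ge0.
apply: (@le_trans _ _ (expR (p / 2 * y))).
  rewrite (mulrC (p / 2) y) expRM ge0_ler_powR ?nnegrE ?expR_ge0 ?expR_ge1Dx//.
  by rewrite divr_ge0// ltW.
apply: le_trans (expR_le_quadratic _) _.
  by rewrite (le_trans _ p2)// ler_wpM2l ?ler_norm// divr_ge0// ltW.
have y2 : y ^+ 2 <= 9 * e ^+ 2.
  rewrite e2 -(real_normK (num_real y)).
  by have := normr_ge0 y; have := normr_ge0 e; nra.
have h2 : e ^+ 2 * normc h ^+ 2 <= e ^+ 2.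
  by rewrite ler_piMr ?sqr_ge0// exprn_ile1.
have -> : 1 + p / 2 * y + 2 * (p / 2 * y) ^+ 2 = 1 + e * (p * Re h)
    + (p / 2 * (e ^+ 2 * normc h ^+ 2) + p ^+ 2 / 2 * y ^+ 2).
  by rewrite {1}/y; field.
have p20 : 0 <= p ^+ 2 by rewrite sqr_ge0.
rewrite lerD2l mulrDl lerD//; first by rewrite ler_wpM2l// divr_ge0// ltW.
have : p ^+ 2 / 2 * y ^+ 2 <= p ^+ 2 / 2 * (9 * e ^+ 2).
  by rewrite ler_wpM2l// divr_ge0.
have : 0 <= p ^+ 2 * e ^+ 2 by rewrite mulr_ge0// sqr_ge0.
by move: (p ^+ 2) (e ^+ 2) (y ^+ 2) => u v w; lra.
Qed.

Lemma powR_add_le q x y : 0 <= q -> 0 <= x -> 0 <= y ->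
  (x + y) `^ q <= 2 `^ q * (x `^ q + y `^ q).
Proof.
move=> q0 x0 y0; wlog xy : x y x0 y0 / x <= y => [H|].
  have [|/ltW yx] := leP x y; first exact: H.
  by rewrite addrC (addrC (x `^ q)); exact: H.
apply: (@le_trans _ _ ((2 * y) `^ q)).
  rewrite ge0_ler_powR ?nnegrE ?addr_ge0 ?mulr_ge0//.
  by rewrite mulr_natl mulr2n lerD2r.
by rewrite powRM// ler_wpM2l ?powR_ge0// lerDr powR_ge0.
Qed.

(** Compare y with dlt * x. *)
Lemma powR_young q dlt x y : 1 <= q -> 0 < dlt -> 0 <= x -> 0 <= y ->
  x `^ (q - 1) * y <= dlt * x `^ q + (dlt `^ (q - 1))^-1 * y `^ q.
Proof.
move=> q1 d0 x0 y0.
have q10 : 0 <= q - 1 by rewrite subr_ge0.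
have qne z : 0 <= z -> z `^ q = z `^ (q - 1) * z.
  rewrite le_eqVlt => /predU1P[<-|z0].
    by rewrite powR0 ?mulr0// gt_eqF// (lt_le_trans ltr01).
  rewrite -[in X in _ * X](powRr1 (ltW z0)) -powRD ?subrK//.
  by rewrite (gt_eqF z0) implybT.
have [yx|xy] := leP y (dlt * x).
  rewrite ler_wpDr ?mulr_ge0 ?invr_ge0 ?powR_ge0//.
  by rewrite qne// mulrCA ler_wpM2l ?powR_ge0.
rewrite ler_wpDl ?mulr_ge0 ?powR_ge0 ?(ltW d0)//.
rewrite (qne y)// mulrA ler_wpM2r// -ler_pdivrMl ?invr_gt0 ?powR_gt0// invrK.
rewrite -powRM ?(ltW d0)// ge0_ler_powR ?nnegrE ?mulr_ge0 ?(ltW d0)//.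
exact: ltW.
Qed.

Lemma powR_sub1 a q : a != 0 ->
  normc a `^ (q - 2) * normc a = normc a `^ (q - 1).
Proof.
move=> a0; have na : normc a != 0 by rewrite normc_eq0.
have -> : q - 1 = (q - 2) + 1 by ring.
by rewrite (@powRD _ _ (q - 2) 1) ?na ?implybT// powRr1// normc_ge0.
Qed.

End elementary_inequalities.

Section touching.
Context (R : realType).

Lemma is_derive_min0 (D : R -> R) (dD e0 : R) : 0 < e0 ->
  is_derive (0 : R) 1 D dD -> D 0 = 0 ->
  (forall e, `|e| < e0 -> 0 <= D e) -> dD = 0.
Proof.
move=> e00 [Dd DE] D0 Dge0.
have : h^-1 *: (D (h *: 1 + 0) - D 0) @[h --> 0^'] --> dD.
  by rewrite -DE; exact: Dd.
rewrite D0 => /cvgrPdist_lt H.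
apply/eqP; rewrite -normr_le0 leNgt; apply/negP => d0.
have := H _ d0; rewrite /dnbhs /within/= => -[r r0 Hr].
pose s := Order.min r e0 / 2.
have s0 : 0 < s by rewrite divr_gt0// lt_min r0.
have sr : s < r.
  by rewrite (@lt_le_trans _ _ (Order.min r e0))// ?ge_min ?lexx// ltr_pdivrMr// ltr_pMr ?ltr1n// lt_min r0.
have se : s < e0.
  by rewrite (@lt_le_trans _ _ (Order.min r e0))// ?ge_min ?lexx ?orbT// ltr_pdivrMr// ltr_pMr ?ltr1n// lt_min r0.
have Ds : 0 <= D s by apply: Dge0; rewrite gtr0_norm.
have DNs : 0 <= D (- s) by apply: Dge0; rewrite normrN gtr0_norm.
have h1 : `|dD - s^-1 * D s| < `|dD|.
  have := Hr s; rewrite /ball_ /= sub0r normrN gtr0_norm// => /(_ sr).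
  by rewrite gt_eqF// => /(_ isT); rewrite subr0 addr0 /GRing.scale /= mulr1.
have h2 : `|dD - (- s)^-1 * D (- s)| < `|dD|.
  have := Hr (- s); rewrite /ball_ /= sub0r opprK gtr0_norm// => /(_ sr).
  by rewrite oppr_eq0 gt_eqF// => /(_ isT); rewrite subr0 addr0 /GRing.scale /= mulr1.
have i0 : 0 <= s^-1 * D s by rewrite mulr_ge0// invr_ge0 ltW.
have i1 : (- s)^-1 * D (- s) <= 0.
  by rewrite invrN mulNr oppr_le0 mulr_ge0// invr_ge0 ltW.
move: h1 h2; move: (s^-1 * D s) ((- s)^-1 * D (- s)) i0 i1 d0 => u v u0 v0.
rewrite normr_gt0 => d0.
have [dp|dn|d00] := ltgtP 0 dD.
- rewrite (gtr0_norm dp) => _; rewrite ger0_norm; lra.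
- rewrite (ltr0_norm dn) => + _; rewrite ler0_norm; lra.
- by rewrite -d00 eqxx in d0.
Qed.

End touching.

Section power_integrals.
Context d (T : measurableType d) (R : realType).
Variable mu : {measure set T -> \bar R}.
Local Notation C := R[i].
Implicit Types (f g : T -> C) (p q : R).

Definition powint p f :=
  cmeasurable f /\ mu.-integrable setT (fun x => (normc (f x) `^ p)%:E).

Definition Ipow p f : R := \int[mu]_x (normc (f x) `^ p).

Lemma measurable_powint p f : cmeasurable f ->
  measurable_fun setT (fun x => normc (f x) `^ p).
Proof.
move=> mf; apply: (@measurableT_comp _ _ _ _ _ _ (fun y : R => y `^ p)).
  exact: measurable_powR.
exact: measurable_normc.
Qed.

Lemma Ipow_ge0 p f : 0 <= Ipow p f.
Proof. by apply: Rintegral_ge0 => x _; exact: powR_ge0. Qed.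

Lemma IpowE p f : powint p f ->
  (\int[mu]_x (normc (f x) `^ p)%:E)%E = (Ipow p f)%:E.
Proof. by move=> [_ ?]; rewrite /Ipow /Rintegral fineK// integrable_fin_num. Qed.

Lemma cLnorm_int p f : cLnorm mu p f =
  ((\int[mu]_x (normc (f x) `^ p)%:E) `^ p^-1)%E.
Proof.
rewrite /cLnorm unlock; apply: (congr1 (fun z => z `^ p^-1)%E).
apply: eq_integral => x _.
by rewrite gee0_abs ?lee_fin ?normc_ge0// poweR_EFin.
Qed.

Lemma cLnormE p f : powint p f -> cLnorm mu p f = (Ipow p f `^ p^-1)%:E.
Proof. by move=> ?; rewrite cLnorm_int IpowE// poweR_EFin. Qed.

Lemma powintP p f : 0 < p -> cmeasurable f ->
  (cLnorm mu p f < +oo)%E <-> powint p f.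
Proof.
move=> p0 mf; split=> [|/cLnormE ->]; last exact: ltry.
rewrite cLnorm_int => h; split => //; apply/integrableP; split.
  exact/measurable_EFinP/measurable_powint.
under eq_integral do rewrite gee0_abs ?lee_fin ?powR_ge0//.
rewrite ltey; apply: contraTneq h => ->.
by rewrite poweRyr ?invr_neq0 ?gt_eqF// ltxx.
Qed.

Lemma cLpP p f : 0 < p -> cLp mu p f <-> powint p f.
Proof.
move=> p0; split=> [[mf /(powintP p0 mf)//]|pf].
by split; [case: pf|apply/powintP => //; case: pf].
Qed.

Lemma powintD p f g : 0 <= p -> powint p f -> powint p g ->
  powint p (fun x => f x + g x).
Proof.
move=> p0 [mf If] [mg Ig]; have mfg := cmeasurableD mf mg; split => //.
have iD := integrableZl measurableT (2 `^ p) (integrableD measurableT If Ig).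
apply: le_integrable iD => //.
  exact/measurable_EFinP/measurable_powint.
move=> x _ /=; rewrite lee_fin !ger0_norm ?powR_ge0//; last first.
  by rewrite mulr_ge0 ?addr_ge0 ?powR_ge0.
apply: le_trans (powR_add_le _ _ _) => //; rewrite ?normc_ge0//.
by rewrite ge0_ler_powR ?nnegrE ?addr_ge0 ?normc_ge0// normcD.
Qed.

Lemma powint_le p f g : 0 <= p -> cmeasurable f ->
  (forall x, normc (f x) <= normc (g x)) -> powint p g -> powint p f.
Proof.
move=> p0 mf fg [mg ig]; split => //; apply: le_integrable ig => //.
  exact/measurable_EFinP/measurable_powint.
move=> x _; rewrite lee_fin !ger0_norm ?powR_ge0//.
by rewrite ge0_ler_powR ?nnegrE ?normc_ge0.
Qed.

Lemma powintZ p (c : C) f : 0 <= p -> powint p f ->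
  powint p (fun x => c * f x).
Proof.
move=> p0 [mf If]; split; first exact/cmeasurableM/mf/cmeasurable_cst.
under eq_fun do rewrite Normc.normcM powRM ?normc_ge0// EFinM.
exact: integrableZl.
Qed.

(** Up to the factor q, the derivative of the q-th power integral at u in the
    direction w. *)
Definition pairing q (u w : T -> C) : R :=
  \int[mu]_x (normc (u x) `^ (q - 2) * Re (conjc (u x) * w x)).

Lemma measurable_pairing q (u w : T -> C) : cmeasurable u -> cmeasurable w ->
  measurable_fun setT (fun x => normc (u x) `^ (q - 2) * Re (conjc (u x) * w x)).
Proof.
move=> mu_ mw; apply: measurable_funM; first exact: measurable_powint.
by have [] := cmeasurableM (cmeasurableJ mu_) mw.
Qed.

Lemma pairing_le q dlt (u w : T -> C) x : 1 <= q -> 0 < dlt -> u x != 0 ->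
  `|normc (u x) `^ (q - 2) * Re (conjc (u x) * w x)| <=
  dlt * normc (u x) `^ q + (dlt `^ (q - 1))^-1 * normc (w x) `^ q.
Proof.
move=> q1 d0 u0; rewrite normrM ger0_norm ?powR_ge0//.
apply: le_trans (powR_young q1 d0 (normc_ge0 (u x)) (normc_ge0 (w x))).
rewrite -(powR_sub1 q u0) -mulrA ler_wpM2l ?powR_ge0//.
by rewrite (le_trans (ler_Re _))// Normc.normcM normcJ.
Qed.

Lemma integrable_pairing q (u w : T -> C) : 1 <= q -> (forall x, u x != 0) ->
  powint q u -> powint q w -> mu.-integrable setT
    (fun x => (normc (u x) `^ (q - 2) * Re (conjc (u x) * w x))%:E).
Proof.
move=> q1 u0 [mu_ iu] [mw iw].
have i1 := integrableZl measurableT 1 iu.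
have i2 := integrableZl measurableT (1 `^ (q - 1))^-1 iw.
apply: le_integrable (integrableD measurableT i1 i2) => //.
  exact/measurable_EFinP/measurable_pairing.
move=> x _ /=; rewrite lee_fin.
apply: le_trans (pairing_le w q1 ltr01 (u0 x)) (ler_norm _).
Qed.

(** The free parameter dlt makes the pairing small together with the q-th power
    integral of w. *)
Lemma pairing_small q dlt (u w : T -> C) : 1 <= q -> 0 < dlt ->
  (forall x, u x != 0) -> powint q u -> powint q w ->
  `|pairing q u w| <= dlt * Ipow q u + (dlt `^ (q - 1))^-1 * Ipow q w.
Proof.
move=> q1 d0 u0 qu qw; have ip := integrable_pairing q1 u0 qu qw.
have [_ iu] := qu; have [_ iw] := qw.
rewrite (le_trans (le_normr_Rintegral _ ip))//.
rewrite -RintegralZl// -RintegralZl// -RintegralD//.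
- apply: le_Rintegral => //.
  + exact: integrable_norm ip.
  + by apply: (integrableD measurableT (integrableZl measurableT dlt iu)
      (integrableZl measurableT _ iw)).
  + by move=> x _; exact: pairing_le.
- exact: (integrableZl measurableT dlt iu).
- exact: (integrableZl measurableT _ iw).
Qed.

Lemma Ipow_tangent q e (u w : T -> C) : 1 <= q -> (forall x, u x != 0) ->
  powint q u -> powint q w ->
  Ipow q u + e * (q * pairing q u w) <= Ipow q (fun x => u x + e%:c * w x).
Proof.
move=> q1 u0 qu qw; have ip := integrable_pairing q1 u0 qu qw.
have q0 : 0 <= q by rewrite (le_trans _ q1).
have [_ iu] := qu.
rewrite mulrA -RintegralZl//.
have ip' : mu.-integrable setT (fun x => (e * q *
    (normc (u x) `^ (q - 2) * Re (conjc (u x) * w x)))%:E).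
  exact: (integrableZl measurableT (e * q) ip).
rewrite -RintegralD//; apply: le_Rintegral => //.
- exact: (integrableD measurableT iu ip').
- by have [] := powintD q0 qu (powintZ e%:c q0 qw).
- by move=> x _; rewrite -mulrA; exact: powR_tangent.
Qed.

Lemma Ipow_expansion p e (G h : T -> C) : 0 < p -> powint p G ->
  cmeasurable h -> (forall x, normc (h x) <= 1) ->
  `|e| <= 1 -> `|e| <= (3 * p)^-1 ->
  Ipow p (fun x => G x + e%:c * (G x * h x)) <=
  Ipow p G + e * (p * \int[mu]_x (normc (G x) `^ p * Re (h x)))
    + (p / 2 + 5 * p ^+ 2) * Ipow p G * e ^+ 2.
Proof.
move=> p0 pG mh h1 e1 ep; have [mG iG] := pG.
set K := p / 2 + 5 * p ^+ 2.
have iGh : mu.-integrable setT (fun x => (normc (G x) `^ p * Re (h x))%:E).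
  apply: le_integrable iG => //.
    apply/measurable_EFinP/measurable_funM; first exact: measurable_powint.
    by case: mh.
  move=> x _; rewrite lee_fin normrM ger0_norm ?powR_ge0// ler_piMr ?powR_ge0//.
  by rewrite (le_trans (ler_Re _)).
have i1 := integrableZl measurableT (e * p) iGh.
have i2 := integrableZl measurableT (K * e ^+ 2) iG.
have -> : Ipow p G + e * (p * \int[mu]_x (normc (G x) `^ p * Re (h x)))
    + K * Ipow p G * e ^+ 2 =
  \int[mu]_x (normc (G x) `^ p + e * p * (normc (G x) `^ p * Re (h x))
    + K * e ^+ 2 * normc (G x) `^ p).
  rewrite RintegralD//; last exact: (integrableD measurableT iG i1).
  by rewrite RintegralD// !RintegralZl// /Ipow; ring.
apply: le_Rintegral => //.
- have := powintD (ltW p0) pG (powintZ e%:c (ltW p0) (powint_le (ltW p0)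
    (cmeasurableM mG mh) _ pG)).
  move=> /(_ _)[]// x; rewrite Normc.normcM ler_piMr ?normc_ge0//.
- exact: (integrableD measurableT (integrableD measurableT iG i1) i2).
- move=> x _.
  have -> : G x + e%:c * (G x * h x) = G x * (1 + e%:c * h x) by ring.
  rewrite Normc.normcM powRM ?normc_ge0//.
  apply: le_trans (ler_wpM2l (powR_ge0 _ _) (powR_expansion_le p0 (h1 x) e1 ep)) _.
  by rewrite -/K le_eqVlt; apply/orP; left; apply/eqP; ring.
Qed.

End power_integrals.

Lemma affine_gt0 (R : realType) (c m : R) : 0 < m ->
  exists2 e1 : R, 0 < e1 & forall e, `|e| < e1 -> 0 < m + e * c.
Proof.
move=> m0; have c0 : 0 < `|c| + 1 by rewrite ltr_wpDl.
exists (m / (`|c| + 1)); first by rewrite divr_gt0.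
move=> e; rewrite ltr_pdivlMr// => ec.
have : `|e * c| < m.
  by rewrite normrM (le_lt_trans _ ec)// ler_wpM2l// lerDl.
by rewrite ltr_norml => /andP[h _]; rewrite addrC -ltrBlDr sub0r.
Qed.

Section variation.
Context d1 d2 (X : measurableType d1) (Y : measurableType d2) (R : realType).
Variables (mu : {measure set X -> \bar R}) (nu : {measure set Y -> \bar R}).
Local Notation C := R[i].

(** If the quotient of the two norms is stationary, then its first variation
    vanishes.  The numerator lies above its tangent line, the denominator below
    a parabola, so the quotient is bounded below by a differentiable function
    that agrees with it at the origin; the two derivatives there coincide. *)
Lemma stationary_quotient (p q : R) (u w : X -> C) (G h : Y -> C) :
  0 < p -> 1 <= q -> (forall x, u x != 0) -> powint mu q u -> powint mu q w ->
  powint nu p G -> cmeasurable h -> (forall y, normc (h y) <= 1) ->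
  0 < Ipow mu q u -> 0 < Ipow nu p G ->
  is_derive (0 : R) 1 (fun e : R =>
    fine (cLnorm mu q (fun x => u x + e%:c * w x)) /
    fine (cLnorm nu p (fun y => G y + e%:c * (G y * h y)))) 0 ->
  pairing mu q u w / Ipow mu q u =
  (\int[nu]_y (normc (G y) `^ p * Re (h y))) / Ipow nu p G.
Proof.
move=> p0 q1 u0 qu qw pG mh h1 m0p n0p dPsi.
set m0 := Ipow mu q u in m0p *; set n0 := Ipow nu p G in n0p *.
set L1 := pairing mu q u w; set L2 := \int[nu]_y _.
have q0 : 0 < q by rewrite (lt_le_trans ltr01).
set K := (p / 2 + 5 * p ^+ 2) * n0.
(* a bounds the numerator integral from below, b the denominator from above *)
pose a (e : R) := m0 + e * (q * L1).
pose b (e : R) := n0 + e * (p * L2) + K * (e * e).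
pose g (e : R) := q^-1 * ln (a e) - p^-1 * ln (b e).
have da : is_derive (0 : R) 1 a (q * L1).
  apply: (@is_derive_eq _ _ _ _ _ _ _ _
    (is_deriveD (is_derive_cst m0 (0 : R) 1)
     (is_deriveM (is_derive_id (0 : R) 1) (is_derive_cst (q * L1) (0 : R) 1)))).
  by rewrite /GRing.scale /= mul0r mulr1 !add0r.
have db : is_derive (0 : R) 1 b (p * L2).
  apply: (@is_derive_eq _ _ _ _ _ _ _ _
    (is_deriveD (is_deriveD (is_derive_cst n0 (0 : R) 1)
     (is_deriveM (is_derive_id (0 : R) 1) (is_derive_cst (p * L2) (0 : R) 1)))
     (is_deriveM (is_derive_cst K (0 : R) 1) (is_deriveM (is_derive_id (0 : R) 1)
       (is_derive_id (0 : R) 1))))).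
  by rewrite /GRing.scale /=; ring.
have a0 : a 0 = m0 by rewrite /a mul0r addr0.
have b0 : b 0 = n0 by rewrite /b !mul0r mulr0 !addr0.
have dlna : is_derive (0 : R) 1 (fun e => ln (a e)) (m0^-1 * (q * L1)).
  by apply: is_derive1_comp; rewrite a0; exact: is_derive1_ln.
have dlnb : is_derive (0 : R) 1 (fun e => ln (b e)) (n0^-1 * (p * L2)).
  by apply: is_derive1_comp; rewrite b0; exact: is_derive1_ln.
have dg : is_derive (0 : R) 1 g (L1 / m0 - L2 / n0).
  apply: (@is_derive_eq _ _ _ _ _ _ _ _
    (is_deriveB (is_deriveM (is_derive_cst q^-1 (0 : R) 1) dlna)
     (is_deriveM (is_derive_cst p^-1 (0 : R) 1) dlnb))).
  rewrite /GRing.scale /= !mulr0 !addr0.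
  by field; rewrite !gt_eqF.
have dexpg : is_derive (0 : R) 1 (fun e => expR (g e))
    (expR (g 0) * (L1 / m0 - L2 / n0)).
  exact: is_derive1_comp (is_derive_expR (g 0)) dg.
set Psi := (fun e : R => _) in dPsi.
have dD := is_deriveB dPsi dexpg.
have pGh e : powint nu p (fun y => G y + e%:c * (G y * h y)).
  have [mG _] := pG.
  apply: powintD => //; first exact: ltW.
  apply: powintZ; first exact: ltW.
  apply: (powint_le (ltW p0) (cmeasurableM mG mh) _ pG) => y.
  by rewrite Normc.normcM ler_piMr ?normc_ge0.
have quw e : powint mu q (fun x => u x + e%:c * w x).
  by apply: powintD (ltW q0) qu (powintZ _ (ltW q0) qw).
have PsiE e : Psi e = Ipow mu q (fun x => u x + e%:c * w x) `^ q^-1 /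
    Ipow nu p (fun y => G y + e%:c * (G y * h y)) `^ p^-1.
  by rewrite /Psi !cLnormE.
have gE e : 0 < a e -> 0 < b e -> expR (g e) = a e `^ q^-1 / b e `^ p^-1.
  move=> ae be; rewrite /g expRD expRN; congr (_ / _).
    by rewrite mulrC expRM lnK.
  by rewrite mulrC expRM lnK.
have Psi0 : Psi 0 = expR (g 0).
  have uE : (fun x => u x + 0%:c * w x) = u.
    by apply/funext => x; rewrite mul0r addr0.
  have GE : (fun y => G y + 0%:c * (G y * h y)) = G.
    by apply/funext => y; rewrite mul0r addr0.
  by rewrite PsiE uE GE gE ?a0 ?b0.
have [e1 e10 He1] := affine_gt0 (q * L1) m0p.
have [e2 e20 {}He2] := affine_gt0 (p * L2) n0p.
have {}He2 e : `|e| < e2 -> 0 < b e.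
  move=> /He2 be; rewrite /b ltr_wpDr// mulr_ge0 ?sqr_ge0//.
  by rewrite mulr_ge0 ?(ltW n0p)// addr_ge0 ?divr_ge0 ?mulr_ge0 ?sqr_ge0 ?(ltW p0).
pose e0 := Order.min (Order.min e1 e2) (Order.min 2^-1 (3 * p)^-1).
have e00 : 0 < e0.
  by rewrite /e0 !lt_min e10 e20 !invr_gt0 mulr_gt0// ltr0n.
have D0 : (Psi - (fun e => expR (g e))) 0 = 0.
  by rewrite -[LHS]/(Psi 0 - expR (g 0)) Psi0 subrr.
have := is_derive_min0 e00 dD D0.
have D1 e : `|e| < e0 -> 0 <= (Psi - (fun e => expR (g e))) e.
  rewrite /e0 !lt_min => /andP[/andP[ee1 ee2] /andP[ee3 ee4]].
  have ae := He1 _ ee1; have be := He2 _ ee2.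
  rewrite -[X in 0 <= X]/(Psi e - expR (g e)) subr_ge0 gE// PsiE.
  have e_le1 : `|e| <= 1 by rewrite (le_trans (ltW ee3))// invf_le1 ?ler1n.
  have := Ipow_expansion p0 pG mh h1 e_le1 (ltW ee4).
  rewrite expr2 -/K => up.
  have lo := Ipow_tangent e q1 u0 qu qw.
  have Np : 0 < Ipow nu p (fun y => G y + e%:c * (G y * h y)).
    have [_ iG] := pG.
    have i2 := integrableZl measurableT (2^-1 `^ p) iG.
    apply: (@lt_le_trans _ _ (2^-1 `^ p * n0)); first by rewrite mulr_gt0// powR_gt0.
    rewrite /n0 -RintegralZl//; apply: le_Rintegral => //.
      by have [] := pGh e.
    move=> y _.
    have -> : G y + e%:c * (G y * h y) = G y * (1 + e%:c * h y) by ring.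
    rewrite Normc.normcM powRM ?normc_ge0// mulrC ler_wpM2l ?powR_ge0//.
    rewrite ge0_ler_powR ?nnegrE ?normc_ge0 ?(ltW p0)//.
    have := normcD (1 + e%:c * h y) (- (e%:c * h y)).
    rewrite addrK normcN Normc.normc1 Normc.normcM normcC.
    have : `|e| * normc (h y) <= 2^-1.
      by rewrite (le_trans _ (ltW ee3))// ler_piMr.
    lra.
  rewrite ler_pM ?invr_ge0 ?powR_ge0//.
    by rewrite ge0_ler_powR ?nnegrE ?Ipow_ge0 ?invr_ge0 ?(ltW q0) ?(ltW ae).
  rewrite lef_pV2 ?posrE ?powR_gt0//.
  by rewrite ge0_ler_powR ?nnegrE ?Ipow_ge0 ?invr_ge0 ?(ltW p0) ?(ltW be).
move=> /(_ D1); rewrite sub0r => /eqP; rewrite oppr_eq0 mulf_eq0.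
by rewrite gt_eqF ?expR_gt0//= subr_eq0 => /eqP.
Qed.
End variation.

(** * The extension operator on Gaussians *)

Section parametric_integral.
Context d1 d2 (X : measurableType d1) (Y : measurableType d2) (R : realType).
Variable m2 : {sigma_finite_measure set Y -> \bar R}.
Local Notation C := R[i].

Lemma measurable_Rintegral_param (f : X * Y -> R) : measurable_fun setT f ->
  measurable_fun setT (fun x => \int[m2]_y f (x, y)).
Proof.
move=> mf; have mEf : measurable_fun setT (EFin \o f) by exact/measurable_EFinP.
rewrite (_ : (fun x => _) = fun x => fine
   ((\int[m2]_y (EFin \o f)^\+ (x, y)) - (\int[m2]_y (EFin \o f)^\- (x, y)))%E).
  apply: (measurableT_comp (fine_measurable measurableT)).
  apply: emeasurable_funB.
  - apply: (measurable_fun_fubini_tonelli_F (EFin \o f)^\+%E) => //.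
    exact: measurable_funepos.
  - apply: (measurable_fun_fubini_tonelli_F (EFin \o f)^\-%E) => //.
    exact: measurable_funeneg.
apply/funext => x; rewrite /Rintegral integralE; congr (fine (_ - _)%E).
- by apply: eq_integral => y _; rewrite !funeposE.
- by apply: eq_integral => y _; rewrite !funenegE.
Qed.

Lemma cmeasurable_cintegral (f : X * Y -> C) : cmeasurable f ->
  cmeasurable (fun x => cintegral m2 (fun y => f (x, y))).
Proof. move=> [f1 f2]; split.
- exact: (measurable_Rintegral_param f1).
- exact: (measurable_Rintegral_param f2). Qed.

End parametric_integral.

Section extension.
Context (R : realType) (d : nat) (sigma : 'I_d -> R).
Local Notation C := R[i].
Local Notation RT := (measurableTypeR R).
Local Notation mu := (lebesgue_rV R d).
Local Notation st := (lebesgue_spacetime R d).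
Local Notation T := (fourier_ext sigma).
Local Notation toC := (map_mx (real_complex R)).
Local Notation mRe := (map_mx (@complex.Re R)).
Local Notation mIm := (map_mx (@complex.Im R)).

Definition ext_kernel (xt : 'rV[R]_d * RT) (xi : 'rV[R]_d) : C :=
  cexp (Complex 0 (dotrV xt.1 xi + (xt.2 : R) * quadQ sigma xi)).

Lemma normc_ext_kernel xt xi : normc (ext_kernel xt xi) = 1.
Proof. by rewrite normc_cexp expR0. Qed.

Lemma measurable_ext_phase : measurable_fun setT
  (fun z : ('rV[R]_d * RT) * 'rV[R]_d =>
    dotrV z.1.1 z.2 + (z.1.2 : R) * quadQ sigma z.2 : RT).
Proof.
have m1 i : measurable_fun setT
    (fun z : ('rV[R]_d * RT) * 'rV[R]_d => z.1.1 ord0 i : RT).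
  apply: (measurableT_comp (measurable_rV_coord i)).
  exact: (measurableT_comp (@measurable_fst _ _ _ _) (@measurable_fst _ _ _ _)).
have m2 i : measurable_fun setT
    (fun z : ('rV[R]_d * RT) * 'rV[R]_d => z.2 ord0 i : RT).
  exact: (measurableT_comp (measurable_rV_coord i) (@measurable_snd _ _ _ _)).
apply: measurable_funD.
  rewrite /dotrV; apply: measurable_sum => i.
  exact: measurable_funM (m1 i) (m2 i).
apply: measurable_funM.
  exact: (measurableT_comp (@measurable_snd _ _ _ _) (@measurable_fst _ _ _ _)).
rewrite /quadQ; apply: measurable_sum => i.
exact: measurable_funM (measurable_cst _) (measurable_funX 2 (m2 i)).
Qed.

Lemma cmeasurable_ext_kernel :
  cmeasurable (fun z : ('rV[R]_d * RT) * 'rV[R]_d => ext_kernel z.1 z.2).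
Proof.
apply: cmeasurable_cexp; split => /=; first exact: measurable_cst.
exact: measurable_ext_phase.
Qed.

Lemma cmeasurable_ext_kernel1 xt : cmeasurable (ext_kernel xt).
Proof.
exact: (cmeasurable_comp cmeasurable_ext_kernel (@measurable_pair1 _ _ _ _ xt)).
Qed.

Lemma cintegrable_ext_kernel xt f : cintegrable mu f ->
  cintegrable mu (fun xi => ext_kernel xt xi * f xi).
Proof.
move=> fi; have mf := cintegrable_cmeasurable fi.
apply: (le_cintegrable _ (cintegrable_normc fi)).
  by apply: cmeasurableM => //; exact: cmeasurable_ext_kernel1.
by move=> xi; rewrite Normc.normcM normc_ext_kernel mul1r.
Qed.

Lemma fourier_extE f xt :
  T f xt = cintegral mu (fun xi => ext_kernel xt xi * f xi).
Proof. by []. Qed.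

Lemma fourier_extDZ (f g : 'rV[R]_d -> C) (a : C) xt : cintegrable mu f ->
  cintegrable mu g -> T (fun xi => f xi + a * g xi) xt = T f xt + a * T g xt.
Proof.
move=> fi gi; rewrite !fourier_extE -cintegralZ; last exact: cintegrable_ext_kernel.
rewrite -cintegralD; first last.
- exact/cintegrableZ/cintegrable_ext_kernel.
- exact: cintegrable_ext_kernel.
by apply: eq_cintegral => xi; rewrite mulrDr mulrCA.
Qed.

Lemma cmeasurable_fourier_ext f : cmeasurable f -> cmeasurable (T f).
Proof.
move=> mf.
pose F (z : ('rV[R]_d * RT) * 'rV[R]_d) := ext_kernel z.1 z.2 * f z.2.
have mF : cmeasurable F.
  apply: cmeasurableM; first exact: cmeasurable_ext_kernel.
  exact: (cmeasurable_comp mf (@measurable_snd _ _ _ _)).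
exact: (cmeasurable_cintegral (leb_rV R d) mF).
Qed.

(** For integrable f the extension is the integral itself, so the inequality bounds
    it directly. *)
Lemma extension_powint (p q : R) : 0 < p -> 0 < q ->
  extension_inequality sigma p q ->
  exists2 C1 : R, 0 <= C1 & forall f, cintegrable mu f -> powint mu p f ->
    powint st q (T f) /\ Ipow st q (T f) <= C1 * Ipow mu p f `^ (q / p).
Proof.
move=> p0 q0 [C0 HC0]; exists (`|C0| `^ q) => [|f fi pf]; first exact: powR_ge0.
have [F [[_ FE]|[]//]] := HC0 f ((cLpP mu f p0).2 pf).
rewrite {}FE (cLnormE pf) -EFinM => le.
have mf := cintegrable_cmeasurable fi.
have qf : powint st q (T f).
  apply/(powintP st q0 (cmeasurable_fourier_ext mf)).
  exact: le_lt_trans le (ltry _).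
split => //; move: le; rewrite (cLnormE qf) lee_fin => le.
have -> : Ipow st q (T f) = (Ipow st q (T f) `^ q^-1) `^ q.
  by rewrite -powRrM mulVf ?gt_eqF// powRr1 ?Ipow_ge0.
have -> : Ipow mu p f `^ (q / p) = (Ipow mu p f `^ p^-1) `^ q.
  by rewrite -powRrM mulrC.
rewrite -powRM ?powR_ge0// ge0_ler_powR ?nnegrE ?powR_ge0 ?mulr_ge0 ?powR_ge0 ?(ltW q0)//.
by rewrite (le_trans le)// ler_wpM2r ?powR_ge0// ler_norm.
Qed.

Definition gfun (A : 'M[C]_d) (b : 'rV[C]_d) (c : C) (xi : 'rV[R]_d) : C :=
  cexp (- qf A (toC xi) + bf 1%:M (toC xi) b + c).

Lemma is_gaussianP G : is_gaussian G ->
  exists (A : 'M[C]_d) (b : 'rV[C]_d) (c : C),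
    [/\ A^T = A, posdef (mRe A) & G = gfun A b c].
Proof.
move=> [A [b [c [AT posA GE]]]]; exists A, (\row_j b j), c; split => //.
  move=> x /posA; rewrite qfE; congr (_ < _).
  rewrite exchange_big; apply: eq_bigr => j _; rewrite mulr_suml.
  by apply: eq_bigr => k _; rewrite !mxE; ring.
apply/funext => xi; rewrite GE /gfun.
have <- : \sum_j \sum_k A j k * (xi ord0 j * xi ord0 k)%:c = qf A (toC xi).
  rewrite qfE exchange_big; apply: eq_bigr => j _; rewrite mulr_suml.
  by apply: eq_bigr => k _; rewrite !mxE rmorphM mulrA (mulrC (A _ _)).
have <- // : \sum_j b j * (xi ord0 j)%:c = bf 1%:M (toC xi) (\row_j b j).
rewrite /bf mulmx1 mxE; apply: eq_bigr => j _.
by rewrite !mxE mulrC.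
Qed.

Definition smx : 'M[R]_d := diag_mx (\row_j sigma j).

(** The quadratic part of the integrand of the extension at time t. *)
Definition Mt (A : 'M[C]_d) (t : R) : 'M[C]_d := A - ('i%C * t%:c) *: toC smx.

Lemma smx_sym : smx^T = smx. Proof. exact: tr_diag_mx. Qed.

Lemma Mt_sym A t : A^T = A -> (Mt A t)^T = Mt A t.
Proof. by move=> AT; rewrite /Mt linearB /= linearZ /= map_trmx smx_sym AT. Qed.

Lemma mRe_Mt A t : mRe (Mt A t) = mRe A.
Proof.
apply/matrixP => i j; rewrite !mxE !ReImE /=; ring.
Qed.

Lemma quadQE xi : quadQ sigma xi = qf smx xi.
Proof.
rewrite qfE; apply: eq_bigr => j _; rewrite (bigD1 j)//= big1 => [|i ij].
  by rewrite !mxE eqxx mulr1n addr0; ring.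
by rewrite !mxE (negPf ij) mulr0n mulr0.
Qed.

Lemma dotrVE (x xi : 'rV[R]_d) : dotrV x xi = bf 1%:M xi x.
Proof.
by rewrite /bf mulmx1 mxE; apply: eq_bigr => j _; rewrite !mxE mulrC.
Qed.

Lemma ext_kernel_gfun A b c xt xi : ext_kernel xt xi * gfun A b c xi =
  cexp (- qf (Mt A xt.2) (toC xi) +
        bf 1%:M (toC xi) ('i%C *: toC xt.1 + b) + c).
Proof.
rewrite /ext_kernel /gfun -cexpD; congr cexp.
have -> : Complex 0 (dotrV xt.1 xi + (xt.2 : R) * quadQ sigma xi) =
    'i%C * (bf 1%:M (toC xi) (toC xt.1) + ((xt.2 : R)%:c) * qf (toC smx) (toC xi)).
  rewrite qf_bf -(map_mx1 (real_complex R)) !bf_toC dotrVE quadQE qf_bf.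
  by apply: complex_eq; rewrite !ReImE /=; ring.
rewrite !qf_bf /Mt bfDr bfZr bfMD -scaleNr bfMZ; ring.
Qed.

Lemma fourier_ext_gfun A b c xt :
  T (gfun A b c) xt = gauss_ft (Mt A xt.2) b c xt.1.
Proof. by apply: eq_cintegral => xi; exact: ext_kernel_gfun. Qed.

(** A modulation in frequency is a translation in space. *)
Lemma fourier_ext_gfun_shift A b c v xt :
  T (gfun A (b + 'i%C *: toC v) c) xt = T (gfun A b c) (xt.1 + v, xt.2).
Proof.
rewrite !fourier_ext_gfun /gauss_ft /=; apply: eq_cintegral => xi.
have -> // : 'i%C *: toC xt.1 + (b + 'i%C *: toC v) = 'i%C *: toC (xt.1 + v) + b.
by rewrite map_mxD scalerDr (addrC b) addrA.
Qed.

Lemma cmeasurable_gfun A b c : cmeasurable (gfun A b c).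
Proof.
apply: cmeasurable_cexp; apply: cmeasurableD; last exact: cmeasurable_cst.
apply: cmeasurableD.
  apply: cmeasurableN.
  by have := cmeasurable_qf A 0; under eq_fun do rewrite subr0.
under eq_fun do rewrite /bf mulmx1 mxE.
apply: cmeasurable_sum => j _; apply: cmeasurableM; last exact: cmeasurable_cst.
under eq_fun do rewrite mxE.
exact: (cmeasurableC (measurable_rV_coord j)).
Qed.

Lemma cintegrable_gfun A b c : A^T = A -> posdef (mRe A) ->
  cintegrable mu (gfun A b c).
Proof. by move=> AT posA; exact: cintegrable_gauss_dot. Qed.

Lemma gfun_neq0 A b c xi : gfun A b c xi != 0.
Proof. exact: cexp_neq0. Qed.

Lemma powint_gfun p A b c : 0 < p -> A^T = A -> posdef (mRe A) ->
  powint mu p (gfun A b c).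
Proof.
move=> p0 AT posA; split; first exact: cmeasurable_gfun.
have ApT : (p%:c *: A)^T = p%:c *: A by rewrite linearZ /= AT.
have posAp : posdef (mRe (p%:c *: A)).
  move=> x x0; have -> : mRe (p%:c *: A) = p *: mRe A.
    by apply/matrixP => i j; rewrite !mxE ReM /= mul0r subr0.
  by rewrite qf_bf bfMZ -qf_bf mulr_gt0// posA.
have := cintegrable_normc (cintegrable_gauss_dot ApT posAp (p%:c *: b) (p%:c * c)).
apply: eq_integrable => // x _; congr (_%:E).
rewrite /gfun !normc_cexp -expRM; congr expR.
rewrite !qf_bf bfMZ bfZr; move: (bf _ _ _) (bf _ _ _) => z w.
by rewrite !ReImE /=; ring.
Qed.

End extension.

Section positivity.
Context (R : realType).
Local Notation RT := (measurableTypeR R).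

Lemma Rintegral_gt0 dd (X : measurableType dd) (m : {measure set X -> \bar R})
    (f : X -> R) : m setT != 0%E -> (forall x, 0 < f x) ->
  m.-integrable setT (EFin \o f) -> 0 < \int[m]_x f x.
Proof.
move=> m0 f0 fi; rewrite lt_neqAle Rintegral_ge0 ?andbT; last by move=> x _; exact: ltW.
apply: contra m0 => /eqP/esym i0.
have mf : measurable_fun setT (EFin \o f) by case/integrableP: fi.
have : (\int[m]_x `|(EFin \o f) x| = 0)%E.
  under eq_integral do rewrite gee0_abs ?lee_fin ?(ltW (f0 _))//.
  by rewrite -(fineK (integrable_fin_num measurableT fi)) -[fine _]/(Rintegral _ _ _) i0.
move=> /(ae_eq_integral_abs _ measurableT mf)[N [mN N0 sub]].
rewrite -measure_le0 -N0 le_measure ?inE// => x _; apply: sub => /=.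
by move=> /(_ I) [] fx0; have := f0 x; rewrite fx0 ltxx.
Qed.

Lemma lebesgue_setT_neq0 : @lebesgue_measure R setT != 0%E.
Proof.
apply/negP => /eqP h; have : (lebesgue_measure (`]0%R, 1%R]%classic : set R) <= 0)%E.
  by rewrite -h le_measure ?inE.
by rewrite lebesgue_measure_itv /= lte_fin ltr01 sube0 lee_fin ler10.
Qed.

Lemma lebesgue_rV_setT_neq0 n : lebesgue_rV R n setT != 0%E.
Proof.
elim: n => [|n IHn].
  rewrite /= diracE in_setT /=; exact: oner_neq0.
rewrite -[X in X != _]/(((leb_rV R n) \x @lebesgue_measure R)%E (@rV_cons R n @^-1` setT)).
rewrite preimage_setT -setXTT product_measure1E//=.
by rewrite mule_eq0 negb_or IHn lebesgue_setT_neq0.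
Qed.

Lemma lebesgue_spacetime_setT_neq0 n : lebesgue_spacetime R n setT != 0%E.
Proof.
rewrite -[X in X != _]/(((leb_rV R n) \x @lebesgue_measure R)%E setT).
rewrite -setXTT product_measure1E//=.
by rewrite mule_eq0 negb_or lebesgue_rV_setT_neq0 lebesgue_setT_neq0.
Qed.

Lemma Ipow_gt0 dd (X : measurableType dd) (m : {measure set X -> \bar R}) p
    (f : X -> R[i]) : m setT != 0%E -> (forall x, f x != 0) -> powint m p f ->
  0 < Ipow m p f.
Proof.
move=> m0 f0 [_ fi]; apply: Rintegral_gt0 => // x.
by rewrite powR_gt0// normc_gt0.
Qed.
End positivity.

(** * Smooth cutoffs *)

Section flat.
Context (R : realType).
Implicit Types x y : R.

(** The functions x^-k exp(-1/x), extended by zero to the half-line x <= 0,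
    form a family that is closed under differentiation up to linear
    combinations, which makes exp(-1/x) smooth. *)
Definition flat (k : nat) (x : R) : R :=
  if 0 < x then x^-1 ^+ k * expR (- x^-1) else 0.

Lemma flat_ge0 k x : 0 <= flat k x.
Proof.
rewrite /flat; case: ifPn => // x0.
by rewrite mulr_ge0 ?expR_ge0// exprn_ge0// invr_ge0 ltW.
Qed.

(** exp(y) >= y^(k+2) / (k+2)! at y = 1/x. *)
Lemma flat_le k x : flat k x <= k.+2`!%:R * x ^+ 2.
Proof.
rewrite /flat; case: ifPn => [x0|_]; last by rewrite mulr_ge0 ?sqr_ge0.
have y0 : 0 < x^-1 by rewrite invr_gt0.
have h := expR_ge1Dxn k.+1 (ltW y0).
rewrite expRN ler_pdivrMr ?expR_gt0//.
have f0 : 0 < k.+2`!%:R :> R by rewrite ltr0n fact_gt0.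
apply: (@le_trans _ _ (k.+2`!%:R * x ^+ 2 * (x^-1 ^+ k.+2 / k.+2`!%:R))).
  rewrite le_eqVlt; apply/orP; left; apply/eqP.
  rewrite !exprS; move: (_ ^+ k) => z; field.
  by rewrite !gt_eqF.
apply: ler_wpM2l; first by apply: mulr_ge0; [exact: ltW|exact: sqr_ge0].
by apply: le_trans h; rewrite lerDr.
Qed.

Lemma is_derive_flat_bound (f : R -> R) (c : R) :
  (forall x, `|f x| <= c * x ^+ 2) -> is_derive (0 : R) 1 f 0.
Proof.
move=> fc.
have f0 : f 0 = 0.
  by apply/eqP; rewrite -normr_le0 (le_trans (fc 0))// expr0n mulr0.
have c0 : 0 <= c by have := le_trans (normr_ge0 _) (fc 1); rewrite expr1n mulr1.
have c1 : 0 < c + 1 by rewrite ltr_wpDl.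
have cv : (fun h : R => h^-1 *: ((f \o shift 0) (h *: (1 : R)) - f 0)) @ 0^' --> (0 : R).
  apply/cvgrPdist_le => e e0; near=> h.
  have h0 : h != 0 by near: h; exact: nbhs_dnbhs_neq.
  rewrite sub0r normrN f0 subr0 /= addr0 [h *: 1]mulr1 [_ *: _]/(_ * _) normrM normfV.
  rewrite mulrC ler_pdivrMr ?normr_gt0// (le_trans (fc h))//.
  rewrite -(real_normK (num_real h)) expr2 mulrA ler_wpM2r//.
  apply: (@le_trans _ _ ((c + 1) * `|h|)); first by rewrite ler_wpM2r// lerDl.
  rewrite mulrC -ler_pdivlMr//; apply: ltW; near: h.
  exact: (dnbhs0_lt (divr_gt0 e0 c1)).
by split; [apply/cvg_ex; exists 0|exact: cvg_lim cv].
Unshelve. all: end_near. Qed.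

Lemma is_derive_flat k x :
  is_derive x 1 (flat k) (- k%:R * flat k.+1 x + flat k.+2 x).
Proof.
have [x0|x0|->] := ltgtP x 0.
- rewrite /flat !ifF ?(lt_gtF x0)// mulr0 addr0.
  apply: near_eq_is_derive (is_derive_cst (0 : R) x 1).
  by near=> y; rewrite ifF//; apply: lt_gtF; near: y; exact: lt_nbhsl.
- have hV : is_derive x 1 (fun y : R => y^-1) (- x ^- 2).
    apply: is_derive_eq; first by apply: is_deriveV; rewrite gt_eqF.
    by rewrite /GRing.scale /= mulr1.
  have hX : is_derive x 1 (fun y : R => y^-1 ^+ k) (k%:R * x^-1 ^+ k.-1 * - x ^- 2).
    rewrite (_ : (fun y : R => _) = (fun y : R => y^-1) ^+ k); last first.
      by apply/funext => y; rewrite exprfctE.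
    apply: (is_derive_eq (is_deriveX k hV)).
    by rewrite /GRing.scale /= mulr_natl.
  have hE : is_derive x 1 (fun y : R => expR (- y^-1)) (expR (- x^-1) * - - x ^- 2).
    exact: (@is_derive1_comp _ expR _ _ _ _ (is_derive_expR _) (is_deriveN hV)).
  apply: near_eq_is_derive (is_derive_eq (is_deriveM hX hE) _).
    near=> y; rewrite /flat ifT//; near: y; exact: lt_nbhsr.
  rewrite /flat x0 /GRing.scale /= -exprVn; case: k {hX} => [|k] /=.
    by rewrite !expr0; ring.
  by rewrite !exprS; ring.
- rewrite /flat ltxx mulr0 addr0.
  apply: (is_derive_flat_bound (c := k.+2`!%:R)) => y.
  by rewrite ger0_norm ?flat_ge0 ?flat_le.
Unshelve. all: end_near. Qed.

Lemma continuous_flat k : continuous (flat k).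
Proof. by move=> x; exact: is_derive_continuous (is_derive_flat k x). Qed.

End flat.

Section elementary.
Context (R : realType) (d : nat).
Local Notation C := R[i].
Local Notation V := ('rV[R]_d).
Local Notation toC := (map_mx (real_complex R)).

(** A class of functions closed under partial derivatives, hence consisting of
    smooth functions: this avoids the product and chain rules for higher
    derivatives. *)
Inductive elementary : (V -> R) -> Prop :=
| elem_cst c : elementary (fun _ => c)
| elem_coord j : elementary (fun x => x ord0 j)
| elem_add f g : elementary f -> elementary g -> elementary (fun x => f x + g x)
| elem_mul f g : elementary f -> elementary g -> elementary (fun x => f x * g x)
| elem_exp f : elementary f -> elementary (fun x => expR (f x))
| elem_cos f : elementary f -> elementary (fun x => cos (f x))
| elem_sin f : elementary f -> elementary (fun x => sin (f x))
| elem_flat k f : elementary f -> elementary (fun x => flat k (f x)).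

Lemma elementary_continuous f : elementary f -> continuous f.
Proof.
elim=> {f} [c|j|f g _ cf _ cg|f g _ cf _ cg|f _ cf|f _ cf|f _ cf|k f _ cf] x.
- exact: cst_continuous.
- exact: coord_continuous.
- exact: cvgD (cf x) (cg x).
- exact: cvgM (cf x) (cg x).
- by apply: (@continuous_comp _ _ _ f expR); [exact: cf|exact: continuous_expR].
- by apply: (@continuous_comp _ _ _ f cos); [exact: cf|exact: continuous_cos].
- by apply: (@continuous_comp _ _ _ f sin); [exact: cf|exact: continuous_sin].
- by apply: (@continuous_comp _ _ _ f (flat k)); [exact: cf|exact: continuous_flat].
Qed.

(** Reduces chain rules for directional derivatives to the one on the line. *)
Lemma is_derive_line (f : V -> R) (x v : V) (a : R) :
  is_derive x v f a <-> is_derive (0 : R) 1 (fun t : R => f (t *: v + x)) a.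
Proof.
have E : (fun h : R => h^-1 *: (((fun t : R => f (t *: v + x)) \o shift 0) (h *: (1 : R))
     - f (0 *: v + x))) = (fun h => h^-1 *: ((f \o shift x) (h *: v) - f x)).
  by apply/funext => h /=; rewrite scale0r add0r addr0 [h *: 1]mulr1.
by split => -[h1 h2]; split; move: h1 h2; rewrite /derivable /derive E.
Qed.

Lemma is_derive_chain (h h' : R -> R) (f : V -> R) (x v : V) (a : R) :
  (forall y : R, is_derive y 1 h (h' y)) -> is_derive x v f a ->
  is_derive x v (fun y => h (f y)) (h' (f x) * a).
Proof.
move=> dh /is_derive_line df; apply/is_derive_line.
have -> : h' (f x) = h' ((fun t : R => f (t *: v + x)) 0) by rewrite scale0r add0r.
exact: (@is_derive1_comp _ h _ _ _ _ (dh _) df).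
Qed.

Lemma elementary_derive f (v : V) : elementary f ->
  exists2 g, elementary g & forall x, is_derive x v f (g x).
Proof.
elim=> {f} [c|j|f g ef [f' ef' df] eg [g' eg' dg]|f g ef [f' ef' df] eg [g' eg' dg]
  |f ef [f' ef' df]|f ef [f' ef' df]|f ef [f' ef' df]|k f ef [f' ef' df]].
- exists (fun _ => 0); first exact: elem_cst.
  by move=> x; exact: is_derive_cst.
- exists (fun _ => v ord0 j); first exact: elem_cst.
  move=> x; apply/is_derive_line; under eq_fun do rewrite !mxE.
  apply: is_derive_eq (is_deriveD (is_deriveM (is_derive_id (0 : R) 1)
    (is_derive_cst (v ord0 j) (0 : R) 1)) (is_derive_cst (x ord0 j) (0 : R) 1)) _.
  by rewrite /GRing.scale /=; ring.
- exists (fun x => f' x + g' x); first exact: elem_add.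
  by move=> x; exact: is_deriveD.
- exists (fun x => f x * g' x + g x * f' x); first by apply: elem_add; apply: elem_mul.
  by move=> x; exact: is_deriveM.
- exists (fun x => expR (f x) * f' x); first by apply: elem_mul => //; exact: elem_exp.
  by move=> x; apply: is_derive_chain => // y; exact: is_derive_expR.
- exists (fun x => (- 1 * sin (f x)) * f' x).
    by do 2 (apply: elem_mul => //); [exact: elem_cst|exact: elem_sin].
  move=> x; rewrite mulN1r.
  by apply: (is_derive_chain (h' := fun y => - sin y)) => // y; exact: is_derive_cos.
- exists (fun x => cos (f x) * f' x); first by apply: elem_mul => //; exact: elem_cos.
  by move=> x; apply: is_derive_chain => // y; exact: is_derive_sin.
- exists (fun x => (- k%:R * flat k.+1 (f x) + flat k.+2 (f x)) * f' x).
    apply: elem_mul => //; apply: elem_add; last exact: elem_flat.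
    by apply: elem_mul; [exact: elem_cst|exact: elem_flat].
  move=> x; apply: (is_derive_chain
    (h' := fun y => - k%:R * flat k.+1 y + flat k.+2 y)) => // y.
  exact: is_derive_flat.
Qed.

Lemma elementary_smooth f : elementary f -> smooth f.
Proof.
move=> ef s; have {}ef : elementary (foldr (@partial R d) f s).
  elim: s => //= j s IHs.
  have [g eg dg] := elementary_derive (delta_mx ord0 j) IHs.
  suff -> : partial j (foldr (@partial R d) f s) = g by [].
  by apply/funext => x; rewrite /partial; have [_ ->] := dg x.
split; first exact: elementary_continuous.
move=> j x; have [g _ dg] := elementary_derive (delta_mx ord0 j) ef.
by have [] := dg x.
Qed.

Lemma elem_sum (I : Type) (r : seq I) (F : I -> V -> R) :
  (forall i, elementary (F i)) -> elementary (fun x => \sum_(i <- r) F i x).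
Proof.
move=> eF; elim: r => [|i r IHr].
  by under eq_fun do rewrite big_nil; exact: elem_cst.
by under eq_fun do rewrite big_cons; exact: elem_add.
Qed.

Definition celementary (f : V -> C) :=
  elementary (fun x => Re (f x)) /\ elementary (fun x => Im (f x)).

Lemma celem_cst (c : C) : celementary (fun _ => c).
Proof. by split; exact: elem_cst. Qed.

Lemma celem_real (f : V -> R) : elementary f -> celementary (fun x => (f x)%:c).
Proof. by split => //=; exact: elem_cst. Qed.

Lemma celem_add f g : celementary f -> celementary g ->
  celementary (fun x => f x + g x).
Proof.
move=> [f1 f2] [g1 g2]; split.
- by under eq_fun do rewrite ReD; exact: elem_add.
- by under eq_fun do rewrite ImD; exact: elem_add.
Qed.

Lemma elem_opp f : elementary f -> elementary (fun x => - f x).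
Proof.
move=> ef; under eq_fun do rewrite -mulN1r.
by apply: elem_mul => //; exact: elem_cst.
Qed.

Lemma celem_mul f g : celementary f -> celementary g ->
  celementary (fun x => f x * g x).
Proof.
move=> [f1 f2] [g1 g2]; split.
- under eq_fun do rewrite ReM; apply: elem_add; first exact: elem_mul.
  by apply: elem_opp; exact: elem_mul.
- by under eq_fun do rewrite ImM; apply: elem_add; exact: elem_mul.
Qed.

Lemma celem_opp f : celementary f -> celementary (fun x => - f x).
Proof.
move=> [f1 f2]; split.
- by under eq_fun do rewrite ReN; exact: elem_opp.
- by under eq_fun do rewrite ImN; exact: elem_opp.
Qed.

Lemma celem_sum (I : Type) (r : seq I) (F : I -> V -> C) :
  (forall i, celementary (F i)) -> celementary (fun x => \sum_(i <- r) F i x).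
Proof.
move=> eF; split.
- by under eq_fun do rewrite Re_sum; apply: elem_sum => i; case: (eF i).
- by under eq_fun do rewrite Im_sum; apply: elem_sum => i; case: (eF i).
Qed.

Lemma celem_cexp f : celementary f -> celementary (fun x => cexp (f x)).
Proof.
move=> [f1 f2]; split; rewrite /cexp /=.
- by apply: elem_mul; [exact: elem_exp|exact: elem_cos].
- by apply: elem_mul; [exact: elem_exp|exact: elem_sin].
Qed.

Lemma celem_coord j : celementary (fun x => (x ord0 j)%:c).
Proof. by apply: celem_real; exact: elem_coord. Qed.

Lemma celem_gfun A b c : celementary (@gfun R d A b c).
Proof.
apply: celem_cexp; apply: celem_add; last exact: celem_cst.
apply: celem_add.
  apply: celem_opp; under eq_fun do rewrite qfE.
  apply: celem_sum => j; apply: celem_mul; last first.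
    by under eq_fun do rewrite mxE; exact: celem_coord.
  apply: celem_sum => i; apply: celem_mul; last exact: celem_cst.
  by under eq_fun do rewrite mxE; exact: celem_coord.
under eq_fun do rewrite /bf mulmx1 mxE.
apply: celem_sum => j; apply: celem_mul; last exact: celem_cst.
by under eq_fun do rewrite mxE; exact: celem_coord.
Qed.

Definition sqnorm (x : V) : R := \sum_j x ord0 j ^+ 2.

Lemma sqnorm_ge0 x : 0 <= sqnorm x.
Proof. by apply: sumr_ge0 => j _; exact: sqr_ge0. Qed.

Lemma elem_sqnorm : elementary sqnorm.
Proof.
rewrite /sqnorm; apply: elem_sum => j; under eq_fun do rewrite expr2.
by apply: elem_mul; exact: elem_coord.
Qed.

(** The factor expR 1 normalizes the value at the origin to 1, so that the cutoffs
    take values between 0 and 1 and tend to 1. *)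
Definition cutoff (n : nat) (x : V) : R :=
  expR 1 * flat 0 (1 - n.+1%:R ^- 2 * sqnorm x).

Lemma elem_cutoff n : elementary (cutoff n).
Proof.
apply: elem_mul; first exact: elem_cst.
apply: elem_flat; apply: elem_add; first exact: elem_cst.
apply: elem_opp; apply: elem_mul; first exact: elem_cst.
exact: elem_sqnorm.
Qed.

Lemma cutoff_ge0 n x : 0 <= cutoff n x.
Proof. by rewrite mulr_ge0 ?expR_ge0 ?flat_ge0. Qed.

Lemma cutoff_le1 n x : cutoff n x <= 1.
Proof.
rewrite /cutoff /flat expr0 mul1r; case: ifPn => [y0|_]; last by rewrite mulr0.
rewrite -expRD -[leRHS]expR0 ler_expR subr_le0 invf_ge1//.
by rewrite gerBl mulr_ge0 ?sqnorm_ge0// invr_ge0 sqr_ge0.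
Qed.

Lemma cutoff_cvg x : cutoff ^~ x @ \oo --> (1 : R).
Proof.
have -> : 1 = expR 1 * flat 0 (1 - 0 * sqnorm x) :> R.
  by rewrite mul0r subr0 /flat ltr01 expr0 mul1r invr1 expRN mulfV ?gt_eqF ?expR_gt0.
have c1 : (fun n : nat => (n.+1%:R ^- 2 : R)) @ \oo --> (0 : R).
  have h : (fun n : nat => (n.+1%:R : R)^-1) @ \oo --> (0 : R).
    exact: cvg_harmonic.
  rewrite -[X in _ --> X](mulr0 (0 : R)).
  rewrite (_ : (fun n : nat => _) = (fun n : nat => n.+1%:R^-1 * n.+1%:R^-1)).
    exact: (cvgM h h).
  by apply/funext => n; rewrite -exprVn expr2.
apply: cvgM; first exact: cvg_cst.
apply: (@cvg_comp _ _ _ (fun n : nat => 1 - n.+1%:R ^- 2 * sqnorm x) (flat 0));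
  last exact: continuous_flat.
apply: cvgB; first exact: cvg_cst.
by apply: cvgM => //; exact: cvg_cst.
Qed.

Lemma cutoff_neq0 n x j : cutoff n x != 0 -> `|x ord0 j| <= n.+1%:R.
Proof.
rewrite /cutoff mulf_eq0 negb_or => /andP[_]; rewrite /flat.
case: ifPn; last by rewrite eqxx.
rewrite subr_gt0 => h _; rewrite -ler_sqr ?nnegrE// real_normK ?num_real//.
move: h; rewrite mulrC ltr_pdivrMr ?exprn_gt0// mul1r => /ltW; apply: le_trans.
by rewrite /sqnorm (bigD1 j)//= lerDl sumr_ge0// => i _; exact: sqr_ge0.
Qed.

Lemma measurable_cutoff n : measurable_fun setT (cutoff n : V -> measurableTypeR R).
Proof.
apply: measurable_funM; first exact: measurable_cst.
apply: (@measurableT_comp _ _ _ _ _ _ (flat 0)).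
  exact: continuous_measurable_fun (@continuous_flat R 0).
apply: measurable_funB; first exact: measurable_cst.
apply: measurable_funM; first exact: measurable_cst.
apply: measurable_sum => j; apply: measurable_funX.
exact: measurable_rV_coord.
Qed.

Lemma test_function_cutoff n A b c :
  test_function (fun x => gfun A b c x * (cutoff n x)%:c).
Proof.
have [e1 e2] := celem_mul (celem_gfun A b c) (celem_real (elem_cutoff n)).
split; [exact: elementary_smooth e1|exact: elementary_smooth e2|].
pose N : R := n.+1%:R.
have cB : compact [set v : V | forall i, `[- N, N]%classic (v ord0 i)].
  by apply: (@rV_compact R d (fun=> `[- N, N]%classic)) => i; exact: segment_compact.
apply: (subclosed_compact _ cB); first exact: closed_closure.
have clB : closed [set v : V | forall i, `[- N, N]%classic (v ord0 i)].
  by apply: compact_closed cB; exact: norm_hausdorff.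
rewrite [X in _ `<=` X]((closure_id _).1 clB); apply: closureS => x /=.
rewrite mulf_eq0 negb_or => /andP[_] h i.
rewrite in_itv /= -ler_norml; apply: cutoff_neq0.
by apply: contra h => /eqP ->.
Qed.

End elementary.

(** * The Euler-Lagrange equation tested against modulations *)

Section euler_lagrange.
Context (R : realType) (d : nat) (sigma : 'I_d -> R).
Local Notation C := R[i].
Local Notation RT := (measurableTypeR R).
Local Notation mu := (lebesgue_rV R d).
Local Notation st := (lebesgue_spacetime R d).
Local Notation T := (fourier_ext sigma).
Local Notation toC := (map_mx (real_complex R)).
Local Notation mRe := (map_mx (@complex.Re R)).
Local Notation mIm := (map_mx (@complex.Im R)).

Variables (p q : R) (A : 'M[C]_d) (b : 'rV[C]_d) (c : C).
Hypotheses (p1 : 1 < p) (q1 : 1 < q) (AT : A^T = A) (posA : posdef (mRe A)).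
Hypothesis ineq : extension_inequality sigma p q.
Hypothesis crit : critical_point sigma p q (gfun A b c).

Let G := gfun A b c.
Let u := T G.
Let m0 := Ipow st q u.
Let n0 := Ipow mu p G.

Let p0 : 0 < p. Proof. exact: lt_trans p1. Qed.
Let q0 : 0 < q. Proof. exact: lt_trans q1. Qed.

Let u_neq0 xt : u xt != 0.
Proof.
rewrite /u fourier_ext_gfun; apply: gauss_ft_neq0; first exact: Mt_sym.
by rewrite mRe_Mt.
Qed.

Let pG : powint mu p G. Proof. exact: powint_gfun. Qed.

Let powint_T b' c' : powint st q (T (gfun A b' c')).
Proof.
have [C1 _ /(_ (gfun A b' c'))] := extension_powint p0 q0 ineq.
by case=> //; [exact: cintegrable_gfun|exact: powint_gfun].
Qed.

Let m0_gt0 : 0 < m0.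
Proof. exact: Ipow_gt0 (@lebesgue_spacetime_setT_neq0 R d) u_neq0 (powint_T _ _). Qed.

Let n0_gt0 : 0 < n0.
Proof. exact: Ipow_gt0 (@lebesgue_rV_setT_neq0 R d) (@gfun_neq0 R d A b c) pG. Qed.

Lemma bf1_toC (x y : 'rV[R]_d) : bf 1%:M (toC x) (toC y) = (bf 1%:M x y)%:c.
Proof. by rewrite -(map_mx1 (real_complex R)) bf_toC. Qed.

Definition modulation (v : 'rV[R]_d) (k : R) (xi : 'rV[R]_d) : C :=
  cexp ('i%C * (bf 1%:M xi v + k)%:c).

Lemma normc_modulation v k xi : normc (modulation v k xi) = 1.
Proof.
by rewrite normc_cexp ReM /= mul0r mulr0 subr0 expR0.
Qed.

Lemma gfun_modulation v k xi :
  gfun A (b + 'i%C *: toC v) (c + 'i%C * k%:c) xi = G xi * modulation v k xi.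
Proof.
rewrite /G /gfun /modulation -cexpD; congr cexp.
rewrite bfDr bfZr bf1_toC rmorphD; ring.
Qed.

Lemma cmeasurable_modulation v k : cmeasurable (modulation v k).
Proof.
apply: cmeasurable_cexp; apply: cmeasurableM; first exact: cmeasurable_cst.
apply: cmeasurableC; apply: measurable_funD; last exact: measurable_cst.
under eq_fun do rewrite /bf mulmx1 mxE.
apply: measurable_sum => j; apply: measurable_funM; first exact: measurable_rV_coord.
exact: measurable_cst.
Qed.

Let h_ v k n xi : C := modulation v k xi * (cutoff n xi)%:c.

Let normc_h v k n xi : normc (h_ v k n xi) <= 1.
Proof.
rewrite /h_ Normc.normcM normc_modulation mul1r normcC.
by rewrite ger0_norm ?cutoff_ge0 ?cutoff_le1.
Qed.

Let mh v k n : cmeasurable (h_ v k n).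
Proof.
apply: cmeasurableM; first exact: cmeasurable_modulation.
by apply: cmeasurableC; exact: measurable_cutoff.
Qed.

Let g v k := gfun A (b + 'i%C *: toC v) (c + 'i%C * k%:c).

Let phi v k n xi : C := G xi * h_ v k n xi.

Let phiE v k n xi : phi v k n xi = g v k xi * (cutoff n xi)%:c.
Proof. by rewrite /g gfun_modulation /phi /h_ mulrA. Qed.

Let ci_phi v k n : cintegrable mu (phi v k n).
Proof.
apply: (le_cintegrable _ (cintegrable_normc (cintegrable_gfun b c AT posA))).
  by apply: cmeasurableM; [exact: cmeasurable_gfun|exact: mh].
by move=> xi; rewrite Normc.normcM ler_piMr ?normc_ge0.
Qed.

Let pphi v k n : powint mu p (phi v k n).
Proof.
apply: (powint_le (ltW p0) _ _ pG) => [|xi].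
  by apply: cmeasurableM; [exact: cmeasurable_gfun|exact: mh].
by rewrite Normc.normcM ler_piMr ?normc_ge0.
Qed.

Let powint_Tphi v k n : powint st q (T (phi v k n)).
Proof.
have [C1 _ /(_ (phi v k n) (ci_phi _ _ _) (pphi _ _ _))] := extension_powint p0 q0 ineq.
by case.
Qed.

Let el_cutoff v k n : pairing st q u (T (phi v k n)) / m0 =
  (\int[mu]_xi (normc (G xi) `^ p * Re (h_ v k n xi))) / n0.
Proof.
apply: (stationary_quotient p0 (ltW q1) u_neq0 (powint_T b c) (powint_Tphi v k n)
  pG (mh v k n) (normc_h v k n) m0_gt0 n0_gt0).
have tf : test_function (phi v k n).
  have := test_function_cutoff n A (b + 'i%C *: toC v) (c + 'i%C * k%:c).
  by rewrite (_ : (fun x => _) = phi v k n)//; apply/funext => xi; rewrite phiE.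
have := crit tf; rewrite /Psi.
have -> // : (fun eps : R => fine (cLnorm st q (T (fun xi => gfun A b c xi + eps%:C%C * phi v k n xi))) /
    fine (cLnorm mu p (fun xi => gfun A b c xi + eps%:C%C * phi v k n xi))) =
  (fun e : R => fine (cLnorm st q (fun x => u x + e%:c * T (phi v k n) x)) /
    fine (cLnorm mu p (fun y => G y + e%:c * (G y * h_ v k n y)))).
apply/funext => e; congr (fine (cLnorm _ _ _) / _); apply/funext => xt.
by rewrite fourier_extDZ//; exact: cintegrable_gfun.
Qed.

Let Ipow_cutoff_cvg v k :
  (fun n => Ipow mu p (fun xi => g v k xi - phi v k n xi)) @ \oo --> (0 : R).
Proof.
have -> : 0 = \int[mu]_xi (0 : R) by rewrite /Rintegral integral0.
have pg : powint mu p (g v k) by exact: powint_gfun.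
have [mg ig] := pg.
have nE n xi : normc (g v k xi - phi v k n xi) `^ p =
    normc (g v k xi) `^ p * (1 - cutoff n xi) `^ p.
  rewrite phiE -{1}(mulr1 (g v k xi)) -mulrBr Normc.normcM powRM ?normc_ge0//.
  rewrite -[1%R]/(1%:c) -rmorphB normcC ger0_norm ?subr_ge0 ?cutoff_le1//.
apply: (Rintegral_dominated_cvg (g := fun xi => normc (g v k xi) `^ p)) => //.
- move=> n; apply: measurable_powint; apply: cmeasurableB => //.
  by have [] := pphi v k n.
- move=> xi; under eq_fun do rewrite nE.
  have cv : (fun n => (1 - cutoff n xi) `^ p) @ \oo --> (0 : R).
    apply/cvgrPdist_le => e e0; near=> n.
    rewrite sub0r normrN ger0_norm ?powR_ge0//.
    have -> : e = (e `^ p^-1) `^ p.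
      by rewrite -powRrM mulVf ?gt_eqF// powRr1// ltW.
    rewrite ge0_ler_powR ?nnegrE ?powR_ge0 ?subr_ge0 ?cutoff_le1 ?(ltW p0)//.
    rewrite (le_trans (ler_norm _))//; near: n.
    have /cvgrPdist_le := @cutoff_cvg R d xi; apply.
    by rewrite powR_gt0.
  have := cvgM (cvg_cst (normc (g v k xi) `^ p)) cv.
  by rewrite mulr0; apply.
- move=> n xi; rewrite nE ger0_norm ?mulr_ge0 ?powR_ge0//.
  rewrite ler_piMr ?powR_ge0//; 
  have p1E : 1 `^ p = 1 :> R by rewrite powR1.
  rewrite -[leRHS]p1E.
  rewrite ge0_ler_powR ?nnegrE ?subr_ge0 ?cutoff_le1 ?(ltW p0)//.
  by rewrite gerBl cutoff_ge0.
Unshelve. all: end_near. Qed.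

Lemma pairingB (w1 w2 : 'rV[R]_d * RT -> C) : powint st q w1 -> powint st q w2 ->
  pairing st q u (fun x => w1 x - w2 x) = pairing st q u w1 - pairing st q u w2.
Proof.
move=> qw1 qw2; rewrite /pairing -RintegralB//.
- by apply: eq_Rintegral => x _; rewrite mulrBr ReD ReN; ring.
- exact: integrable_pairing (ltW q1) u_neq0 (powint_T b c) qw1.
- exact: integrable_pairing (ltW q1) u_neq0 (powint_T b c) qw2.
Qed.

(** The extension inequality turns convergence of phi in L^p into convergence of
    the pairing with its extension. *)
Let pairing_cvg v k :
  (fun n => pairing st q u (T (phi v k n))) @ \oo --> pairing st q u (T (g v k)).
Proof.
have [C1 C10 HC] := extension_powint p0 q0 ineq.
have m1 : 0 < 2 * (m0 + 1) by rewrite mulr_gt0// ltr_wpDl// ltW.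
apply/cvgrPdist_le => e e0.
pose dlt := e / (2 * (m0 + 1)); have d0 : 0 < dlt by rewrite divr_gt0.
pose K := (dlt `^ (q - 1))^-1 * C1.
have K0 : 0 <= K by rewrite mulr_ge0// invr_ge0 powR_ge0.
have K1 : 0 < 2 * (K + 1) by rewrite mulr_gt0// ltr_wpDl.
pose eta := (e / (2 * (K + 1))) `^ (p / q).
have eta0 : 0 < eta by rewrite powR_gt0// divr_gt0.
near=> n.
have Ig : cintegrable mu (g v k) by exact: cintegrable_gfun.
have pD : powint mu p (fun xi => g v k xi - phi v k n xi).
  apply: (powint_le (ltW p0) _ _ (powint_gfun (b + 'i%C *: toC v) (c + 'i%C * k%:c) p0 AT posA)).
    by apply: cmeasurableB; [exact: cmeasurable_gfun|have [] := pphi v k n].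
  move=> xi; rewrite phiE -{1}(mulr1 (g v k xi)) -mulrBr Normc.normcM.
  rewrite -[1%R]/(1%:c) -rmorphB normcC ger0_norm ?subr_ge0 ?cutoff_le1//.
  by rewrite ler_piMr ?normc_ge0// gerBl cutoff_ge0.
have iD : cintegrable mu (fun xi => g v k xi - phi v k n xi) by exact: cintegrableB.
have [qD leD] := HC _ iD pD.
rewrite -(pairingB (powint_T _ _ : powint st q (T (g v k))) (powint_Tphi v k n)).
have TE : (fun x => T (g v k) x - T (phi v k n) x) =
    T (fun xi => g v k xi - phi v k n xi).
  apply/funext => xt; have := @fourier_extDZ R d sigma _ _ (-1) xt Ig (ci_phi v k n).
  by under eq_fun do rewrite mulN1r; move=> ->; rewrite mulN1r.
rewrite TE (le_trans (pairing_small (ltW q1) d0 u_neq0 (powint_T _ _) qD))//.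
rewrite [leRHS]splitr lerD//.
  rewrite -/m0 /dlt -mulrA ler_wpM2l ?(ltW e0)//.
  rewrite mulrC ler_pdivrMr// mulrC -subr_ge0.
  have -> : 2 * (m0 + 1) / 2 - m0 = 1 by field.
  exact: ler01.
apply: (@le_trans _ _ (K * (e / (2 * (K + 1))))).
  rewrite /K -mulrA ler_wpM2l ?invr_ge0 ?powR_ge0// (le_trans leD)// ler_wpM2l//.
  have -> : e / (2 * (K + 1)) = eta `^ (q / p).
    rewrite /eta -powRrM; have -> : p / q * (q / p) = 1 by field; rewrite !gt_eqF.
    by rewrite powRr1// divr_ge0 ?ltW.
  rewrite ge0_ler_powR ?nnegrE ?Ipow_ge0 ?(ltW eta0) ?divr_ge0 ?(ltW q0) ?(ltW p0)//.
  rewrite (le_trans (ler_norm _))// -normrN -sub0r; near: n.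
  by move/cvgrPdist_le : (Ipow_cutoff_cvg v k); apply.
have K1' : 0 < K + 1 by rewrite ltr_wpDl.
have -> : K * (e / (2 * (K + 1))) = e / 2 * (K / (K + 1)) by field; rewrite gt_eqF.
rewrite ler_piMr ?divr_ge0 ?(ltW e0)//.
by rewrite ler_pdivrMr// mul1r lerDl.
Unshelve. all: end_near. Qed.

(** A modulated copy of the Gaussian is not compactly supported, but it is a limit
    of test functions, and both sides are continuous along that limit. *)
Lemma el_modulation v k : pairing st q u (T (g v k)) / m0 =
  (\int[mu]_xi (normc (G xi) `^ p * Re (modulation v k xi))) / n0.
Proof.
have h1 : (fun n => pairing st q u (T (phi v k n)) / m0) @ \oo -->
    pairing st q u (T (g v k)) / m0.
  by apply: cvgM; [exact: pairing_cvg|exact: cvg_cst].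
have h2 : (fun n => pairing st q u (T (phi v k n)) / m0) @ \oo -->
    (\int[mu]_xi (normc (G xi) `^ p * Re (modulation v k xi))) / n0.
  under eq_fun do rewrite el_cutoff.
  apply: cvgM; last exact: cvg_cst.
  have [mG iG] := pG.
  apply: (Rintegral_dominated_cvg (g := fun xi => normc (G xi) `^ p)) => //.
  - move=> n; apply: measurable_funM; first exact: measurable_powint.
    by have [] := mh v k n.
  - apply: measurable_funM; first exact: measurable_powint.
    by have [] := cmeasurable_modulation v k.
  - move=> xi; apply: cvgM; first exact: cvg_cst.
    have -> : (fun n => Re (h_ v k n xi)) =
        (fun n => Re (modulation v k xi) * cutoff n xi).
      by apply/funext => n; rewrite /h_ ReM ReC ImC mulr0 subr0.
    have := cvgM (cvg_cst (Re (modulation v k xi))) (@cutoff_cvg R d xi).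
    by rewrite mulr1; apply.
  - move=> n xi; rewrite normrM ger0_norm ?powR_ge0// ler_piMr ?powR_ge0//.
    by rewrite (le_trans (ler_Re _)).
exact: cvg_unique h1 h2.
Qed.

Let corr v (xt : 'rV[R]_d * RT) : C :=
  (normc (u xt) `^ (q - 2))%:c * (conjc (u xt) * u (xt.1 + v, xt.2)).

Let T_gE v k xt : T (g v k) xt = cexp ('i%C * k%:c) * u (xt.1 + v, xt.2).
Proof.
rewrite /u -fourier_ext_gfun_shift !fourier_extE -cintegralZ; last first.
  by apply: cintegrable_ext_kernel; exact: cintegrable_gfun.
apply: eq_cintegral => xi; rewrite mulrCA; congr (_ * _).
by rewrite /g /gfun -cexpD; congr cexp; ring.
Qed.

Let u0 xt : (xt.1 + 0, xt.2) = xt :> 'rV[R]_d * RT.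
Proof. by rewrite addr0; case: xt. Qed.

Let ReT_g0 v xt : normc (u xt) `^ (q - 2) * Re (conjc (u xt) * T (g v 0) xt) =
  Re (corr v xt).
Proof.
rewrite T_gE mulr0 cexp0 mul1r /corr; move: (conjc (u xt) * _) => z.
by rewrite ReM ReC ImC mul0r subr0.
Qed.

(** The phase -pi/2 extracts the imaginary part of the correlation. *)
Let ReT_gpi v xt : normc (u xt) `^ (q - 2) *
  Re (conjc (u xt) * T (g v (- (pi / 2))) xt) = Im (corr v xt).
Proof.
rewrite T_gE.
have -> : cexp ('i%C * (- (pi / 2))%:c) = - 'i%C :> C.
  rewrite cexpE; apply: complex_eq; rewrite !ReImE /= ?mul0r ?mulr0 ?subr0 ?addr0 ?add0r ?mul1r.
    by rewrite expR0 cosN cos_pihalf mulr0 oppr0.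
  by rewrite expR0 sinN sin_pihalf mul1r.
rewrite /corr mulrCA; move: (conjc (u xt) * _) => z.
by rewrite !ReImE /=; ring.
Qed.

Let ci_corr v : cintegrable st (corr v).
Proof.
split.
- apply: eq_integrable (integrable_pairing (ltW q1) u_neq0 (powint_T b c)
    (powint_T (b + 'i%C *: toC v) (c + 'i%C * 0%:c))) => //.
  by move=> xt _; rewrite (ReT_g0 v).
- apply: eq_integrable (integrable_pairing (ltW q1) u_neq0 (powint_T b c)
    (powint_T (b + 'i%C *: toC v) (c + 'i%C * (- (pi / 2))%:c))) => //.
  by move=> xt _; rewrite (ReT_gpi v).
Qed.

Let gcorr v (xi : 'rV[R]_d) : C := (normc (G xi) `^ p)%:c * modulation v 0 xi.

Let modulation_pi v xi : Re (modulation v (- (pi / 2)) xi) = Im (modulation v 0 xi).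
Proof.
rewrite /modulation !cexpE addr0 !ReImE /= !(mul0r, mulr0, subr0, addr0, add0r, mul1r).
by rewrite cosBpihalf oppr0.
Qed.

(** The phases 0 and -pi/2 combine into one complex identity. *)
Lemma el_correlation v : cintegral st (corr v) / m0%:c =
  cintegral mu (gcorr v) / n0%:c.
Proof.
have h0 := el_modulation v 0; have hpi := el_modulation v (- (pi / 2)).
have e1 : Re (cintegral st (corr v)) = pairing st q u (T (g v 0)).
  by apply: eq_Rintegral => xt _; rewrite ReT_g0.
have e2 : Im (cintegral st (corr v)) = pairing st q u (T (g v (- (pi / 2)))).
  by apply: eq_Rintegral => xt _; rewrite ReT_gpi.
have e3 : Re (cintegral mu (gcorr v)) =
    \int[mu]_xi (normc (G xi) `^ p * Re (modulation v 0 xi)).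
  by apply: eq_Rintegral => xi _; rewrite /gcorr ReM ReC ImC mul0r subr0.
have e4 : Im (cintegral mu (gcorr v)) =
    \int[mu]_xi (normc (G xi) `^ p * Re (modulation v (- (pi / 2)) xi)).
  by apply: eq_Rintegral => xi _; rewrite /gcorr ImM ReC ImC mul0r addr0 modulation_pi.
have Cinv (a : R) (z : C) : z / a%:c = z * (a^-1)%:c by rewrite fmorphV.
have sRe (z : C) (a : R) : Re (z * a%:c) = Re z * a.
  by rewrite ReM ReC ImC mulr0 subr0.
have sIm (z : C) (a : R) : Im (z * a%:c) = Im z * a.
  by rewrite ImM ReC ImC mulr0 add0r.
rewrite !Cinv; apply: complex_eq.
- rewrite !sRe; apply: (etrans (congr1 (fun x => x * m0^-1) e1)).
  by apply: (etrans h0); rewrite e3.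
- rewrite !sIm; apply: (etrans (congr1 (fun x => x * m0^-1) e2)).
  by apply: (etrans hpi); rewrite e4.
Qed.

Let P := mRe A.
Let Pi := invmx P.
Let xi0 := freq_center A b.

Let PT : P^T = P. Proof. exact: mRe_sym. Qed.
Let PU : P \in unitmx. Proof. exact: posdef_unit. Qed.

Let gcorrE v xi : gcorr v xi = cexp (- qf (toC (p *: P)) (toC xi) +
  bf 1%:M (toC xi) (toC (p *: mRe b) + 'i%C *: toC v) + (p * Re c)%:c).
Proof.
rewrite /gcorr /G /gfun /modulation normc_cexp addr0 -expRM -cexpC -cexpD.
congr cexp; rewrite !qf_bf bfDr bfZr bf1_toC bf1_toC bf_toC.
rewrite bfMZ bfZr; apply: complex_eq; rewrite !ReImE /=; last by ring.
rewrite bf_toCE -(map_mx1 (real_complex R)).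
have -> : Re (bf (toC 1%:M) (toC xi) b) = bf 1%:M xi (mRe b).
  rewrite {1}(mx_ReIm b) bfDr bfZr !bf_toC !ReImE /=; ring.
by rewrite !ReImE /=; ring.
Qed.

Lemma cintegral_gcorr v : cintegral mu (gcorr v) =
  n0%:c * cexp ('i%C * bf 1%:M (toC v) (toC xi0) - ((4 * p)^-1 * qf Pi v)%:c).
Proof.
pose M := toC (p *: P).
have MT : M^T = M by rewrite /M map_trmx linearZ /= PT.
have posM : posdef (mRe M).
  move=> x x0; have -> : mRe M = p *: P by apply/matrixP => i j; rewrite !mxE.
  by rewrite qf_bf bfMZ -qf_bf mulr_gt0// posA.
have [Z Z0 HZ] := cintegral_gauss_dot MT posM.
have gE w : cintegral mu (gcorr w) =
    cexp (4^-1 * qf (invmx M) (toC (p *: mRe b) + 'i%C *: toC w) + (p * Re c)%:c) * Z.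
  by rewrite -HZ; apply: eq_cintegral => xi; rewrite gcorrE.
have n0E : n0%:c = cintegral mu (gcorr 0).
  have m1 xi : modulation 0 0 xi = 1.
    by rewrite /modulation /bf trmx0 mulmx0 mxE addr0 mulr0 cexp0.
  have gc0 xi : gcorr 0 xi = (normc (G xi) `^ p)%:c by rewrite /gcorr m1 mulr1.
  rewrite (eq_cintegral _ gc0).
  apply: complex_eq; rewrite /cintegral /= ?ImC ?ReC//.
  by rewrite /Rintegral integral0.
have ME : invmx M = toC (p^-1 *: Pi).
  apply: invmx_uniq; rewrite -map_mxM -scalemxAl -scalemxAr scalerA mulfV ?gt_eqF//.
  by rewrite scale1r mulmxV// map_mx1.
have key : 4^-1 * qf (toC (p^-1 *: Pi)) (toC (p *: mRe b) + 'i%C *: toC v) =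
  4^-1 * qf (toC (p^-1 *: Pi)) (toC (p *: mRe b) + 'i%C *: toC 0) +
  ('i%C * bf 1%:M (toC v) (toC xi0) - ((4 * p)^-1 * qf Pi v)%:c).
  rewrite map_mx0 scaler0 addr0 !qf_bf !(bfDl, bfDr, bfZl, bfZr) !bf_toC.
  have -> : bf 1%:M (toC v) (toC xi0) = (2^-1 * bf Pi v (mRe b))%:c.
    rewrite bf1_toC /xi0 /freq_center bfZr bf_mulmx mul1mx.
    by rewrite /Pi trmx_inv PT.
  have PiT : Pi^T = Pi by rewrite /Pi trmx_inv PT.
  rewrite !bfMZ !bfZl !bfZr (bfC (mRe b) v PiT).
  move: (bf Pi v (mRe b)) (bf Pi v v) (bf Pi (mRe b) (mRe b)) => y1 y2 y3.
  by apply: complex_eq; rewrite !ReImE /=; field; rewrite ?gt_eqF.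
rewrite n0E !gE ME key; move: (4^-1 * _) ('i%C * _ - _) (p * _)%:c => y1 y2 y3.
by rewrite !cexpD; ring.
Qed.

(** The Euler-Lagrange equation of a critical Gaussian, tested against all its
    modulations: the time slices of the extension contribute complex Gaussians
    in v with quadratic forms invmx (Mt sigma A t), and their integral against J is
    a real Gaussian. *)
Lemma el_identity : exists J : R -> R, exists2 m : R, 0 < m &
  forall v : 'rV[R]_d,
  let F := fun t : RT => (J t)%:c *
    cexp (- (((1 - 2 / q) / 4)%:c * qf (invmx (Mt sigma A t)) (toC v))) in
  cintegrable (@lebesgue_measure R) F /\
  cintegral (@lebesgue_measure R) F =
    m%:c * cexp (- ((p^-1 - q^-1) / 4 * qf Pi v)%:c).
Proof.
have slice t := gauss_ft_correlation (Mt_sym sigma t AT)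
  (eq_ind_r (@posdef R d) posA (mRe_Mt sigma A t)) b c q0.
have [J HJ] := choice slice; exists J, m0 => // v F.
(* the phase and the part of the exponent that do not depend on time *)
pose kap : C := cexp ('i%C * bf 1%:M (toC v) (toC xi0) - ((4 * q)^-1 * qf Pi v)%:c).
have sliceE t : cintegral mu (fun x => corr v (x, t)) = kap * F t.
  have -> : (fun x => corr v (x, t)) = (fun x =>
      (normc (gauss_ft (Mt sigma A t) b c x) `^ (q - 2))%:c *
      (conjc (gauss_ft (Mt sigma A t) b c x) * gauss_ft (Mt sigma A t) b c (x + v))).
    by apply/funext => x; rewrite /corr /u !fourier_ext_gfun.
  rewrite (HJ t v).2 /F mulrCA -cexpD; congr (_ * cexp _).
  have -> : freq_center (Mt sigma A t) b = xi0 by rewrite /xi0 /freq_center mRe_Mt.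
  rewrite mRe_Mt -/P -/Pi.
  have -> : qf (toC Pi) (toC v) = (qf Pi v)%:c by exact: bf_toC.
  move: (bf 1%:M _ _) (qf (invmx _) _) (qf Pi v) => y1 y2 y3.
  have -> : ((1 - 2 / q) / 4)%:c = 4^-1 * (1 - 2 / q)%:c :> C.
    by apply: complex_eq; rewrite !ReImE /=; field; rewrite gt_eqF.
  have -> : ((4 * q)^-1 * y3)%:c = 4^-1 * (q^-1%:c * y3%:c) :> C.
    by apply: complex_eq; rewrite !ReImE /=; field; rewrite gt_eqF.
  by ring.
have sliceI t : cintegrable (leb_rV R d) (fun x => corr v (x, t)).
  have [+ _] := HJ t v; apply: eq_cintegrable => x.
  by rewrite /corr /u !fourier_ext_gfun.
have ci : cintegrable (leb_rV R d \x @lebesgue_measure R)%E (corr v).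
  exact: (ci_corr v).
have k0 : kap != 0 by exact: cexp_neq0.
have FE t : F t = kap^-1 * cintegral mu (fun x => corr v (x, t)).
  by rewrite sliceE mulKf.
have ciS := cintegrable_prod2 ci sliceI.
split.
  by apply: eq_cintegrable (cintegrableZ kap^-1 ciS) => t; rewrite FE.
rewrite (eq_cintegral _ FE) (cintegralZ kap^-1 ciS) -(cintegral_prod2 ci sliceI).
have m00 : m0%:c != 0 :> C by rewrite fmorph_eq0 gt_eqF.
have n00 : n0%:c != 0 :> C by rewrite fmorph_eq0 gt_eqF.
have := el_correlation v; rewrite cintegral_gcorr (mulrC n0%:c) mulfK// => h.
have {}h : cintegral st (corr v) = m0%:c *
    cexp ('i%C * bf 1%:M (toC v) (toC xi0) - ((4 * p)^-1 * qf Pi v)%:c).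
  by rewrite -h mulrCA mulfV// mulr1.
apply: etrans (congr1 _ h) _; rewrite mulrCA /kap -cexpN -cexpD.
congr (_ * cexp _); move: (bf _ _ _) (qf Pi v) => y1 y2.
by apply: complex_eq; rewrite !ReImE /=; field; rewrite ?gt_eqF.
Qed.

End euler_lagrange.

(** * Moments of the time average *)

Section taylor.
Context (R : realType).
Local Notation C := R[i].

Lemma is_derive_bound (h h' : R -> R) (K : R) (n : nat) :
  (forall s : R, is_derive s 1 h (h' s)) -> h 0 = 0 -> 0 <= K ->
  (forall s, 0 <= s <= 1 -> `|h' s| <= K * s ^+ n) ->
  forall s, 0 <= s <= 1 -> `|h s| <= K * s ^+ n.+1.
Proof.
move=> dh h0 K0 hb s /andP[s0 s1].
have [->|sn0] := eqVneq s 0; first by rewrite h0 normr0 expr0n mulr0.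
have sp : 0 < s by rewrite lt_neqAle eq_sym sn0.
have cont : {within `[0, s], continuous h}.
  by apply: continuous_subspaceT => x; exact: is_derive_continuous (dh x).
have [c] := MVT sp (fun x _ => dh x) cont.
rewrite in_itv /= => /andP[c0 cs]; rewrite h0 !subr0 => ->.
rewrite normrM (ger0_norm s0) exprSr mulrA ler_wpM2r//.
have c01 : 0 <= c <= 1 by rewrite (ltW c0) (le_trans (ltW cs)).
by rewrite (le_trans (hb c c01))// ler_wpM2l// lerXn2r ?nnegrE ?(ltW c0) ?(ltW cs).
Qed.

Lemma is_cderive_bound (h h' : R -> C) (K : R) (n : nat) :
  (forall s, is_cderive h s (h' s)) -> h 0 = 0 -> 0 <= K ->
  (forall s, 0 <= s <= 1 -> normc (h' s) <= K * s ^+ n) ->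
  forall s, 0 <= s <= 1 -> normc (h s) <= 2 * K * s ^+ n.+1.
Proof.
move=> dh h0 K0 hb s s01; rewrite (le_trans (normc_le_ReIm _))//.
rewrite -mulrA mulr_natl mulr2n lerD//.
- apply: (is_derive_bound (h := fun s => Re (h s)) (h' := fun s => Re (h' s))) => //.
  + by move=> x; case: (dh x).
  + by rewrite h0.
  + by move=> x x01; rewrite (le_trans (ler_Re _)) ?hb.
- apply: (is_derive_bound (h := fun s => Im (h s)) (h' := fun s => Im (h' s))) => //.
  + by move=> x; case: (dh x).
  + by rewrite h0.
  + by move=> x x01; rewrite (le_trans (ler_Im _)) ?hb.
Qed.

Definition taylor2 (s : R) (z : C) : C :=
  cexp (s%:c * z) - 1 - s%:c * z - 2^-1 * (s%:c * z) ^+ 2.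

(** The remainders of orders 0, 1 and 2 form a chain: up to the factor z, each is the
    derivative in s of the next. *)
Lemma taylor2_le (K : R) (z : C) (s : R) : normc z <= K -> 0 <= s <= 1 ->
  normc (taylor2 s z) <= 8 * (K ^+ 3 * expR K) * s ^+ 3.
Proof.
move=> zK s01; have K0 : 0 <= K := le_trans (normc_ge0 z) zK.
have idd (x : R) : is_cderive (fun t : R => t%:c) x 1.
  exact: is_cderive_real (is_derive_id x 1).
have dsz x : is_cderive (fun t : R => t%:c * z) x z.
  apply: is_cderive_eq (is_cderiveM (idd x) (is_cderive_cst z x)) _.
  by rewrite mul1r mulr0 addr0.
pose h0 (t : R) := cexp (t%:c * z) - 1.
pose h1 (t : R) := h0 t - t%:c * z.
have c0 (x : R) : is_cderive h0 x (z * cexp (x%:c * z)).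
  apply: is_cderive_eq (is_cderiveD (is_cderive_cexp (dsz x)) (is_cderive_cst (-1) x)) _.
  by rewrite addr0.
have cN (x : R) : is_cderive (fun t : R => - (t%:c * z)) x (- z).
  have -> : (fun t : R => - (t%:c * z)) = (fun t : R => -1 * (t%:c * z)).
    by apply/funext => t; rewrite mulN1r.
  apply: is_cderive_eq (is_cderiveM (is_cderive_cst (-1) x) (dsz x)) _.
  by rewrite mul0r add0r mulN1r.
have c1 (x : R) : is_cderive h1 x (z * h0 x).
  apply: is_cderive_eq (is_cderiveD (c0 x) (cN x)) _.
  by rewrite /h0 mulrBr mulr1.
have c2 (x : R) : is_cderive (taylor2 ^~ z) x (z * h1 x).
  have cq : is_cderive (fun t : R => - (2^-1 * (t%:c * z) ^+ 2)) x (- z * (x%:c * z)).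
    have -> : (fun t : R => - (2^-1 * (t%:c * z) ^+ 2)) =
        (fun t : R => (- 2^-1) * ((t%:c * z) * (t%:c * z))).
      by apply/funext => t; rewrite expr2 mulNr.
    apply: is_cderive_eq (is_cderiveM (is_cderive_cst (- 2^-1) x)
      (is_cderiveM (dsz x) (dsz x))) _.
    by rewrite mul0r add0r; field.
  apply: is_cderive_eq (is_cderiveD (c1 x) cq) _.
  by rewrite /h1; ring.
have E0 : 0 <= K * expR K by rewrite mulr_ge0 ?expR_ge0.
have b0 x : 0 <= x <= 1 -> normc (h0 x) <= 2 * (K * expR K) * x ^+ 1.
  apply: is_cderive_bound c0 _ _ _ x; rewrite /h0 ?mul0r ?cexp0 ?subrr//.
  move=> y /andP[y0 y1]; rewrite expr0 mulr1 Normc.normcM ler_pM ?normc_ge0//.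
  rewrite normc_cexp ler_expR (le_trans (ler_norm _))// (le_trans (ler_Re _))//.
  by rewrite Normc.normcM normcC (ger0_norm y0) (le_trans _ zK)// ler_piMl ?normc_ge0.
have E1 : 0 <= K * (2 * (K * expR K)) by rewrite !mulr_ge0 ?expR_ge0.
have b1 x : 0 <= x <= 1 -> normc (h1 x) <= 2 * (K * (2 * (K * expR K))) * x ^+ 2.
  apply: is_cderive_bound c1 _ _ _ x; rewrite /h1 /h0 ?mul0r ?cexp0 ?subrr ?subr0//.
  move=> y y01; rewrite Normc.normcM -mulrA.
  by rewrite ler_pM ?normc_ge0//; exact: b0.
have E2 : 0 <= K * (2 * (K * (2 * (K * expR K)))) by rewrite !mulr_ge0 ?expR_ge0.
have b2 := is_cderive_bound c2 _ E2 _ s01.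
apply: le_trans (b2 2%N _ _) _.
- by rewrite /taylor2 mul0r cexp0 subrr subr0 expr0n mulr0 subr0.
- move=> y y01; rewrite Normc.normcM -[leRHS]mulrA ler_pM ?normc_ge0//.
  exact: b1.
- by rewrite le_eqVlt; apply/orP; left; apply/eqP; ring.
Qed.

Lemma le_small_eq0 (x K : R) : 0 <= x ->
  (forall s, 0 < s <= 1 -> x <= s * K) -> x = 0.
Proof.
move=> x0 h; apply/eqP; rewrite eq_le x0 andbT; apply/ler_addgt0Pl => e e0.
have K0 : 0 <= K by rewrite -[K]mul1r (le_trans x0)// h// ltr01 lexx.
have K1 : 0 < K + 1 by rewrite ltr_wpDl.
pose s := Order.min 1 (e / (K + 1)).
have s0 : 0 < s by rewrite lt_min ltr01 divr_gt0.
rewrite addr0 (le_trans (h s _))//; first by rewrite s0 ge_min lexx.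
apply: (@le_trans _ _ (e / (K + 1) * K)).
  by rewrite ler_wpM2r// ge_min lexx orbT.
by rewrite mulrAC ler_pdivrMr// ler_wpM2l ?(ltW e0)// lerDl.
Qed.

(** Divide by s and let s tend to 0, twice. *)
Lemma quadratic_small_eq0 (a b : C) (K : R) :
  (forall s, 0 < s <= 1 -> normc (s%:c * a + (s ^+ 2)%:c * b) <= K * s ^+ 3) ->
  a = 0 /\ b = 0.
Proof.
move=> h; have a0 : a = 0.
  apply/eqP; rewrite -normc_eq0; apply/eqP.
  apply: (le_small_eq0 (K := K + normc b)) (normc_ge0 _) _ => s s01.
  have /andP[s0 s1] := s01; rewrite -(ler_pM2l s0).
  have -> : s * normc a = normc (s%:c * a) by rewrite Normc.normcM normcC gtr0_norm.
  have -> : s%:c * a = (s%:c * a + (s ^+ 2)%:c * b) + - ((s ^+ 2)%:c * b).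
    by rewrite addrK.
  rewrite (le_trans (normcD _ _))// normcN Normc.normcM normcC ger0_norm ?sqr_ge0//.
  have hs := h s s01.
  have K0 : 0 <= K.
    have := le_trans (normc_ge0 _) (h 1 _); rewrite expr1n mulr1 lexx ltr01.
    by apply.
  have : K * s ^+ 3 <= K * s ^+ 2.
    by rewrite ler_wpM2l// exprS ler_piMl ?sqr_ge0.
  by move: hs; move: (normc (_ + _)) => x; move: (normc b) => y; nra.
split=> //; apply/eqP; rewrite -normc_eq0; apply/eqP.
apply: (le_small_eq0 (K := K)) (normc_ge0 _) _ => s s01.
have /andP[s0 s1] := s01; have := h s s01; rewrite a0 mulr0 add0r.
rewrite Normc.normcM normcC ger0_norm ?sqr_ge0//.
have s20 : 0 < s ^+ 2 by rewrite exprn_gt0.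
have -> : K * s ^+ 3 = s ^+ 2 * (s * K) by ring.
by rewrite ler_pM2l.
Qed.

End taylor.

Section measurable_matrix.
Context d (T : measurableType d) (R : realType).
Local Notation C := R[i].

Definition cmeasurable_mx m n (M : T -> 'M[C]_(m, n)) :=
  forall i j, cmeasurable (fun t => M t i j).

Lemma cmeasurable_det n (M : T -> 'M[C]_n) : cmeasurable_mx M ->
  cmeasurable (fun t => \det (M t)).
Proof.
move=> mM; rewrite /determinant; apply: cmeasurable_sum => s _.
apply: cmeasurableM; first exact: cmeasurable_cst.
by apply: cmeasurable_prod => i _; exact: mM.
Qed.

Lemma cmeasurable_invmx n (M : T -> 'M[C]_n) : (forall t, M t \in unitmx) ->
  cmeasurable_mx M -> cmeasurable_mx (fun t => invmx (M t)).
Proof.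
move=> uM mM i j; under eq_fun do rewrite /invmx uM !mxE.
apply: cmeasurableM; first by apply: cmeasurableV; exact: cmeasurable_det.
apply: cmeasurableM; first exact: cmeasurable_cst.
apply: cmeasurable_det => k l; under eq_fun do rewrite !mxE.
exact: mM.
Qed.

End measurable_matrix.

Section moments.
Context (R : realType).
Local Notation C := R[i].
Local Notation RT := (measurableTypeR R).
Local Notation leb := (@lebesgue_measure R).

Variable J : R -> R.
Hypothesis iJ : cintegrable leb (fun t : RT => (J t)%:c).

(** The class on which the average against J is finite and linear; it is closed under
    products, as needed for second moments. *)
Definition bounded_cm (f : RT -> C) :=
  cmeasurable f /\ exists K, forall t, normc (f t) <= K.

Definition avg (f : RT -> C) : C := cintegral leb (fun t : RT => (J t)%:c * f t).

Lemma bounded_cmD f g : bounded_cm f -> bounded_cm g ->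
  bounded_cm (fun t => f t + g t).
Proof.
move=> [mf [K fK]] [mg [L gL]]; split; first exact: cmeasurableD.
by exists (K + L) => t; rewrite (le_trans (normcD _ _))// lerD.
Qed.

Lemma bounded_cmM f g : bounded_cm f -> bounded_cm g ->
  bounded_cm (fun t => f t * g t).
Proof.
move=> [mf [K fK]] [mg [L gL]]; split; first exact: cmeasurableM.
by exists (K * L) => t; rewrite Normc.normcM ler_pM ?normc_ge0.
Qed.

Lemma bounded_cm_cst (z : C) : bounded_cm (fun=> z).
Proof. by split; [exact: cmeasurable_cst|exists (normc z)]. Qed.

Lemma bounded_cmZ z f : bounded_cm f -> bounded_cm (fun t => z * f t).
Proof. by move=> bf_; apply: bounded_cmM => //; exact: bounded_cm_cst. Qed.

Lemma bounded_cm_sum (I : Type) (r : seq I) (F : I -> RT -> C) :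
  (forall i, bounded_cm (F i)) -> bounded_cm (fun t => \sum_(i <- r) F i t).
Proof.
move=> bF; elim: r => [|i r IHr].
  by under eq_fun do rewrite big_nil; exact: bounded_cm_cst.
by under eq_fun do rewrite big_cons; exact: bounded_cmD.
Qed.

Lemma cintegrable_avg f : bounded_cm f ->
  cintegrable leb (fun t : RT => (J t)%:c * f t).
Proof.
move=> [mf [K fK]].
apply: (le_cintegrable _ (integrableZl measurableT K (cintegrable_normc iJ))).
  by apply: cmeasurableM => //; exact: cintegrable_cmeasurable iJ.
by move=> t; rewrite Normc.normcM mulrC ler_wpM2r ?normc_ge0.
Qed.

Lemma avgD f g : bounded_cm f -> bounded_cm g ->
  avg (fun t => f t + g t) = avg f + avg g.
Proof.
move=> bf_ bg; rewrite /avg -cintegralD; try exact: cintegrable_avg.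
by apply: eq_cintegral => t; rewrite mulrDr.
Qed.

Lemma avgZ z f : bounded_cm f -> avg (fun t => z * f t) = z * avg f.
Proof.
move=> bf_; rewrite /avg -cintegralZ; last exact: cintegrable_avg.
by apply: eq_cintegral => t; rewrite mulrCA.
Qed.

Lemma avg_sum (I : Type) (r : seq I) (F : I -> RT -> C) :
  (forall i, bounded_cm (F i)) ->
  avg (fun t => \sum_(i <- r) F i t) = \sum_(i <- r) avg (F i).
Proof.
move=> bF; elim: r => [|i r IHr].
  rewrite big_nil; under eq_fun do rewrite big_nil.
  by rewrite -[0 in LHS](mul0r (1 : C)) avgZ ?mul0r//; exact: bounded_cm_cst.
rewrite big_cons -IHr -avgD//; last exact: bounded_cm_sum.
by congr avg; apply/funext => t; rewrite big_cons.
Qed.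

Lemma eq_avg f g : f =1 g -> avg f = avg g.
Proof. by move=> fg; congr avg; exact/funext. Qed.

Lemma normc_avg_le f K : bounded_cm f -> (forall t, normc (f t) <= K) ->
  normc (avg f) <= K * \int[leb]_t `|J t|.
Proof.
move=> bf_ fK; rewrite (le_trans (le_normc_cintegral (cintegrable_avg bf_)))//.
have iJn : leb.-integrable setT (EFin \o (fun t => `|J t|)).
  by apply: eq_integrable (cintegrable_normc iJ) => // t _; congr (_%:E); exact: normcC.
rewrite -RintegralZl//; apply: le_Rintegral => //.
- exact: cintegrable_normc (cintegrable_avg bf_).
- exact: (integrableZl measurableT K iJn).
- by move=> t _; rewrite Normc.normcM normcC mulrC ler_wpM2r.
Qed.

(** The second-order Taylor remainders of both sides are O(s^3), because z is
    bounded; the coefficients of s and s^2 must then agree. *)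
Lemma moments_of_exponential (z : RT -> C) (m : R) (w : C) : bounded_cm z ->
  avg (fun=> 1) = m%:c ->
  (forall s, 0 < s <= 1 -> avg (fun t => cexp (s%:c * z t)) = m%:c * cexp (s%:c * w)) ->
  avg z = m%:c * w /\ avg (fun t => z t ^+ 2) = m%:c * w ^+ 2.
Proof.
move=> bz m1 ez; have [mz [K0 zK0]] := bz.
pose K := Order.max K0 (normc w).
have zK t : normc (z t) <= K by rewrite le_max zK0.
have wK : normc w <= K by rewrite le_max lexx orbT.
have bz2 : bounded_cm (fun t => z t ^+ 2).
  by under eq_fun do rewrite expr2; exact: bounded_cmM.
have bsz (s : R) : bounded_cm (fun t => s%:c * z t) by exact: bounded_cmZ.
have bE (s : R) : 0 < s <= 1 -> bounded_cm (fun t => cexp (s%:c * z t)).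
  move=> /andP[s0 s1]; split; first by apply: cmeasurable_cexp; case: (bsz s).
  exists (expR K) => t; rewrite normc_cexp ler_expR (le_trans (ler_norm _))//.
  rewrite (le_trans (ler_Re _))// Normc.normcM normcC gtr0_norm//.
  by rewrite (le_trans _ (zK t))// ler_piMl ?normc_ge0// ltW.
pose L := (`|m| + \int[leb]_t `|J t|) * (8 * (K ^+ 3 * expR K)).
have [] := @quadratic_small_eq0 R (avg z - m%:c * w)
  (2^-1 * (avg (fun t => z t ^+ 2) - m%:c * w ^+ 2)) L.
  move=> s s01; have s01' : 0 <= s <= 1 by case/andP: s01 => /ltW -> ->.
  have tE : (fun t => taylor2 s (z t)) = (fun t => (cexp (s%:c * z t) + (-1) * 1) +
      ((- s%:c) * z t + (- (2^-1 * (s ^+ 2)%:c)) * z t ^+ 2)).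
    by apply/funext => t; rewrite /taylor2 rmorphXn /=; ring.
  have bt : bounded_cm (fun t => taylor2 s (z t)).
    rewrite tE; apply: bounded_cmD.
      by apply: bounded_cmD; [exact: bE|exact/bounded_cmZ/bounded_cm_cst].
    by apply: bounded_cmD; exact: bounded_cmZ.
  have E1 : avg (fun t => taylor2 s (z t)) = m%:c * cexp (s%:c * w) - m%:c
      - s%:c * avg z - 2^-1 * (s ^+ 2)%:c * avg (fun t => z t ^+ 2).
    rewrite tE avgD; first last.
    - by apply: bounded_cmD; exact: bounded_cmZ.
    - by apply: bounded_cmD; [exact: bE|exact/bounded_cmZ/bounded_cm_cst].
    rewrite avgD; first last.
    - exact/bounded_cmZ/bounded_cm_cst.
    - exact: bE.
    rewrite avgD; [|exact: bounded_cmZ|exact: bounded_cmZ].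
    rewrite avgZ; last exact: bounded_cm_cst.
    by rewrite (avgZ _ bz) (avgZ _ bz2) ez// m1; ring.
  have -> : s%:c * (avg z - m%:c * w) +
      (s ^+ 2)%:c * (2^-1 * (avg (fun t => z t ^+ 2) - m%:c * w ^+ 2)) =
      m%:c * taylor2 s w + - avg (fun t => taylor2 s (z t)).
    by rewrite E1 /taylor2 rmorphXn /=; ring.
  rewrite (le_trans (normcD _ _))// normcN /L mulrDl mulrDl lerD//.
    rewrite Normc.normcM normcC -mulrA ler_wpM2l//.
    exact: taylor2_le.
  rewrite -mulrA mulrC; apply: normc_avg_le => // t.
  exact: taylor2_le.
move=> /eqP; rewrite subr_eq0 => /eqP-> /eqP; rewrite mulf_eq0 invr_eq0 pnatr_eq0 /=.
by rewrite subr_eq0 => /eqP ->.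
Qed.

End moments.

(** The eight combinations v1 + e2 v2 + e3 v3 + e4 v4, tagged with the parity of the
    number of minus signs. *)
Definition polar_signs (V : zmodType) (v1 v2 v3 v4 : V) : seq (bool * V) :=
  [:: (false, v1 + v2 + v3 + v4); (true, v1 + v2 + v3 - v4);
      (true, v1 + v2 - v3 + v4); (false, v1 + v2 - v3 - v4);
      (true, v1 - v2 + v3 + v4); (false, v1 - v2 + v3 - v4);
      (false, v1 - v2 - v3 + v4); (true, v1 - v2 - v3 - v4)].

Section polarization.
Context (F : fieldType) (n : nat) (M : 'M[F]_n).
Hypothesis MT : M^T = M.

Definition quartic (v1 v2 v3 v4 : 'rV[F]_n) : F :=
  bf M v1 v2 * bf M v3 v4 + bf M v1 v3 * bf M v2 v4 + bf M v1 v4 * bf M v2 v3.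

(** Polarization of the quartic form v |-> (qf M v) ^+ 2: the alternating sum kills
    every monomial except v1 v2 v3 v4. *)
Lemma quartic_polar v1 v2 v3 v4 : 64 * quartic v1 v2 v3 v4 =
  \sum_(w <- polar_signs v1 v2 v3 v4) (-1) ^+ w.1 * qf M w.2 ^+ 2.
Proof.
rewrite !big_cons big_nil /= expr0 expr1 !mul1r !mulN1r.
rewrite /quartic !qf_bf !(bfDl, bfDr, bfNl, bfNr).
rewrite (bfC v2 v1 MT) (bfC v3 v1 MT) (bfC v4 v1 MT) (bfC v3 v2 MT)
  (bfC v4 v2 MT) (bfC v4 v3 MT).
move: (bf M v1 v1) (bf M v2 v2) (bf M v3 v3) (bf M v4 v4) (bf M v1 v2) (bf M v1 v3)
  (bf M v1 v4) (bf M v2 v3) (bf M v2 v4) (bf M v3 v4) => *.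
by ring.
Qed.

(** The difference of the quartic forms at (a, i, i, m) and (a, m, m, i), with the
    index a contracted against the rows m and i of B.  For B = S A and M = R_t the
    product B M is S + i t R_t, and the antisymmetry in i and m removes the terms
    containing t. *)
Definition contraction (B : 'M[F]_n) (i m : 'I_n) : F :=
  \sum_a B m a * (2 * M a i * M i m + M a m * M i i) -
  \sum_a B i a * (2 * M a m * M i m + M a i * M m m).

Lemma contractionE (B : 'M[F]_n) i m : contraction B i m =
  2 * (B *m M) m i * M i m + (B *m M) m m * M i i -
  (2 * (B *m M) i m * M i m + (B *m M) i i * M m m).
Proof.
rewrite /contraction !mxE.
by congr (_ - _); rewrite !(mulr_sumr, mulr_suml) -big_split /=; apply: eq_bigr => a _; ring.
Qed.

End polarization.

Section conclusion.
Context (R : realType) (d : nat) (sigma : 'I_d -> R).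
Local Notation C := R[i].
Local Notation RT := (measurableTypeR R).
Local Notation leb := (@lebesgue_measure R).
Local Notation toC := (map_mx (real_complex R)).
Local Notation mRe := (map_mx (@complex.Re R)).

Hypothesis hsigma : forall j, sigma j = 1 \/ sigma j = -1.
Variable A : 'M[C]_d.
Hypotheses (AT : A^T = A) (posA : posdef (mRe A)).
Variables (k k' m : R) (J : R -> R).
Hypothesis m0 : 0 < m.

Let Pi := invmx (mRe A).
Let Rt t := invmx (Mt sigma A t).
Let S := smx sigma.

Hypothesis identity : forall v : 'rV[R]_d,
  let F := fun t : RT => (J t)%:c * cexp (- (k%:c * qf (Rt t) (toC v))) in
  cintegrable leb F /\ cintegral leb F = m%:c * cexp (- (k' * qf Pi v)%:c).

Let posM t : posdef (mRe (Mt sigma A t)). Proof. by rewrite mRe_Mt. Qed.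
Let MtT t : (Mt sigma A t)^T = Mt sigma A t. Proof. exact: Mt_sym. Qed.
Let RtT t : (Rt t)^T = Rt t. Proof. by rewrite /Rt trmx_inv MtT. Qed.
Let PT : (mRe A)^T = mRe A. Proof. exact: mRe_sym. Qed.
Let PiT : Pi^T = Pi. Proof. by rewrite /Pi trmx_inv PT. Qed.
Let PU : mRe A \in unitmx. Proof. exact: posdef_unit. Qed.

Let iJ : cintegrable leb (fun t : RT => (J t)%:c).
Proof.
have [+ _] := identity 0; apply: eq_cintegrable => t.
by rewrite /qf map_mx0 !mul0mx mxE mulr0 oppr0 cexp0 mulr1.
Qed.

Let X v (t : RT) : C := qf (Rt t) (toC v).

Let mRt : cmeasurable_mx (fun t : RT => Rt t).
Proof.
apply: cmeasurable_invmx; first by move=> t; exact: symmetric_unit.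
move=> i j; under eq_fun do rewrite /Mt !mxE.
apply: cmeasurableB; first exact: cmeasurable_cst.
apply: cmeasurableM; last exact: cmeasurable_cst.
apply: cmeasurableM; first exact: cmeasurable_cst.
by apply: cmeasurableC; exact: measurable_id.
Qed.

Let bX v : bounded_cm (X v).
Proof.
split; last first.
  exists (2 * qf Pi v) => t; have := normc_qf_inv (MtT t) (posM t) v.
  by rewrite mRe_Mt.
rewrite /X; under eq_fun do rewrite qfE.
apply: cmeasurable_sum => j _; apply: cmeasurableM; last exact: cmeasurable_cst.
apply: cmeasurable_sum => i _; apply: cmeasurableM; first exact: cmeasurable_cst.
exact: mRt.
Qed.

Let avg1 : avg J (fun=> 1) = m%:c.
Proof.
have [_] := identity 0.
rewrite {2}/qf mul0mx mul0mx mxE mulr0 oppr0 cexp0 mulr1 => <-.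
by apply: eq_cintegral => t; rewrite /qf map_mx0 !mul0mx mxE mulr0 oppr0 cexp0.
Qed.

(** Scaling v by r multiplies all forms by s = r^2. *)
Let moments v : k%:c * avg J (X v) = (k' * m * qf Pi v)%:c /\
  (k ^+ 2)%:c * avg J (fun t => X v t ^+ 2) = (k' ^+ 2 * m * qf Pi v ^+ 2)%:c.
Proof.
have bX2 : bounded_cm (fun t => X v t ^+ 2).
  by under eq_fun do rewrite expr2; exact: bounded_cmM.
have [] := @moments_of_exponential R J iJ (fun t => (- k%:c) * X v t) m
  (- (k' * qf Pi v)%:c) (bounded_cmZ _ (bX v)) avg1.
  move=> s /andP[s0 _]; pose r := Num.sqrt s.
  have rs : r ^+ 2 = s by rewrite sqr_sqrtr// ltW.
  have [_] := identity (r *: v).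
  have -> : qf Pi (r *: v) = s * qf Pi v.
    by rewrite !qf_bf bfZl bfZr mulrA -expr2 rs.
  have XE t : qf (Rt t) (toC (r *: v)) = s%:c * X v t.
    rewrite /X map_mxZ !qf_bf bfZl bfZr mulrA -rs rmorphXn /= expr2.
    by [].
  have -> : - (k' * (s * qf Pi v))%:c = s%:c * - (k' * qf Pi v)%:c :> C.
    by rewrite mulrN -rmorphM mulrCA.
  move=> <-; apply: eq_cintegral => t; rewrite XE; congr (_ * cexp _); ring.
rewrite avgZ// => e1; have -> : (fun t => (- k%:c * X v t) ^+ 2) =
    (fun t => (k ^+ 2)%:c * X v t ^+ 2).
  by apply/funext => t; rewrite exprMn sqrrN rmorphXn.
rewrite avgZ// => e2; split.
  apply: oppr_inj; rewrite -mulNr e1 mulrN -rmorphM; congr (- _%:c); ring.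
by rewrite e2 sqrrN -rmorphXn -rmorphM; congr (_%:c); ring.
Qed.

Let avg_quartic v1 v2 v3 v4 : (k ^+ 2)%:c *
    avg J (fun t => quartic (Rt t) (toC v1) (toC v2) (toC v3) (toC v4)) =
  (k' ^+ 2 * m * quartic Pi v1 v2 v3 v4)%:c.
Proof.
have bX2 v : bounded_cm (fun t => X v t ^+ 2).
  by under eq_fun do rewrite expr2; exact: bounded_cmM.
have n64 : (64 : C) != 0 by rewrite pnatr_eq0.
pose vs := polar_signs v1 v2 v3 v4.
have vsC : polar_signs (toC v1) (toC v2) (toC v3) (toC v4) =
    [seq (w.1, toC w.2) | w <- vs].
  by rewrite /vs /polar_signs /= !(map_mxD, map_mxN).
have qR t : quartic (Rt t) (toC v1) (toC v2) (toC v3) (toC v4) =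
    64^-1 * \sum_(w <- vs) (-1) ^+ w.1 * X w.2 t ^+ 2.
  by apply: (mulfI n64); rewrite mulVKf// quartic_polar// vsC big_map.
have qPi : quartic Pi v1 v2 v3 v4 = 64^-1 * \sum_(w <- vs) (-1) ^+ w.1 * qf Pi w.2 ^+ 2.
  have n64' : (64 : R) != 0 by rewrite pnatr_eq0.
  by apply: (mulfI n64'); rewrite mulVKf// quartic_polar.
have V64 : (64^-1)%:c = 64^-1 :> C by rewrite fmorphV rmorph_nat.
rewrite (eq_avg J qR) (avgZ iJ); last by apply: bounded_cm_sum => w; exact: bounded_cmZ.
rewrite (avg_sum iJ); last by move=> w; exact: bounded_cmZ.
have -> : (k' ^+ 2 * m * quartic Pi v1 v2 v3 v4)%:c = 64^-1 *
    (k' ^+ 2 * m * \sum_(w <- vs) (-1) ^+ w.1 * qf Pi w.2 ^+ 2)%:c :> C.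
  rewrite qPi mulrCA; apply: etrans (rmorphM (real_complex R) _ _) _.
  by congr (_ * _); exact: V64.
rewrite mulrCA; have -> // : (k ^+ 2)%:c * (\sum_(w <- vs) avg J (fun t : RT => (-1) ^+ w.1 * X w.2 t ^+ 2)) =
  (k' ^+ 2 * m * \sum_(w <- vs) (-1) ^+ w.1 * qf Pi w.2 ^+ 2)%:c.
rewrite !mulr_sumr rmorph_sum; apply: eq_bigr => w _.
rewrite (avgZ iJ)// mulrCA (moments _).2 -(rmorph_sign (real_complex R)) -rmorphM.
by congr (_%:c); ring.
Qed.

Let toC_delta j : toC (delta_mx ord0 j : 'rV[R]_d) = delta_mx ord0 j.
Proof. exact: map_delta_mx. Qed.

Let X_delta j t : X (delta_mx ord0 j) t = Rt t j j.
Proof. by rewrite /X toC_delta qf_bf bf_delta. Qed.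

Let bR a b : bounded_cm (fun t : RT => Rt t a b).
Proof.
have e t : Rt t a b = 4^-1 * X (delta_mx ord0 a + delta_mx ord0 b) t +
    (- 4^-1) * X (delta_mx ord0 a - delta_mx ord0 b) t.
  rewrite /X !map_mxD map_mxN !toC_delta !qf_bf !(bfDl, bfDr, bfNl, bfNr).
  rewrite (bfC (delta_mx ord0 b) (delta_mx ord0 a) (RtT t)) !bf_delta.
  move: (Rt t a a) (Rt t a b) (Rt t b b) => x y z; by field.
by under eq_fun do rewrite e; apply: bounded_cmD; exact: bounded_cmZ.
Qed.

Let B := toC S *m A.

Let SS : S *m S = 1%:M.
Proof.
apply/matrixP => i j; rewrite /S /smx mul_diag_mx !mxE.
by case: eqP => [->|_]; rewrite ?mulr0//= mulr1n; case: (hsigma j) => ->; ring.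
Qed.

Let BRt t : B *m Rt t = toC S + ('i%C * t%:c) *: Rt t.
Proof.
have MU : Mt sigma A t *m Rt t = 1%:M by exact/mulmxV/symmetric_unit.
have -> : B = toC S *m Mt sigma A t + ('i%C * t%:c) *: 1%:M.
  by rewrite /Mt mulmxBr -scalemxAr -map_mxM -/S SS map_mx1 subrK.
by rewrite mulmxDl -mulmxA MU mulmx1 -scalemxAl mul1mx.
Qed.

(** Only the real part S of the product matters in the contraction. *)
Let BPi : B *m toC Pi = toC S + 'i%C *: toC (S *m map_mx (@complex.Im R) A *m Pi).
Proof.
rewrite /B [A in LHS]mx_ReIm -mulmxA mulmxDl -map_mxM mulmxV// map_mx1.
by rewrite -scalemxAl -map_mxM mulmxDr mulmx1 -scalemxAr -map_mxM mulmxA.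
Qed.

Let quartic_delta (M : 'M[C]_d) a i j : quartic M (delta_mx ord0 a)
    (delta_mx ord0 i) (delta_mx ord0 i) (delta_mx ord0 j) =
  2 * M a i * M i j + M a j * M i i.
Proof. by rewrite /quartic !bf_delta; ring. Qed.

Let contraction_quartic (M : 'M[C]_d) i j : M^T = M ->
  contraction M B i j = \sum_a (B j a * quartic M (delta_mx ord0 a)
    (delta_mx ord0 i) (delta_mx ord0 i) (delta_mx ord0 j) +
  (- B i a) * quartic M (delta_mx ord0 a)
    (delta_mx ord0 j) (delta_mx ord0 j) (delta_mx ord0 i)).
Proof.
move=> MT; have Mji : M j i = M i j by rewrite -[in LHS]MT mxE.
rewrite /contraction -sumrB; apply: eq_bigr => a _.
by rewrite !quartic_delta Mji mulNr.
Qed.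

Let bquartic a i j : bounded_cm (fun t : RT => quartic (Rt t) (delta_mx ord0 a)
    (delta_mx ord0 i) (delta_mx ord0 i) (delta_mx ord0 j)).
Proof.
under eq_fun do rewrite quartic_delta.
by apply: bounded_cmD; apply: bounded_cmM => //; exact: bounded_cmZ.
Qed.

Let avg_contraction i j : (k ^+ 2)%:c * avg J (fun t => contraction (Rt t) B i j) =
  (k' ^+ 2 * m)%:c * contraction (toC Pi) B i j.
Proof.
have PiTC : (toC Pi)^T = toC Pi by rewrite map_trmx PiT.
rewrite (contraction_quartic _ _ PiTC).
rewrite (eq_avg J (fun t => contraction_quartic i j (RtT t))) (avg_sum iJ); last first.
  by move=> a; apply: bounded_cmD; exact: bounded_cmZ.
rewrite !mulr_sumr; apply: eq_bigr => a _.
rewrite (avgD iJ); [|exact: bounded_cmZ|exact: bounded_cmZ].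
rewrite (avgZ iJ (B j a) (bquartic a i j)) (avgZ iJ (- B i a) (bquartic a j i)).
have q v1 v2 v3 v4 : (k ^+ 2)%:c *
    avg J (fun t => quartic (Rt t) (toC v1) (toC v2) (toC v3) (toC v4)) =
    (k' ^+ 2 * m)%:c * quartic (toC Pi) (toC v1) (toC v2) (toC v3) (toC v4).
  have -> : quartic (toC Pi) (toC v1) (toC v2) (toC v3) (toC v4) =
      (quartic Pi v1 v2 v3 v4)%:c.
    by rewrite /quartic !bf_toC !(rmorphD (real_complex R)) !(rmorphM (real_complex R)).
  rewrite avg_quartic; exact: (rmorphM (real_complex R)).
have := q (delta_mx ord0 a) (delta_mx ord0 i) (delta_mx ord0 i) (delta_mx ord0 j).
have := q (delta_mx ord0 a) (delta_mx ord0 j) (delta_mx ord0 j) (delta_mx ord0 i).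
rewrite !toC_delta; move: (avg J _) (avg J _) (quartic (toC Pi) _ _ _ _)
  (quartic (toC Pi) _ _ _ _) => x y z w ex ey.
by rewrite !mulrDr mulrCA (mulrCA _ (- B i a)) ey ex; ring.
Qed.

Let entryE (N : 'M[C]_d) (z : C) a b :
  (toC S + z *: N) a b = (sigma a *+ (a == b))%:c + z * N a b.
Proof. by rewrite !mxE. Qed.

(** Since sigma i and sigma j are opposite, the surviving terms sigma j R_ii - sigma i R_jj
    of the contraction add up instead of cancelling, and their average is known
    both from the second moments and from the first ones. *)
Lemma exponents_agree i j : sigma i = -1 -> sigma j = 1 -> k' != 0 -> k = k'.
Proof.
move=> si sj k0; have ij : i != j.
  by apply: contra_eq_neq si => ->; rewrite sj; lra.
have cR t : contraction (Rt t) B i j = Rt t i i + Rt t j j.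
  rewrite contractionE BRt.
  have Rji : Rt t j i = Rt t i j by rewrite -[in LHS]RtT mxE.
  rewrite !entryE !eqxx eq_sym (negPf ij) /= si sj Rji mulr1n mulr0n.
  by rewrite (rmorph0 (real_complex R)) (rmorphN1 (real_complex R))
    (rmorph1 (real_complex R)); ring.
have cPi : Re (contraction (toC Pi) B i j) = Pi i i + Pi j j.
  rewrite contractionE BPi; move: (S *m _ *m Pi) => N.
  rewrite !entryE !eqxx eq_sym (negPf ij) /= si sj mulr1n mulr0n.
  rewrite !mxE natCE !ReImE /=; ring.
have Pi0 l : 0 < Pi l l.
  have -> : Pi l l = qf Pi (delta_mx ord0 l) by rewrite qf_bf bf_delta.
  have PC : mRe (toC (mRe A)) = mRe A by apply/matrixP => a b; rewrite !mxE.
  have PCT : (toC (mRe A))^T = toC (mRe A) by rewrite map_trmx PT.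
  have := @mRe_inv_posdef R d (toC (mRe A)) PCT.
  rewrite PC => /(_ posA); rewrite -map_invmx.
  have -> : mRe (toC (invmx (mRe A))) = Pi by apply/matrixP => a b; rewrite !mxE.
  apply; apply/eqP => /matrixP /(_ ord0 l) /eqP.
  by rewrite !mxE !eqxx oner_eq0.
have mo l : k * Re (avg J (fun t => Rt t l l)) = k' * m * Pi l l.
  have [h _] := moments (delta_mx ord0 l).
  rewrite (eq_avg J (X_delta l)) in h.
  move/(congr1 (@complex.Re R)): h; rewrite ReM ReC ImC mul0r subr0 => -> /=.
  by rewrite qf_bf bf_delta.
have /(congr1 (@complex.Re R)) := avg_contraction i j.
have sRe (a : R) (z : C) : Re (a%:c * z) = a * Re z.
  by rewrite ReM ReC ImC mul0r subr0.
rewrite (eq_avg J cR) (avgD iJ (bR i i) (bR j j)) !sRe cPi ReD => h.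
have : k' * m * (Pi i i + Pi j j) * (k - k') = 0.
  have e : k' * m * (Pi i i + Pi j j) =
      k * (Re (avg J (fun t => Rt t i i)) + Re (avg J (fun t => Rt t j j))).
    by rewrite !mulrDr !mo.
  by rewrite mulrBr {1}e mulrAC -expr2 h; ring.
move=> /eqP; rewrite !mulf_eq0 (negPf k0) gt_eqF//= gt_eqF ?addr_gt0//= subr_eq0.
by move/eqP.
Qed.

End conclusion.

Lemma opposite_signs (R : realType) d (sigma : 'I_d -> R) :
  (forall j, sigma j = 1 \/ sigma j = -1) -> ~ (forall j k, sigma j = sigma k) ->
  exists i j, sigma i = -1 /\ sigma j = 1.
Proof.
move=> s1 hyp; apply: contrapT => h; apply: hyp => j k.
case: (s1 j) (s1 k) => [sj|sj] [sk|sk]; rewrite ?sj ?sk//; exfalso; apply: h.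
- by exists k, j.
- by exists j, k.
Qed.

Theorem theorem1 (R : realType) (d : nat) (sigma : 'I_d -> R) (p : R)
    (hsigma : forall j, sigma j = 1 \/ sigma j = -1)
    (hyperbolic : ~ (forall j k, sigma j = sigma k))
    (hp : 1 < p < 2 * (d%:R + 1) / d%:R) :
  let p' := p / (p - 1) in
  let q := (d%:R + 2) * p' / d%:R in
  extension_inequality sigma p q ->
  forall G : 'rV[R]_d -> R[i], is_gaussian G -> ~ critical_point sigma p q G.
Proof.
move=> p' q ineq G gaussG crit.
have [i [j [si sj]]] := opposite_signs hsigma hyperbolic.
have d0 : 0 < d%:R :> R by rewrite ltr0n; exact: leq_ltn_trans (ltn_ord i).
have [p1 p2] : 1 < p /\ p < 2 * (d%:R + 1) / d%:R by move/andP: hp.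
have p0 : 0 < p := lt_trans ltr01 p1.
have p10 : 0 < p - 1 by rewrite subr_gt0.
have pd : p * d%:R < 2 * (d%:R + 1) by rewrite -ltr_pdivlMr.
have qE : q = (d%:R + 2) * p / (d%:R * (p - 1)).
  by rewrite /q /p'; field; rewrite !gt_eqF.
have dp0 : 0 < d%:R * (p - 1) by rewrite mulr_gt0.
have qp : p < q.
  rewrite qE ltr_pdivlMr// mulrC ltr_pM2r//; nra.
have q1 : 1 < q := lt_trans p1 qp.
have q0 : 0 < q := lt_trans ltr01 q1.
have [A [b [c [AT posA GE]]]] := is_gaussianP gaussG.
rewrite GE in crit.
have [J [m m0 HJ]] := el_identity p1 q1 AT posA ineq crit.
have k0 : (p^-1 - q^-1) / 4 != 0 :> R.
  by rewrite mulf_neq0 ?invr_neq0 ?pnatr_eq0// subr_eq0 gt_eqF// ltf_pV2.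
have := exponents_agree hsigma AT posA m0 HJ si sj k0.
move=> /(congr1 (fun x => x * 4 * p * q)) /eqP; apply/negP.
have -> : (1 - 2 / q) / 4 * 4 * p * q = p * q - 2 * p by field; rewrite gt_eqF.
have -> : (p^-1 - q^-1) / 4 * 4 * p * q = q - p by field; rewrite !gt_eqF.
(* equality would mean that q is the dual exponent of p *)
have -> : (p * q - 2 * p == q - p) = (q * (d%:R * (p - 1)) == p * d%:R).
  rewrite -subr_eq0 -[RHS]subr_eq0.
  have -> : p * q - 2 * p - (q - p) = q * (p - 1) - p by ring.
  have -> : q * (d%:R * (p - 1)) - p * d%:R = (q * (p - 1) - p) * d%:R by ring.
  by rewrite mulf_eq0 (gt_eqF d0) orbF.
by rewrite qE divfK ?gt_eqF//; nra.
Qed.
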